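(* Let $(R,\mathfrak m)$ be a Cohen-Macaulay local ring of dimension $d$, and let $I$ be an $\mathfrak m$-primary ideal of $R$ containing a parameter ideal $Q=(x_1,\ldots,x_d)$ as a reduction. Suppose that $I$ is an Ulrich ideal but not a parameter ideal. Consider the following assertions: (i) $R$ is Gorenstein; (ii) for every horizontally linked $R$-module $M$, $M$ is Ulrich with respect to $I$ if and only if $\lambda M$ is Ulrich with respect to $I$; (iii) for every horizontally linked $R$-module $M$ which is Ulrich with respect to $I$, the module $\lambda M$ is maximal Cohen-Macaulay; (iv) $\mathrm{Ext}_R^{d+2}(R/I,R)=0$. Then: (a) (i) $\Rightarrow$ (ii) $\Rightarrow$ (iii); (b) if $d\ge 2$, then (iii) $\Rightarrow$ (iv); (c) if $d\ge 2$ and $I=\mathfrak m$, then all four conditions are equivalent.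
   Context: All rings are commutative and Noetherian with 1; ''finite'' module means finitely generated. A finite $R$-module $M$ is maximal Cohen-Macaulay if $\mathrm{depth}_R M=\dim R$ (the zero module, of depth $+\infty$, is not). A parameter ideal is an ideal generated by a system of parameters. That $Q\subset I$ is a reduction of $I$ means $QI^r=I^{r+1}$ for some $r\ge 0$. The ideal $I$ is Ulrich if $I^2=QI$ and $I/I^2$ is a free $R/I$-module. A finite $R$-module $M$ is Ulrich with respect to $I$ if $M$ is maximal Cohen-Macaulay, $IM=QM$, and $M/IM$ is a free $R/I$-module. For a finite $R$-module $M$ with minimal free presentation $F_1\xrightarrow{\partial_1}F_0\to M\to 0$, the Auslander transpose is $\mathrm{Tr}\,M=\mathrm{coker}(\mathrm{Hom}_R(F_0,R)\xrightarrow{\partial_1^*}\mathrm{Hom}_R(F_1,R))$, and the syzygy module is $\Omega M=\mathrm{Im}\,\partial_1\subset F_0$. Set $\lambda M=\Omega\,\mathrm{Tr}\,M$. A finite $R$-module $M$ is horizontally linked if $M\cong\lambda(\lambda M)$. *)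

(* Defs.v *)
From HB Require Import structures.
From mathcomp Require Import all_boot all_order all_algebra.
From mathcomp Require Import boolp classical_sets functions.

Set Implicit Arguments.
Unset Strict Implicit.
Unset Printing Implicit Defensive.

Import GRing.Theory.
Local Open Scope ring_scope.
Local Open Scope quotient_scope.

Section SubQuotient.
Variables (R : comNzRingType) (V : lmodType R) (U : submodClosed V).

(* [submodClosed] only records the semimodule closure properties, whereas the
   quotient of ring_quotient asks for closure under opposite as well. *)
Definition pred_of_submod : {pred V} := U.
Lemma pred_of_submod_closed : zmod_closed pred_of_submod.
Proof.
by split=> [|x y Ux Uy]; rewrite /pred_of_submod ?rpred0 // -scaleN1r rpredD ?rpredZ.
Qed.
HB.instance Definition _ :=
  GRing.isZmodClosed.Build V pred_of_submod pred_of_submod_closed.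

Definition submod := {x : V | x \in U}.
HB.instance Definition _ := SubChoice.on submod.
HB.instance Definition _ := [SubChoice_isSubLmodule of submod by <:].

Definition quotmod := {ideal_quot pred_of_submod}.
HB.instance Definition _ := GRing.Zmodule.on quotmod.
HB.instance Definition _ := EqQuotient.on quotmod.

Definition quotmod_scale (a : R) (q : quotmod) : quotmod :=
  \pi_quotmod (a *: repr q).

Lemma quotmod_scale_pi a x :
  quotmod_scale a (\pi_quotmod x) = \pi_quotmod (a *: x).
Proof.
apply/eqP; rewrite /quotmod_scale -Quotient.idealrBE -scalerBr.
rewrite (@GRing.rpredZ R V U) // -[_ \in U]/(_ \in pred_of_submod).
by rewrite Quotient.idealrBE reprK.
Qed.

Let piD (x y : V) : \pi_quotmod (x + y) = \pi_quotmod x + \pi_quotmod y.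
Proof. by rewrite piE. Qed.

Let quotmod_scaleA a b v :
  quotmod_scale a (quotmod_scale b v) = quotmod_scale (a * b) v.
Proof. by elim/quotW: v => v; rewrite (quotmod_scale_pi b) !quotmod_scale_pi scalerA. Qed.
Let quotmod_scale1 : left_id 1 quotmod_scale.
Proof. by elim/quotW=> v; rewrite quotmod_scale_pi scale1r. Qed.
Let quotmod_scaleDr : right_distributive quotmod_scale +%R.
Proof.
move=> a; elim/quotW=> u; elim/quotW=> v.
by rewrite -piD (quotmod_scale_pi a u) (quotmod_scale_pi a v)
  quotmod_scale_pi -piD scalerDr.
Qed.
Let quotmod_scaleDl v : {morph quotmod_scale^~ v : a b / a + b}.
Proof.
by move=> a b; elim/quotW: v => v; rewrite (quotmod_scale_pi a) (quotmod_scale_pi b)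
  quotmod_scale_pi scalerDl piD.
Qed.

HB.instance Definition _ := GRing.Zmodule_isLmodule.Build R quotmod
  quotmod_scaleA quotmod_scale1 quotmod_scaleDr quotmod_scaleDl.
End SubQuotient.

Definition isomorphic (R : comNzRingType) (V W : lmodType R) :=
  exists f : {linear V -> W}, bijective f.

Section Submodules.
Variables (R : comNzRingType).
Implicit Types V W : lmodType R.

Definition mspan_pred V (S : set V) : {pred V} := fun v =>
  `[< exists n (a : 'I_n -> R) (g : 'I_n -> V),
        (forall i, S (g i)) /\ v = \sum_(i < n) a i *: g i >].

Lemma mspan_closed V (S : set V) : submod_closed (mspan_pred S).
Proof.
split=> [|c u v].
  by apply/asboolP; exists 0, (fun=> 0), (fun=> 0); split=> [[]|]; rewrite ?big_ord0.
case/asboolP=> n [a [g [Sg ->]]]; case/asboolP=> p [b [h [Sh ->]]].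
apply/asboolP; exists (n + p)%N.
exists (fun i => match fintype.split i with inl j => c * a j | inr j => b j end).
exists (fun i => match fintype.split i with inl j => g j | inr j => h j end).
split=> [i|]; first by case: (fintype.split i).
rewrite big_split_ord /= scaler_sumr; congr (_ + _); apply: eq_bigr => i _.
  by rewrite (unsplitK (inl i)) scalerA.
by rewrite (unsplitK (inr i)).
Qed.
HB.instance Definition _ V (S : set V) :=
  GRing.isSubmodClosed.Build R V (mspan_pred S) (mspan_closed S).
Definition mspan V (S : set V) : submodClosed V := mspan_pred S.

Definition fullmod V : submodClosed V := mspan setT.

Definition mker_pred V W (f : {linear V -> W}) : {pred V} := fun v => f v == 0.
Lemma mker_closed V W (f : {linear V -> W}) : submod_closed (mker_pred f).
Proof.
split=> [|c u v]; rewrite !unfold_in ?linear0 // => /eqP fu /eqP fv.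
by rewrite linearP fu fv scaler0 addr0.
Qed.
HB.instance Definition _ V W (f : {linear V -> W}) :=
  GRing.isSubmodClosed.Build R V (mker_pred f) (mker_closed f).
Definition mker V W (f : {linear V -> W}) : submodClosed V := mker_pred f.

Definition mim_pred V W (f : {linear V -> W}) : {pred W} := fun w =>
  `[< exists v, f v = w >].
Lemma mim_closed V W (f : {linear V -> W}) : submod_closed (mim_pred f).
Proof.
split=> [|c _ _ /asboolP[u <-] /asboolP[v <-]]; apply/asboolP.
  by exists 0; rewrite linear0.
by exists (c *: u + v); rewrite linearP.
Qed.
HB.instance Definition _ V W (f : {linear V -> W}) :=
  GRing.isSubmodClosed.Build R W (mim_pred f) (mim_closed f).
Definition mim V W (f : {linear V -> W}) : submodClosed W := mim_pred f.

(* The part of [W] lying in [U], as a submodule of [U]. *)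
Definition mtrace_pred V (U W : submodClosed V) : {pred submod U} :=
  fun u => val u \in W.
Arguments mtrace_pred : clear implicits.
Lemma mtrace_closed V (U W : submodClosed V) : submod_closed (mtrace_pred _ U W).
Proof.
split=> [|c u v]; rewrite !unfold_in.
  exact: (rpred0 W).
move=> Wu Wv.
exact: (rpredD (rpredZ c Wu) Wv).
Qed.
HB.instance Definition _ V (U W : submodClosed V) :=
  GRing.isSubmodClosed.Build R (submod U) (mtrace_pred _ U W) (mtrace_closed U W).
Definition mtrace V (U W : submodClosed V) : submodClosed (submod U) :=
  mtrace_pred V U W.

End Submodules.

Section Hom.
Variables (R : comNzRingType).
Implicit Types U V W : lmodType R.

Definition hom_pred V W : {pred V -> W} := fun f => `[< linear f >].
Lemma hom_closed V W : submod_closed (@hom_pred V W).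
Proof.
split=> [|c f g /asboolP lf /asboolP lg]; apply/asboolP.
  by move=> a x y; rewrite scaler0 addr0.
move=> a x y; rewrite /= !fctE /= lf lg !scalerDr !scalerA mulrC.
by rewrite addrACA.
Qed.
HB.instance Definition _ V W :=
  GRing.isSubmodClosed.Build R (V -> W) (@hom_pred V W) (@hom_closed V W).

Definition Hom V W : lmodType R := submod (@hom_pred V W : submodClosed (V -> W)).

Lemma precomp_subproof U V W (f : {linear U -> V}) (g : Hom V W) :
  (val g \o f) \in @hom_pred U W.
Proof.
apply/asboolP => a x y /=; rewrite linearP.
by have /asboolP -> := valP g.
Qed.
(* The map f^* : Hom(V, W) -> Hom(U, W), g |-> g o f. *)
Definition precomp U V W (f : {linear U -> V}) (g : Hom V W) : Hom U W :=
  exist _ (val g \o f) (precomp_subproof f g).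
Lemma precomp_linear U V W (f : {linear U -> V}) : linear (@precomp U V W f).
Proof. by move=> a g h; apply: val_inj; apply/funext. Qed.
HB.instance Definition _ U V W (f : {linear U -> V}) :=
  GRing.isLinear.Build R (Hom V W) (Hom U W) _ (@precomp U V W f)
    (precomp_linear f).
End Hom.

Notation ideal R := (submodClosed (R^o : lmodType R)).

Section Ideals.
Variables (R : comNzRingType).
Implicit Types (I J K P Q m : ideal R) (M V : lmodType R).

Definition generated V (s : seq V) : submodClosed V := mspan [set v | v \in s].

Definition ideal_gen (s : seq R) : ideal R := generated (s : seq R^o).

Definition ideal_mul I V (U : submodClosed V) : submodClosed V :=
  mspan [set v | exists2 a : R, a \in I & exists2 u, u \in U & v = a *: u].

Fixpoint ideal_pow I n : ideal R :=
  if n is n'.+1 then ideal_mul I (ideal_pow I n') else fullmod (R^o : lmodType R).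

Definition noetherian_ring := forall J, exists s : seq R, J =i ideal_gen s.

Definition prime_ideal P := (1 : R) \notin P /\ prime_idealr_closed (P : {pred R}).

Definition maximal_ideal J :=
  (1 : R) \notin J /\
  forall K, (1 : R) \notin K -> {subset J <= K} -> K =i J.

Definition local_ring m := maximal_ideal m /\ forall J, maximal_ideal J -> J =i m.

Definition prime_chain n (p : nat -> ideal R) :=
  (forall i, (i <= n)%N -> prime_ideal (p i)) /\
  (forall i, (i < n)%N -> {subset p i <= p i.+1} /\ ~ p i =i p i.+1).

Definition krull_dim n :=
  (exists p, prime_chain n p) /\ forall k p, prime_chain k p -> (k <= n)%N.

Definition primary_to m I :=
  [/\ (1 : R) \notin I,
      forall a b : R, a * b \in I -> a \in I \/ exists n, b ^+ n \in I
    & forall a : R, a \in m <-> exists n, a ^+ n \in I].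

Definition parameter_ideal m J :=
  exists d (x : d.-tuple R),
    [/\ krull_dim d, primary_to m (ideal_gen x) & J =i ideal_gen x].

Definition reduction Q I :=
  {subset Q <= I} /\
  exists r, ideal_mul Q (ideal_pow I r) =i ideal_pow I r.+1.

Definition finite_module M := exists s : seq M, forall v, v \in generated s.

Definition regular_sequence M (s : seq R) :=
  (forall i, (i < size s)%N ->
     forall y : quotmod (ideal_mul (ideal_gen (take i s)) (fullmod M)),
       s`_i *: y = 0 -> y = 0) /\
  exists y : quotmod (ideal_mul (ideal_gen s) (fullmod M)), y != 0.

(* No [n] satisfies this when [M] is zero, whose depth is infinite. *)
Definition depth m M n :=
  (exists s : seq R,
     [/\ size s = n, {subset s <= m} & regular_sequence M s]) /\
  forall s : seq R, {subset s <= m} -> regular_sequence M s -> (size s <= n)%N.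

Definition maximal_CM m M :=
  finite_module M /\ exists2 d, krull_dim d & depth m M d.

(* For an R-module [N] killed by [I], an R-linear bijection with a power of R/I
   is the same thing as an R/I-linear one. *)
Definition free_over_quot I (N : lmodType R) :=
  exists n, isomorphic N {ffun 'I_n -> quotmod I}.

Definition Ulrich_ideal I Q :=
  ideal_mul I I =i ideal_mul Q I /\
  free_over_quot I (quotmod (mtrace I (ideal_mul I I))).

Definition Ulrich_module m I Q M :=
  [/\ maximal_CM m M,
      ideal_mul I (fullmod M) =i ideal_mul Q (fullmod M)
    & free_over_quot I (quotmod (ideal_mul I (fullmod M)))].

End Ideals.

Section Linkage.
Variables (R : comNzRingType) (m : ideal R).
Implicit Types M : lmodType R.

Record free_map := FreeMap {
  src_rank : nat;
  tgt_rank : nat;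
  free_map_fun :> {linear 'rV[R]_src_rank -> 'rV[R]_tgt_rank} }.

Definition minimal_presentation M (D : free_map) :=
  exists eps : {linear 'rV[R]_(tgt_rank D) -> M},
    [/\ forall v, exists u, eps u = v,
        mim D =i mker eps,
        {subset mker eps <= ideal_mul m (fullmod 'rV[R]_(tgt_rank D))}
      & {subset mker D <= ideal_mul m (fullmod 'rV[R]_(src_rank D))}].

(* Over a Noetherian local ring every finite module has a minimal free
   presentation, unique up to isomorphism; we pick one, with a dummy value for
   modules that have none. *)
Definition minpres M : free_map :=
  match pselect (exists D, minimal_presentation M D) with
  | left ex => projT1 (cid ex)
  | right _ => @FreeMap 0 0 \0
  end.

Definition syzygy M : lmodType R := submod (mim (minpres M)).

Definition transpose_module M : lmodType R :=
  quotmod (mim (precomp (W := R^o) (minpres M))).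

Definition lambda M : lmodType R := syzygy (transpose_module M).

Definition horizontally_linked M :=
  finite_module M /\ isomorphic M (lambda (lambda M)).

End Linkage.

Section Homological.
Variables (R : comNzRingType).
Implicit Types M N : lmodType R.

Record free_resolution M := FreeResolution {
  res_rank : nat -> nat;
  res_diff n : {linear 'rV[R]_(res_rank n.+1) -> 'rV[R]_(res_rank n)};
  res_aug : {linear 'rV[R]_(res_rank 0) -> M};
  res_aug_surj : forall v, exists u, res_aug u = v;
  res_exact0 : mim (res_diff 0) =i mker res_aug;
  res_exactS : forall n, mim (res_diff n.+1) =i mker (res_diff n) }.

Definition homology (U V W : lmodType R) (f : {linear U -> V}) (g : {linear V -> W}) :
  lmodType R := quotmod (mtrace (mker g) (mim f)).

Definition Ext M (F : free_resolution M) N n : lmodType R :=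
  if n is n'.+1 then
    homology (precomp (W := N) (res_diff F n')) (precomp (res_diff F n'.+1))
  else submod (mker (precomp (W := N) (res_diff F 0))).

(* Ext does not depend on the chosen resolution; finite modules over a
   Noetherian ring do have resolutions by finite free modules. *)
Definition Ext_vanishes n M N :=
  exists F : free_resolution M, forall e : Ext F N n, e = 0.

Definition injective_module (E : lmodType R) :=
  forall (A B : lmodType R) (i : {linear A -> B}) (f : {linear A -> E}),
    injective i -> exists g : {linear B -> E}, forall a, g (i a) = f a.

Definition finite_injective_dimension M :=
  exists (E : nat -> lmodType R) (e : {linear M -> E 0%N})
         (d : forall n, {linear E n -> E n.+1}),
    [/\ forall n, injective_module (E n),
        injective e,
        mim e =i mker (d 0%N),
        forall n, mim (d n) =i mker (d n.+1)
      & exists n, forall k, (n < k)%N -> forall v : E k, v = 0].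

End Homological.

(* Intended for Noetherian local rings. *)
Definition Gorenstein (R : comNzRingType) :=
  finite_injective_dimension (R^o : lmodType R).

Section Assertions.
Variables (R : comNzRingType) (m I Q : ideal R).

Definition lambda_preserves_Ulrich :=
  forall M : lmodType R, horizontally_linked m M ->
    Ulrich_module m I Q M <-> Ulrich_module m I Q (lambda m M).

Definition lambda_Ulrich_maximal_CM :=
  forall M : lmodType R, horizontally_linked m M ->
    Ulrich_module m I Q M -> maximal_CM m (lambda m M).

End Assertions.

(* Main.v *)
(** Reducing modulo Q = (x_1, ..., x_d), the module I/Q is free over R/I, and
    0 -> (R/I)^r -> R/Q -> R/I -> 0 with r > 0 is exact, so Ext^n(R/I, R) vanishes
    for all n > d as soon as it vanishes for one.

    (i) => (ii): if R is Gorenstein, this and Nakayama give Ext^n(M, R) = 0 for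
    n > 0 and M Ulrich.  With F -> M a minimal cover and Z its kernel, lambda M is
    F* modulo the functionals vanishing on Z, hence Z*.  Maps from Z to R/Q lift to
    R and extend to F; this yields r = 1, Q : I = I, and lambda M / Q lambda M
    = Hom(Z, R/Q) is free over R/(Q : I).  The converse follows since M is
    isomorphic to lambda (lambda M).

    (iii) => (iv): the (d+1)-st syzygy M of R/I is Ulrich, and it is horizontally
    linked since I <> Q prevents an Ulrich module from mapping onto R.  Indeed
    every syzygy X has Koszul homology H_p(x; X) free over R/I, with cycles in
    Q K_p(X) being boundaries, and both properties pass to the next syzygy.  Since
    I kills Ext^1(M, R), a functional on Z becomes extendable after multiplication
    by x_1 or x_2, hence is itself extendable when x_1, x_2 is regular on lambda M.
    So Ext^1(M, R) = Ext^(d+2)(R/I, R) vanishes.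

    (iv) => (i) for I = m: by Noetherian induction Ext^n(R/J, R) = 0 for all
    ideals J and n > d, and Baer's criterion shows that the d-th cosyzygy of R is
    injective. *)

Require Import Defs.
From HB Require Import structures.
From mathcomp Require Import all_boot all_order all_algebra.
From mathcomp Require Import boolp classical_sets functions.
From mathcomp Require Import ring.
(* Restores [Hom], which the vector library shadows. *)
Import Defs.

Set Implicit Arguments.
Unset Strict Implicit.
Unset Printing Implicit Defensive.
Import GRing.Theory.
Local Open Scope ring_scope.
Local Open Scope quotient_scope.

(** Only Ext into R occurs, so one injective resolution [E] of R computes all of it: a class in
    Ext^n(N, R) is a cocycle N -> [E n], and long exact sequences reduce to extending maps into the
    [E n]. For (i) => (ii) the finite resolution given by the Gorenstein hypothesis serves;
    elsewhere one is built from divisible groups, and the Ext of (iv), defined by a free resolution,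
    is compared with it. Nakayama needs Ext^n(N, R) to be finitely generated although Hom(N, [E n])
    need not be.

    Koszul complexes enter for two reasons. Depth d is witnessed by an arbitrary regular sequence in
    [m], whereas the reductions are modulo the given x. And R/I and its first syzygies need not be
    x-regular, so freeness of X/QX is not enough for an induction: bases of the Koszul homology in
    all positive degrees pass from one syzygy to the next, until this homology vanishes after d
    steps.

    [lambda] rests on chosen minimal presentations. It is used only through [lambda_cover], which
    describes it by functionals on any minimal cover; likewise Ulrich modules are handled through
    free covers with kernel in I F. *)

Local Notation "J ** V" := (ideal_mul J (fullmod V)) (at level 40).

(** * Construction and factorization of linear maps *)

Section LinearMaps.
Variable R : comNzRingType.
Implicit Types U V W : lmodType R.

Definition mklin V W (f : V -> W) (lf : linear f) : {linear V -> W} :=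
  HB.pack f (GRing.isLinear.Build R V W _ f lf).

(** Two values at one vector differ by a value at 0, so the relation is single-valued and any choice
    function for it is linear. Maps defined through choices of lifts or coefficients are built this
    way. *)
Lemma linear_of_rel V W (G : V -> W -> Prop) :
  (forall v, exists w, G v w) -> (forall w, G 0 w -> w = 0) ->
  (forall a v w v' w', G v w -> G v' w' -> G (a *: v + v') (a *: w + w')) ->
  exists f : {linear V -> W}, forall v, G v (f v).
Proof.
move=> Gtot G0 GL; have [f fP] := choice Gtot.
have Guniq v w w' : G v w -> G v w' -> w = w'.
  move=> h h'; apply/eqP; rewrite -subr_eq0; apply/eqP/G0.
  by have := GL (-1) _ _ _ _ h' h; rewrite !scaleN1r addNr addrC.
have lf : linear f by move=> a v v'; apply: Guniq (fP _) _; apply: GL.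
by exists (mklin lf).
Qed.

Lemma factor_surj V W U (p : {linear V -> W}) (f : {linear V -> U}) :
  (forall w, exists v, p v = w) -> (forall v, p v = 0 -> f v = 0) ->
  exists g : {linear W -> U}, forall v, g (p v) = f v.
Proof.
move=> ps pf.
have [||a _ _ _ _ [v [<- <-]] [v' [<- <-]]|g gP] :=
  @linear_of_rel W U (fun w u => exists v, p v = w /\ f v = u).
- by move=> w; have [v <-] := ps w; exists (f v), v.
- by move=> _ [v [/pf -> <-]].
- by exists (a *: v + v'); rewrite !linearP.
exists g => v; have [v' [h <-]] := gP (p v).
by apply/eqP; rewrite -subr_eq0 -linearB; apply/eqP/pf; rewrite linearB h subrr.
Qed.

Lemma factor_inj V W U (i : {linear U -> V}) (f : {linear W -> V}) :
  injective i -> (forall w, exists u, i u = f w) ->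
  exists g : {linear W -> U}, forall w, i (g w) = f w.
Proof.
move=> ii h.
have [||a w u w' u' e e'|g gP] := @linear_of_rel W U (fun w u => i u = f w).
- exact: h.
- by move=> u; rewrite linear0 => e; apply: ii; rewrite e linear0.
- by rewrite !linearP e e'.
by exists g.
Qed.

Lemma lin_comb_subproof V n (v : 'I_n -> V) :
  linear (fun u : 'rV[R]_n => \sum_i u 0 i *: v i).
Proof.
move=> a x y; rewrite scaler_sumr -big_split; apply: eq_bigr => i _ /=.
by rewrite !mxE scalerDl scalerA.
Qed.
Definition lin_comb V n (v : 'I_n -> V) : {linear 'rV[R]_n -> V} :=
  mklin (lin_comb_subproof v).

Lemma lin_combE V n (v : 'I_n -> V) u : lin_comb v u = \sum_i u 0 i *: v i.
Proof. by []. Qed.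

Lemma lin_comb_basis V n (f : {linear 'rV[R]_n -> V}) u :
  f u = \sum_i u 0 i *: f (delta_mx 0 i).
Proof. by rewrite {1}[u]row_sum_delta linear_sum; apply: eq_bigr => i _; rewrite linearZ. Qed.

Lemma lift_free V W n (p : {linear V -> W}) (f : {linear 'rV[R]_n -> W}) :
  (forall w, exists v, p v = w) ->
  exists g : {linear 'rV[R]_n -> V}, forall u, p (g u) = f u.
Proof.
move=> ps; have [v vP] := choice (fun i => ps (f (delta_mx 0 i))).
exists (lin_comb v) => u; rewrite (lin_comb_basis f) lin_combE linear_sum.
by apply: eq_bigr => i _; rewrite linearZ vP.
Qed.

Definition comp_lin U V W (g : {linear V -> W}) (f : {linear U -> V}) :
  {linear U -> W} := g \o f.
Lemma comp_linE U V W (g : {linear V -> W}) (f : {linear U -> V}) u :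
  comp_lin g f u = g (f u).
Proof. by []. Qed.

Definition id_lin V : {linear V -> V} := @idfun V.
Definition sub_lin V W (f g : {linear V -> W}) : {linear V -> W} := f \- g.
Definition add_lin V W (f g : {linear V -> W}) : {linear V -> W} := f \+ g.
Lemma scale_lin_subproof V W a (f : {linear V -> W}) : linear (fun v => a *: f v).
Proof. by move=> b x y; rewrite linearP scalerDr !scalerA mulrC. Qed.
Definition scale_lin V W a (f : {linear V -> W}) := mklin (scale_lin_subproof a f).

Lemma scale_idE V a (v : V) : scale_lin a (id_lin V) v = a *: v.
Proof. by []. Qed.

Lemma mulv_subproof V (v : V) : linear (fun r : R^o => r *: v).
Proof. by move=> a r s; rewrite scalerDl scalerA. Qed.
Definition mulv_lin V (v : V) : {linear R^o -> V} := mklin (mulv_subproof v).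

Lemma coord_subproof n (j : 'I_n) : linear (fun u : 'rV[R]_n => u 0 j : R^o).
Proof. by move=> a x y; rewrite !mxE. Qed.
Definition coord_lin n (j : 'I_n) : {linear 'rV[R]_n -> R^o} := mklin (coord_subproof j).

Lemma sum_lin V W n (f : 'I_n -> {linear V -> W}) :
  exists g : {linear V -> W}, forall v, g v = \sum_i f i v.
Proof.
have lf : linear (fun v => \sum_i f i v).
  move=> a x y; rewrite scaler_sumr -big_split; apply: eq_bigr => i _ /=.
  by rewrite linearP.
by exists (mklin lf).
Qed.
End LinearMaps.

(** * Submodules, spans and products with ideals *)

Section Submodules.
Variable R : comNzRingType.
Implicit Types (V W : lmodType R) (J K : ideal R).

Section Closure.
Variables (V : lmodType R) (U : submodClosed V).
Lemma subm0 : 0 \in U. Proof. exact: (rpred0 U). Qed.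
Lemma submD v w : v \in U -> w \in U -> v + w \in U.
Proof. exact: (@rpredD V U). Qed.
Lemma submZ a v : v \in U -> a *: v \in U.
Proof. exact: (@rpredZ R V U). Qed.
Lemma submN v : v \in U -> - v \in U.
Proof. by rewrite -scaleN1r; apply: submZ. Qed.
Lemma submB v w : v \in U -> w \in U -> v - w \in U.
Proof. by move=> hv hw; apply: submD => //; apply: submN. Qed.
Lemma subm_sum T (r : seq T) (P : pred T) (F : T -> V) :
  (forall i, P i -> F i \in U) -> \sum_(i <- r | P i) F i \in U.
Proof. by move=> h; elim/big_ind: _ => //; [exact: subm0 | exact: submD]. Qed.
End Closure.

Lemma mem_idealMl J (a b : R) : b \in J -> a * b \in J.
Proof. exact: submZ. Qed.
Lemma mem_idealMr J (a b : R) : a \in J -> a * b \in J.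
Proof. by rewrite mulrC; apply: mem_idealMl. Qed.

Lemma mem_mspan V (S : set V) v : S v -> v \in mspan S.
Proof.
move=> Sv; apply/asboolP; exists 1%N, (fun=> 1), (fun=> v); split=> //.
by rewrite big_ord1 scale1r.
Qed.

Lemma mspan_sub V (S : set V) (U : submodClosed V) :
  (forall v, S v -> v \in U) -> forall v, v \in mspan S -> v \in U.
Proof.
move=> h v /asboolP[n [a [g [Sg ->]]]]; apply: subm_sum => i _.
by apply: submZ; apply: h.
Qed.

Lemma mem_fullmod V v : v \in fullmod V.
Proof. exact: mem_mspan. Qed.

(** For a linearly closed predicate, membership in this span is the predicate itself ([msubP]), so
    an assertion about all elements of a span or of a product with an ideal reduces to
    generators. *)
Definition msub V (P : V -> Prop) : submodClosed V := mspan [set v | P v].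

Lemma msubP V (P : V -> Prop) :
  P 0 -> (forall a v w, P v -> P w -> P (a *: v + w)) ->
  forall v, v \in msub P <-> P v.
Proof.
move=> P0 PL v; split; last exact: mem_mspan.
move=> /asboolP[n [a [g [Sg ->]]]].
elim: n a g Sg => [|n IH] a g Sg; first by rewrite big_ord0.
rewrite big_ord_recl; apply: PL; first exact: Sg.
by apply: IH => i; apply: Sg.
Qed.

Lemma mem_ideal_mul J V (U : submodClosed V) a v :
  a \in J -> v \in U -> a *: v \in ideal_mul J U.
Proof. by move=> ha hv; apply: mem_mspan; exists a => //; exists v. Qed.

Lemma mem_mulM J V a (v : V) : a \in J -> a *: v \in J ** V.
Proof. by move=> ha; apply: mem_ideal_mul (mem_fullmod _). Qed.

Lemma ideal_mul_sub J V (U N : submodClosed V) :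
  (forall (a : R) v, a \in J -> v \in U -> a *: v \in N) ->
  forall v, v \in ideal_mul J U -> v \in N.
Proof. by move=> h; apply: mspan_sub => _ [a ha [u hu ->]]; apply: h. Qed.

Lemma mulM_sub J V (N : submodClosed V) :
  (forall (a : R) v, a \in J -> a *: v \in N) -> forall v, v \in J ** V -> v \in N.
Proof. by move=> h; apply: ideal_mul_sub => a v ha _; apply: h. Qed.

Lemma ideal_mulS J K V (U N : submodClosed V) :
  {subset J <= K} -> {subset U <= N} -> {subset ideal_mul J U <= ideal_mul K N}.
Proof. by move=> hJ hU; apply: ideal_mul_sub => a v /hJ ha /hU; apply: mem_ideal_mul. Qed.

Lemma ideal_mul_subr J V (U : submodClosed V) : {subset ideal_mul J U <= U}.
Proof. by apply: ideal_mul_sub => a v _; apply: submZ. Qed.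

Lemma lin_mulM J V W (f : {linear V -> W}) v : v \in J ** V -> f v \in J ** W.
Proof.
move=> hv; have fP := @msubP V (fun v => f v \in J ** W) _ _.
apply/fP; rewrite ?linear0 ?subm0 //.
  by move=> a x y hx hy; rewrite linearP; apply: submD => //; apply: submZ.
move: v hv; apply: mulM_sub => a v ha; apply: mem_mspan => /=.
by rewrite linearZ; apply: mem_mulM.
Qed.

Lemma mulM_surj J V W (f : {linear V -> W}) :
  (forall w, exists v, f v = w) ->
  forall w, w \in J ** W -> exists2 v, v \in J ** V & f v = w.
Proof.
move=> fs w hw.
have fP := @msubP W (fun w => exists2 v, v \in J ** V & f v = w) _ _.
apply/fP; first by exists 0; rewrite ?subm0 ?linear0.
  move=> a _ _ [x hx <-] [y hy <-]; exists (a *: x + y); last by rewrite linearP.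
  by apply: submD => //; apply: submZ.
move: w hw; apply: mulM_sub => a w ha; apply: mem_mspan => /=.
by have [v <-] := fs w; exists (a *: v); rewrite ?linearZ //; apply: mem_mulM.
Qed.

Lemma mulM_rV J n (u : 'rV[R]_n) : u \in J ** 'rV[R]_n <-> forall i, u 0 i \in J.
Proof.
split=> h; last first.
  rewrite [u]row_sum_delta; apply: subm_sum => i _; exact: mem_mulM.
have uP := @msubP _ (fun u : 'rV[R]_n => forall i, u 0 i \in J) _ _.
apply/uP.
- by move=> i; rewrite mxE; apply: (subm0 J).
- by move=> a x y hx hy i; rewrite !mxE; apply: submD => //; apply: mem_idealMl.
move: u h; apply: mulM_sub => a u ha; apply: mem_mspan => i /=.
by rewrite mxE; apply: mem_idealMr.
Qed.

Lemma mulM_ring J (a : R) : a \in (J ** R^o : ideal R) <-> a \in J.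
Proof.
split=> [|h]; last by rewrite -(mulr1 a); apply: (@mem_mulM J R^o a 1).
by apply: (@mulM_sub J R^o J) => b c hb; apply: (mem_idealMr c hb).
Qed.

Lemma quotpi_subproof V (U : submodClosed V) : linear (\pi_(quotmod U) : V -> quotmod U).
Proof.
move=> a x y.
have piD u v : \pi_(quotmod U) (u + v) = \pi_(quotmod U) u + \pi_(quotmod U) v.
  by rewrite piE.
by rewrite piD -quotmod_scale_pi.
Qed.
Definition quotpi V (U : submodClosed V) : {linear V -> quotmod U} :=
  mklin (quotpi_subproof U).

Lemma quotpi_surj V (U : submodClosed V) q : exists v, quotpi U v = q.
Proof. by exists (repr q); rewrite /= reprK. Qed.

Lemma quotpi_eq0 V (U : submodClosed V) v : quotpi U v = 0 <-> v \in U.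
Proof.
have -> : (0 : quotmod U) = quotpi U 0 by rewrite linear0.
have -> : (v \in U) = (v \in pred_of_submod U) by [].
rewrite -{2}[v]subr0 Quotient.idealrBE; split=> [/eqP|/eqP] //.
Qed.

Lemma submod_val_linear V (U : submodClosed V) : linear (val : submod U -> V).
Proof. by move=> a x y; rewrite linearP. Qed.
Definition subval V (U : submodClosed V) : {linear submod U -> V} :=
  mklin (@submod_val_linear V U).

Lemma subval_inj V (U : submodClosed V) : injective (subval U).
Proof. exact: val_inj. Qed.
Lemma subvalP V (U : submodClosed V) u : subval U u \in U.
Proof. exact: valP. Qed.
Lemma subval_exists V (U : submodClosed V) v : v \in U -> exists u, subval U u = v.
Proof. by move=> h; exists (exist _ v h). Qed.

Lemma in_mker V W (f : {linear V -> W}) v : v \in mker f <-> f v = 0.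
Proof. by split => /eqP. Qed.
Lemma in_mim V W (f : {linear V -> W}) w : w \in mim f <-> exists v, f v = w.
Proof. by split => /asboolP. Qed.

Lemma isomorphicP V W : isomorphic V W <->
  exists f : {linear V -> W}, injective f /\ forall w, exists v, f v = w.
Proof.
split=> [[f [g fK gK]]|[f [fi fs]]].
  by exists f; split=> [|w]; [exact: can_inj fK | exists (g w)].
have [g gP] := choice fs.
by exists f, g => // v; apply: fi; rewrite gP.
Qed.

Lemma iso_of_kernels (U V W : lmodType R) (f : {linear U -> V}) (g : {linear U -> W}) :
  (forall v, exists u, f u = v) -> (forall w, exists u, g u = w) ->
  (forall u, f u = 0 <-> g u = 0) -> isomorphic V W.
Proof.
move=> fs gs fg; have [h hP] := factor_surj fs (fun u => (fg u).1).
apply/isomorphicP; exists h; split=> [v v' e|w]; last first.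
  by have [u <-] := gs w; exists (f u).
have [u eu] := fs (v - v'); apply/eqP; rewrite -subr_eq0 -eu.
by apply/eqP/fg; rewrite -hP eu linearB e subrr.
Qed.

Lemma inj_lin V W (f : {linear V -> W}) :
  (forall v, f v = 0 -> v = 0) -> injective f.
Proof.
move=> h x y e; apply/eqP; rewrite -subr_eq0; apply/eqP/h.
by rewrite linearB e subrr.
Qed.

Lemma isomorphic_sym V W : isomorphic V W -> isomorphic W V.
Proof.
case=> f [g fK gK].
have lg : linear g by move=> a x y; apply: (can_inj fK); rewrite linearP !gK.
by exists (mklin lg), f.
Qed.

Lemma mem_generated V (s : seq V) v : v \in s -> v \in generated s.
Proof. exact: mem_mspan. Qed.

Lemma generated_sub V (s : seq V) (U : submodClosed V) :
  {subset s <= U} -> {subset generated s <= U}.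
Proof. by move=> h; apply: mspan_sub. Qed.

Lemma generatedS V (s t : seq V) : {subset s <= t} -> {subset generated s <= generated t}.
Proof. by move=> h; apply: generated_sub => v /h; apply: mem_generated. Qed.

Lemma generated_nil V (v : V) : v \in generated [::] <-> v = 0.
Proof.
split=> [h|->]; last exact: subm0.
have P := @msubP V (fun v => v = 0) erefl _.
apply/P; first by move=> a _ _ -> ->; rewrite scaler0 addr0.
by move: v h; apply: generated_sub.
Qed.

Lemma generated_cons V a (s : seq V) (v : V) :
  v \in generated (a :: s) <-> exists c w, w \in generated s /\ v = c *: a + w.
Proof.
split=> [h|[c [w [hw ->]]]]; last first.
  apply: submD; first by apply/submZ/mem_generated/mem_head.
  by apply: generatedS hw => u hu; rewrite in_cons hu orbT.
have P := @msubP V (fun v => exists c w, w \in generated s /\ v = c *: a + w) _ _.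
apply/P.
- by exists 0, 0; rewrite subm0 scale0r addr0.
- move=> b _ _ [c [w [hw ->]]] [c' [w' [hw' ->]]].
  exists (b * c + c'), (b *: w + w'); split.
    by apply: submD => //; apply: submZ.
  by rewrite scalerDr scalerDl scalerA addrACA.
move: v h; apply: generated_sub => v; rewrite in_cons => /orP[/eqP->|hv].
  by apply: mem_mspan; exists 1, 0; rewrite subm0 scale1r addr0.
apply: mem_mspan; exists 0, v; rewrite scale0r add0r; split=> //.
exact: mem_generated.
Qed.

Lemma generatedP V (s : seq V) v :
  v \in generated s <-> exists a : 'I_(size s) -> R, v = \sum_i a i *: s`_i.
Proof.
split=> [|[a ->]]; last first.
  by apply: subm_sum => i _; apply/submZ/mem_generated/mem_nth.
elim: s v => [|b s IH] v.
  by move=> /generated_nil ->; exists (fun=> 0); rewrite big_ord0.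
move=> /generated_cons[c [w [/IH[a ->] ->]]].
exists (fun i => if unlift ord0 i is Some j then a j else c).
rewrite big_ord_recl unlift_none; congr (_ + _); apply: eq_bigr => i _.
by rewrite liftK.
Qed.

Lemma generated_fam V n (v : 'I_n -> V) w :
  w \in generated (codom v) <-> exists a : 'I_n -> R, w = \sum_i a i *: v i.
Proof.
split=> [h|[a ->]]; last first.
  by apply: subm_sum => i _; apply/submZ/mem_generated/codom_f.
have P := @msubP V (fun w => exists a : 'I_n -> R, w = \sum_i a i *: v i) _ _.
apply/P.
- by exists (fun=> 0); rewrite big1 // => i _; rewrite scale0r.
- move=> c _ _ [a ->] [b ->]; exists (fun i => c * a i + b i).
  rewrite scaler_sumr -big_split; apply: eq_bigr => i _ /=.
  by rewrite scalerDl scalerA.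
move: w h; apply: generated_sub => w /codomP[i ->]; apply: mem_mspan => /=.
exists (fun j => (j == i)%:R); rewrite (bigD1 i) //= eqxx scale1r big1 ?addr0 //.
by move=> j /negbTE ->; rewrite scale0r.
Qed.

Lemma gmul_cat V (s t : seq R) (v : V) :
  v \in ideal_gen (s ++ t) ** V <->
  exists w w', [/\ w \in ideal_gen s ** V, w' \in ideal_gen t ** V & v = w + w'].
Proof.
split=> [h|[w [w' [hw hw' ->]]]]; last first.
  apply: submD; [move: w hw | move: w' hw']; apply: ideal_mulS => //.
    by apply: generatedS => a ha; rewrite mem_cat ha.
  by apply: generatedS => a ha; rewrite mem_cat ha orbT.
pose P v := exists w w', [/\ w \in ideal_gen s ** V, w' \in ideal_gen t ** V & v = w + w'].
have Pz : P 0 by exists 0, 0; rewrite !subm0 addr0.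
have PL a x y : P x -> P y -> P (a *: x + y).
  move=> [w [w' [h1 h2 ->]]] [z [z' [h3 h4 ->]]].
  exists (a *: w + z), (a *: w' + z'); split; last by rewrite scalerDr addrACA.
    by apply: submD => //; apply: submZ.
  by apply: submD => //; apply: submZ.
have PP := msubP Pz PL.
apply/PP; move: v h; apply: mulM_sub => a v ha; apply/PP.
(* The assertion is linear in the scalar as well, which reduces it to the generators of the
   ideal. *)
pose P' (a : R) := P (a *: v).
have P'P := @msubP R^o P' _ _.
apply/P'P.
- by rewrite /P' scale0r.
- by move=> c x y hx hy; rewrite /P' scalerDl -scalerA; apply: PL.
move: a ha; apply: (@generated_sub R^o (s ++ t)) => a; rewrite mem_cat.
move=> /orP[ha|ha]; apply: mem_mspan.
  exists (a *: v), 0; rewrite subm0 addr0; split=> //.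
  by apply/mem_mulM/mem_generated.
exists 0, (a *: v); rewrite subm0 add0r; split=> //.
by apply/mem_mulM/mem_generated.
Qed.

Lemma gmul_nil V (v : V) : v \in ideal_gen [::] ** V <-> v = 0.
Proof.
split=> [h|->]; last exact: subm0.
have P := @msubP V (fun v => v = 0) erefl _.
apply/P; first by move=> a _ _ -> ->; rewrite scaler0 addr0.
by move: v h; apply: mulM_sub => a v /generated_nil ->; rewrite scale0r subm0.
Qed.

Lemma gmul_seq1 V a (v : V) : v \in ideal_gen [:: a] ** V <-> exists u, v = a *: u.
Proof.
split=> [h|[u ->]]; last by apply/mem_mulM/mem_generated/mem_head.
have P := @msubP V (fun v => exists u, v = a *: u) _ _.
apply/P.
- by exists 0; rewrite scaler0.
- by move=> b _ _ [x ->] [y ->]; exists (b *: x + y); rewrite scalerDr !scalerA mulrC.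
move: v h; apply: mulM_sub => b v /generated_cons[c [w [/generated_nil -> ->]]].
by apply: mem_mspan; exists (c *: v); rewrite addr0 scalerA mulrC.
Qed.

Lemma gmul_cons V a s (v : V) : v \in ideal_gen (a :: s) ** V <->
  exists u w, w \in ideal_gen s ** V /\ v = a *: u + w.
Proof.
rewrite -cat1s; split=> [/gmul_cat[w [w' [/gmul_seq1[u ->] h ->]]]|[u [w [h ->]]]].
  by exists u, w'.
by apply/gmul_cat; exists (a *: u), w; split=> //; apply/gmul_seq1; exists u.
Qed.

Lemma gmul_rcons V a s (v : V) : v \in ideal_gen (rcons s a) ** V <->
  exists u w, w \in ideal_gen s ** V /\ v = a *: u + w.
Proof.
rewrite -cats1; split=> [/gmul_cat[w [w' [h /gmul_seq1[u ->] ->]]]|[u [w [h ->]]]].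
  by exists u, w; rewrite addrC.
apply/gmul_cat; exists w, (a *: u); rewrite addrC; split=> //.
by apply/gmul_seq1; exists u.
Qed.

Lemma gmul_eq_mem V s t : s =i t -> ideal_gen s ** V =i ideal_gen t ** V.
Proof.
move=> e v; apply/idP/idP; apply: ideal_mulS => //; apply: generatedS => a.
  by rewrite e.
by rewrite e.
Qed.

Lemma gmulP V s (v : V) : v \in ideal_gen s ** V <->
  exists u : 'I_(size s) -> V, v = \sum_(i < size s) s`_i *: u i.
Proof.
split=> [|[u ->]]; last first.
  by apply: subm_sum => i _; apply/mem_mulM/mem_generated/mem_nth.
elim: s v => [|a s IH] v.
  by move=> /gmul_nil ->; exists (fun=> 0); rewrite big_ord0.
move=> /gmul_cons[u [w [/IH[z ->] ->]]].
exists (fun i => if unlift ord0 i is Some j then z j else u).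
rewrite big_ord_recl unlift_none; congr (_ + _); apply: eq_bigr => i _.
by rewrite liftK.
Qed.

End Submodules.

(** * Finitely generated modules over Noetherian local rings *)

Section FiniteGeneration.
Variable R : comNzRingType.
Implicit Types (V W M N : lmodType R) (J K : ideal R).

Lemma generated_map V W (f : {linear V -> W}) (s : seq V) w :
  w \in generated (map f s) <-> exists2 v, v \in generated s & f v = w.
Proof.
split; last first.
  move=> [v hv <-].
  have P := @msubP _ V (fun v => f v \in generated (map f s)) _ _.
  apply/P; rewrite ?linear0 ?subm0 //.
    by move=> a x y hx hy; rewrite linearP; apply: submD => //; apply: submZ.
  move: v hv; apply: generated_sub => v hv; apply: mem_mspan => /=.
  by apply: mem_generated; apply: map_f.
move=> hw; have P := @msubP _ W (fun w => exists2 v, v \in generated s & f v = w) _ _.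
apply/P.
- by exists 0; rewrite ?subm0 ?linear0.
- move=> a _ _ [x hx <-] [y hy <-]; exists (a *: x + y); rewrite ?linearP //.
  by apply: submD => //; apply: submZ.
move: w hw; apply: generated_sub => w /mapP[v hv ->]; apply: mem_mspan.
by exists v => //; apply: mem_generated.
Qed.

Lemma finite_surj M N (f : {linear M -> N}) :
  (forall w, exists v, f v = w) -> finite_module M -> finite_module N.
Proof.
move=> fs [s hs]; exists (map f s) => w; apply/generated_map.
by have [v <-] := fs w; exists v.
Qed.

Lemma finite_rV n : finite_module ('rV[R]_n : lmodType R).
Proof.
exists (codom (fun i : 'I_n => delta_mx 0 i : 'rV[R]_n)) => u.
by apply/generated_fam; exists (fun i => u 0 i); apply: row_sum_delta.
Qed.

Lemma finite_cover M : finite_module M ->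
  exists n (p : {linear 'rV[R]_n -> M}), forall v, exists u, p u = v.
Proof.
case=> s hs; exists (size s), (lin_comb (fun i : 'I_(size s) => s`_i)) => v.
have /generatedP[a ->] := hs v; exists (\row_i a i).
by rewrite lin_combE; apply: eq_bigr => i _; rewrite mxE.
Qed.

Hypothesis hnoeth : noetherian_ring R.

(** Otherwise dependent choice yields a strictly ascending chain above [J0]; finitely many
    generators of its union already lie in one member, where the chain stops. *)
Lemma noetherian_max (Pr : ideal R -> Prop) (J0 : ideal R) : Pr J0 ->
  exists J, [/\ Pr J, {subset J0 <= J}
    & forall K, Pr K -> {subset J <= K} -> {subset K <= J}].
Proof.
move=> P0; apply: contrapT => hno.
pose T := {K : ideal R | Pr K /\ {subset J0 <= K}}.
have hstep (t : T) : exists t' : T, {subset sval t <= sval t'}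
    /\ ~ {subset sval t' <= sval t}.
  case: t => K [PK JK] /=; apply: contrapT => h; apply: hno; exists K; split=> //.
  move=> K' PK' KK'; apply: contrapT => h'; apply: h.
  have J0K' : {subset J0 <= K'} by move=> a /JK /KK'.
  by exists (exist _ K' (conj PK' J0K')).
have [f fP] := choice hstep.
pose t0 : T := exist _ J0 (conj P0 (fun _ => id)).
pose c k := sval (iter k f t0).
have cmono k l : (k <= l)%N -> {subset c k <= c l}.
  move=> /subnK <-; elim: (l - k)%N => [|n IH] a ha //.
  by apply: (fP _).1; apply: IH.
have P := @msubP _ R^o (fun r => exists k, r \in c k) _ _.
have {}P : forall r, r \in msub (fun r : R^o => exists k, r \in c k) <-> exists k, r \in c k.
  apply: P; first by exists 0%N; apply: subm0.
  move=> a x y [k hk] [l hl]; exists (maxn k l).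
  by apply: submD; [apply: submZ|]; apply: cmono; [apply: leq_maxl|exact: hk|apply: leq_maxr|].
have [s hs] := hnoeth (msub (fun r : R^o => exists k, r \in c k)).
have hsc : forall a, a \in s -> exists k, a \in c k.
  by move=> a ha; apply/P; rewrite hs; apply: mem_generated.
have [n hn] : exists n, forall a, a \in s -> a \in c n.
  move: hsc.
  elim: (s) => [|a s' IH] h; first by exists 0%N.
  have [|n hn] := IH; first by move=> b hb; apply: h; rewrite in_cons hb orbT.
  have [k hk] := h a (mem_head _ _); exists (maxn k n) => b.
  rewrite in_cons => /orP[/eqP->|/hn hb].
    exact: (cmono _ _ (leq_maxl _ _) _ hk).
  exact: (cmono _ _ (leq_maxr _ _) _ hb).
apply: (fP (iter n f t0)).2 => a ha.
have : a \in msub (fun r : R^o => exists k, r \in c k) by apply/P; exists n.+1.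
by rewrite hs; move: a {ha}; apply: (@generated_sub _ R^o s).
Qed.

(** The coefficients of [a] in elements of [U] form an ideal [J]. Lifts of generators of [J],
    together with generators of the part of [U] inside the span of [s], generate [U]. *)
Lemma noetherian_sub V (s : seq V) (U : submodClosed V) :
  {subset U <= generated s} -> exists t, U =i generated t.
Proof.
elim: s U => [|a s IH] U hU.
  exists [::] => v; apply/idP/idP; first exact: hU.
  by move=> /generated_nil ->; apply: subm0.
have P : forall r, r \in msub (fun r : R^o => exists2 w, w \in generated s & r *: a + w \in U)
    <-> exists2 w, w \in generated s & r *: a + w \in U.
  refine (msubP _ _); first by exists 0; rewrite ?scale0r ?addr0 subm0.
  move=> b x y [w hw hx] [z hz hy]; exists (b *: w + z).
    by apply: submD => //; apply: submZ.
  rewrite scalerDl -scalerA addrACA -scalerDr.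
  by apply: submD => //; apply: submZ.
set J := msub _ in P.
have [rs hrs] := hnoeth J.
have /choice[f fP] : forall r : R, exists w, r \in J -> w \in generated s /\ r *: a + w \in U.
  move=> r; have [/P[w hw hr]|h] := boolP (r \in J); first by exists w.
  by exists 0.
have P' : forall v, v \in msub (fun v => v \in U /\ v \in generated s) <->
    v \in U /\ v \in generated s.
  refine (msubP _ _); first by rewrite !subm0.
  by move=> b x y [h1 h2] [h3 h4]; split; apply: submD => //; apply: submZ.
set U' := msub _ in P'.
have [|t' ht'] := IH U'; first by move=> v /P'[].
exists ([seq r *: a + f r | r <- rs] ++ t') => v; apply/idP/idP.
  move=> hv; have /generated_cons[c [w [hw e]]] := hU _ hv.
  have cJ : c \in J by apply/P; exists w; rewrite -?e.
  set t := _ ++ t'.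
  have Q : forall c, c \in msub (fun c : R^o => exists2 z, z \in generated s &
      c *: a + z \in generated t) <->
      exists2 z, z \in generated s & c *: a + z \in generated t.
    refine (msubP _ _); first by exists 0; rewrite ?scale0r ?addr0 subm0.
    move=> b x y [z hz hx] [z' hz' hy]; exists (b *: z + z').
      by apply: submD => //; apply: submZ.
    rewrite scalerDl -scalerA addrACA -scalerDr.
    by apply: submD => //; apply: submZ.
  have [z hz hzt] : exists2 z, z \in generated s & c *: a + z \in generated t.
    apply/Q; rewrite hrs in cJ; move: c cJ {e}; apply: (@generated_sub _ R^o rs) => r hr.
    apply/Q; have rJ : r \in J by rewrite hrs; apply: mem_generated.
    exists (f r); first by case: (fP r rJ).
    by apply: mem_generated; rewrite mem_cat; apply/orP; left; apply/mapP; exists r.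
  have tU : {subset generated t <= U}.
    apply: generated_sub => x; rewrite mem_cat => /orP[/mapP[r hr ->]|hx].
      by apply: (fP r _).2; rewrite hrs; apply: mem_generated.
    by have /P'[] : x \in U' by rewrite ht'; apply: mem_generated.
  rewrite -[v](subrK (c *: a + z)); apply: submD => //.
  have : v - (c *: a + z) \in U'.
    apply/P'; split; first by apply: submB => //; apply: tU.
    by rewrite e opprD addrACA subrr add0r; apply: submB.
  rewrite ht'; apply: generatedS => x hx; by rewrite mem_cat hx orbT.
move: v; apply: generated_sub => v; rewrite mem_cat => /orP[/mapP[r hr ->]|hx].
  by apply: (fP r _).2; rewrite hrs; apply: mem_generated.
by have /P'[] : v \in U' by rewrite ht'; apply: mem_generated.
Qed.

Lemma finite_inj M N (f : {linear N -> M}) :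
  injective f -> finite_module M -> finite_module N.
Proof.
move=> fi [s hs]; have [t ht] := @noetherian_sub M s (mim f) (fun v _ => hs v).
have /choice[g gP] : forall v, exists u, v \in mim f -> f u = v.
  move=> v; have [/in_mim[u e]|_] := boolP (v \in mim f); first by exists u.
  by exists 0.
exists (map g t) => v.
have et : map f (map g t) = t.
  rewrite -map_comp; rewrite -[RHS]map_id; apply/eq_in_map => x hx /=; apply: gP.
  by rewrite ht; apply: mem_generated.
have : f v \in generated t by rewrite -ht; apply/in_mim; exists v.
by rewrite -{1}et => /generated_map[w hw /fi <-].
Qed.

Lemma finite_submod M (U : submodClosed M) :
  finite_module M -> finite_module (submod U).
Proof. exact: finite_inj (@subval_inj _ _ U). Qed.

Lemma finite_sub_gen M (U : submodClosed M) :
  finite_module M -> exists t, U =i generated t.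
Proof. by case=> s hs; apply: (@noetherian_sub M s U (fun v _ => hs v)). Qed.

Lemma finite_quot M (U : submodClosed M) :
  finite_module M -> finite_module (quotmod U).
Proof. exact: finite_surj (@quotpi_surj _ _ U). Qed.

End FiniteGeneration.

(** * Local rings: Nakayama's lemma and minimal covers *)

Section Local.
Variables (R : comNzRingType) (m : ideal R).
Hypothesis hnoeth : noetherian_ring R.
Hypothesis hlocal : local_ring m.
Implicit Types (V W M N : lmodType R) (J K : ideal R).

Lemma local_not1 : (1 : R) \notin m.
Proof. by case: hlocal => [[]]. Qed.

(** Otherwise Ra is proper and lies in a maximal ideal, which is [m]. *)
Lemma local_unit (a : R) : a \notin m -> exists b, b * a = 1.
Proof.
move=> ha; apply: contrapT => hno.
have h1 : (1 : R) \notin ideal_gen [:: a].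
  apply/negP => /generated_cons[c [w [/generated_nil -> e]]].
  by apply: hno; exists c; rewrite e addr0.
have [K [K1 JK Kmax]] := noetherian_max hnoeth (Pr := fun K => (1 : R) \notin K) h1.
have /hlocal.2 hK : maximal_ideal K.
  split=> // K' K'1 KK' b; apply/idP/idP; last exact: KK'.
  exact: Kmax.
by move/negP: ha; apply; rewrite -hK; apply/JK/mem_generated/mem_head.
Qed.

Lemma proper_ideal_sub J : (1 : R) \notin J -> {subset J <= m}.
Proof.
move=> h a ha; apply: contraT => /local_unit[b e].
by case/negP: h; rewrite -e; apply: mem_idealMl.
Qed.

Lemma unit_1B (c : R) : c \in m -> exists b, b * (1 - c) = 1.
Proof.
move=> hc; apply: local_unit; apply: contra local_not1 => h.
by rewrite -(subrK c 1); apply: (submD h hc).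
Qed.

Lemma ideal_mul_gen_cons J V a (s : seq V) (v : V) :
  v \in ideal_mul J (generated (a :: s)) ->
  exists c w, [/\ c \in J, w \in ideal_mul J (generated s) & v = c *: a + w].
Proof.
move=> hv; have P := @msubP _ V (fun v => exists c w, [/\ c \in J,
  w \in ideal_mul J (generated s) & v = c *: a + w]) _ _.
apply/P.
- by exists 0, 0; rewrite !subm0 scale0r addr0; split=> //; apply: (subm0 J).
- move=> b _ _ [c [w [hc hw ->]]] [c' [w' [hc' hw' ->]]].
  exists (b * c + c'), (b *: w + w'); split.
  + by apply: (submD (mem_idealMl b hc) hc').
  + by apply: submD => //; apply: submZ.
  by rewrite scalerDr scalerDl scalerA addrACA.
move: v hv; apply: ideal_mul_sub => b v hb /generated_cons[c [w [hw ->]]].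
apply: mem_mspan; exists (@GRing.mul R b c), (b *: w); split.
- exact: (mem_idealMr c hb).
- exact: mem_ideal_mul.
by rewrite scalerDr scalerA.
Qed.

(** Induction on the generators: modulo [N] the head satisfies a = c a + w' with c in [m], and
    inverting 1 - c eliminates it from the other relations. Only the span of [s] has to be finite;
    [V] may be a module of maps into an injective. *)
Lemma nakayama_gen V (s : seq V) (N : submodClosed V) :
  (forall v, v \in s -> exists2 w, w \in ideal_mul m (generated s) & v - w \in N) ->
  {subset generated s <= N}.
Proof.
move=> h; apply: generated_sub; elim: s h => // a s IH h.
have [w /ideal_mul_gen_cons[c [w' [hc hw' ->]]] hN] := h a (mem_head _ _).
have [e he] := unit_1B hc.
have ea : a = e *: w' + e *: (a - (c *: a + w')).
  rewrite -scalerDr opprD addrCA [w' + _]addrCA subrr addr0.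
  by rewrite -{2}[a]scale1r -scalerBl scalerA he scale1r.
have hs : {subset s <= N}.
  apply: IH => v hv.
  have [|z /ideal_mul_gen_cons[c' [w'' [hc' hw'' ->]]] hN'] := h v.
    by rewrite in_cons hv orbT.
  exists (c' *: (e *: w') + w'').
    by apply: submD => //; do 2!apply: submZ.
  have -> : v - (c' *: (e *: w') + w'') =
     v - (c' *: a + w'') + c' *: (e *: (a - (c *: a + w'))).
    set y := e *: (a - _) in ea *; rewrite [in RHS]ea scalerDr.
    by rewrite [c' *: _ + c' *: y + _]addrAC [- (_ + c' *: y)]opprD addrA subrK.
  by apply: submD => //; do 2!apply: submZ.
move=> v; rewrite in_cons => /orP[/eqP->|]; last exact: hs.
rewrite ea; apply: submD; last exact: submZ.
by apply/submZ/(generated_sub hs)/(ideal_mul_subr hw').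
Qed.

Lemma nakayama M (U N : submodClosed M) : finite_module M ->
  (forall v, v \in U -> exists2 w, w \in ideal_mul m U & v - w \in N) ->
  {subset U <= N}.
Proof.
move=> /(finite_sub_gen hnoeth U)[t ht] h v; rewrite ht; move: v.
apply: nakayama_gen => v hv.
have [|w hw hN] := h v; first by rewrite ht; apply: mem_generated.
by exists w => //; apply: ideal_mulS hw => // u; rewrite ht.
Qed.

Lemma nakayama_top M (N : submodClosed M) : finite_module M ->
  (forall v, exists2 w, w \in m ** M & v - w \in N) -> forall v, v \in N.
Proof.
by move=> hM h v; apply: (@nakayama M (fullmod M) N) (mem_fullmod v) => // u _.
Qed.

(** Nakayama makes [a] surjective, so the identity lifts to a right inverse; for square matrices
    over a commutative ring it is two-sided. *)
Lemma near_id_bij n (a : {linear 'rV[R]_n -> 'rV[R]_n}) :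
  (forall u, a u - u \in m ** 'rV[R]_n) ->
  exists b : {linear 'rV[R]_n -> 'rV[R]_n}, cancel a b /\ cancel b a.
Proof.
move=> h.
have as_ u : exists v, a v = u.
  apply/in_mim; apply: nakayama_top (finite_rV R n) _ u => u.
  exists (u - a u); first by rewrite -opprB; apply: submN.
  by rewrite opprB addrC subrK; apply/in_mim; exists u.
have [b bP] := lift_free (id_lin 'rV[R]_n) as_.
exists b; split=> u; last exact: bP.
have e : lin1_mx b *m lin1_mx a = 1%:M.
  by apply/row_matrixP => i; rewrite rowE mulmxA !mul_rV_lin1 bP rowE mulmx1.
by rewrite -[a u]mul_rV_lin1 -[b _]mul_rV_lin1 -mulmxA (mulmx1C e) mulmx1.
Qed.

Definition mincover M n (p : {linear 'rV[R]_n -> M}) :=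
  (forall v, exists u, p u = v) /\ forall u, p u = 0 -> u \in m ** 'rV[R]_n.

(** A relation with a unit coefficient expresses one generator through the others, which can then be
    dropped. *)
Lemma mincover_exists M : finite_module M -> exists n (p : {linear 'rV[R]_n -> M}), mincover p.
Proof.
move=> /finite_cover[n [p ps]]; elim: n p ps => [|n IH] p ps.
  by exists 0%N, p; split=> // u _; apply/mulM_rV => -[].
have [h|] := pselect (forall u, p u = 0 -> u \in m ** 'rV[R]_n.+1); first by exists n.+1, p.
move=> /existsNP[u /not_implyP[pu0 hu]].
have [i hi] : exists i, u 0 i \notin m.
  apply: contrapT => hno; apply: hu; apply/mulM_rV => i.
  by apply: contraT => hi; case: hno; exists i.
have [b hb] := local_unit hi.
apply: (IH (lin_comb (fun j => p (delta_mx 0 (lift i j))))) => v.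
have [w <-] := ps v.
(* Subtracting a multiple of the relation [u] clears the i-th coordinate without changing the image
   in [M]. *)
pose w' := w - (w 0 i * b) *: u.
have -> : p w = p w' by rewrite linearB linearZ /= pu0 scaler0 subr0.
have w'i : w' 0 i = 0 by rewrite !mxE -mulrA hb mulr1 subrr.
exists (\row_j w' 0 (lift i j)).
rewrite lin_combE (lin_comb_basis p w') (bigD1_ord i) //= w'i scale0r add0r.
by apply: eq_bigr => j _; rewrite mxE.
Qed.

(** When the two covers are lifted through each other, both composites are the identity modulo [m],
    hence invertible. *)
Lemma mincover_unique M n n' (p : {linear 'rV[R]_n -> M}) (p' : {linear 'rV[R]_n' -> M}) :
  mincover p -> mincover p' ->
  exists (g : {linear 'rV[R]_n -> 'rV[R]_n'}) (g' : {linear 'rV[R]_n' -> 'rV[R]_n}),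
    [/\ cancel g g', cancel g' g & forall u, p' (g u) = p u].
Proof.
move=> [ps pm] [ps' pm'].
have [g gP] := lift_free p ps'; have [h hP] := lift_free p' ps.
have [b [b1 b2]] : exists b : {linear 'rV[R]_n -> 'rV[R]_n},
    cancel (comp_lin h g) b /\ cancel b (comp_lin h g).
  by apply: near_id_bij => u; apply: pm; rewrite linearB hP gP subrr.
have [c [c1 c2]] : exists b : {linear 'rV[R]_n' -> 'rV[R]_n'},
    cancel (comp_lin g h) b /\ cancel b (comp_lin g h).
  by apply: near_id_bij => u; apply: pm'; rewrite linearB gP hP subrr.
exists g, (comp_lin b h); split=> // u.
rewrite -{1}(c2 u); have -> : comp_lin b h (comp_lin g h (c u)) = h (c u).
  exact: (b1 (h (c u))).
exact: c2.
Qed.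

(** Minimal generators of a free R/J-module form a basis. The covers lift through each other to [a]
    and [b]; a relation [u] of [p] is sent by [a] to a vector with entries in [J], and b a is
    invertible. *)
Lemma min_gens_basis J V n k (p : {linear 'rV[R]_n -> V}) (q : {linear 'rV[R]_k -> V}) :
  mincover p -> (forall v, exists u, q u = v) ->
  (forall u, q u = 0 <-> u \in J ** 'rV[R]_k) ->
  forall u, p u = 0 -> u \in J ** 'rV[R]_n.
Proof.
move=> [ps pm] qs qJ u pu.
have [a aP] := lift_free p qs; have [b bP] := lift_free q ps.
have [c [c1 _]] : exists c : {linear 'rV[R]_n -> 'rV[R]_n},
    cancel (comp_lin b a) c /\ cancel c (comp_lin b a).
  by apply: near_id_bij => w; apply: pm; rewrite linearB bP aP subrr.
rewrite -(c1 u) comp_linE; apply/lin_mulM/lin_mulM/qJ.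
by rewrite aP.
Qed.

End Local.

(** * Koszul complexes and regular sequences *)

Section Koszul.
Variable R : comNzRingType.
Implicit Types (U V W M N : lmodType R) (J : ideal R) (s : seq R) (p : nat).

(* Iterated mapping cones: the second factor of a pair is the shifted copy, and
   [kdeg p] selects the homogeneous elements of degree [p]. *)
Fixpoint koszul s M : lmodType R :=
  if s is _ :: s' then (koszul s' M * koszul s' M)%type else M.

Fixpoint kdiff s M : koszul s M -> koszul s M :=
  match s return koszul s M -> koszul s M with
  | [::] => fun=> 0
  | a :: s' => fun w => (kdiff w.1 + a *: w.2, - kdiff w.2)
  end.

Fixpoint kdeg s M p : koszul s M -> Prop :=
  match s return koszul s M -> Prop with
  | [::] => fun w => if p is _.+1 then w = 0 else True
  | a :: s' => fun w => kdeg p w.1 /\ (if p is q.+1 then kdeg q w.2 else w.2 = 0)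
  end.

Fixpoint kmap s V W (f : V -> W) : koszul s V -> koszul s W :=
  match s return koszul s V -> koszul s W with
  | [::] => f
  | a :: s' => fun w => (kmap f w.1, kmap f w.2)
  end.

Fixpoint kin s M (v : M) : koszul s M :=
  match s return koszul s M with
  | [::] => v
  | a :: s' => (kin s' v, 0)
  end.

Definition kexact s M p := forall w : koszul s M,
  kdeg p w -> kdiff w = 0 -> exists2 w', kdeg p.+1 w' & kdiff w' = w.

Lemma pairD (A B : nmodType) (a a' : A) (b b' : B) : (a, b) + (a', b') = (a + a', b + b').
Proof. by []. Qed.
Lemma pairZ V W c (a : V) (b : W) : c *: (a, b) = (c *: a, c *: b).
Proof. by []. Qed.

Lemma kdiff_linear s M : linear (@kdiff s M).
Proof.
elim: s => [|a s IH] c x y; first by rewrite /= scaler0 addr0.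
rewrite /= !IH pairZ pairD; congr (_, _).
  by rewrite !scalerDr !scalerA [c * a]mulrC addrACA.
by rewrite opprD scalerN.
Qed.
HB.instance Definition _ s M := GRing.isLinear.Build R (koszul s M) (koszul s M) _
  (@kdiff s M) (@kdiff_linear s M).

Lemma kdiffK s M (w : koszul s M) : kdiff (kdiff w) = 0.
Proof.
elim: s w => [|a s IH] w //=; rewrite -[in RHS]/((0, 0)); congr (_, _).
  by rewrite linearD linearZ /= IH add0r scalerN subrr.
by rewrite linearN /= IH oppr0 oppr0.
Qed.

Lemma kdeg_lin s M p a (x y : koszul s M) : kdeg p x -> kdeg p y -> kdeg p (a *: x + y).
Proof.
elim: s p x y => [|b s IH] [|p] //=.
- by move=> x y -> ->; rewrite scaler0 addr0.
- by move=> [u v] [u' v'] /= [hu ->] [hu' ->]; rewrite scaler0 addr0; split=> //; apply: IH.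
by move=> [u v] [u' v'] /= [hu hv] [hu' hv']; split; apply: IH.
Qed.

Lemma kdeg0 s M p : kdeg p (0 : koszul s M).
Proof. by elim: s p => [|b s IH] [|p] //=; split. Qed.

Lemma kdegZ s M p a (x : koszul s M) : kdeg p x -> kdeg p (a *: x).
Proof. by move=> h; rewrite -[_ *: _]addr0; apply: kdeg_lin h (kdeg0 _ _ _). Qed.
Lemma kdegD s M p (x y : koszul s M) : kdeg p x -> kdeg p y -> kdeg p (x + y).
Proof. by move=> h h'; rewrite -[x]scale1r; apply: kdeg_lin. Qed.
Lemma kdegN s M p (x : koszul s M) : kdeg p x -> kdeg p (- x).
Proof. by rewrite -scaleN1r; apply: kdegZ. Qed.
Lemma kdegB s M p (x y : koszul s M) : kdeg p x -> kdeg p y -> kdeg p (x - y).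
Proof. by move=> h h'; apply: kdegD h (kdegN h'). Qed.
Lemma kdiff_deg0 s M (w : koszul s M) : kdeg 0 w -> kdiff w = 0.
Proof.
elim: s w => [|b s' IH'] //= [u v] /= [/IH' -> ->].
by rewrite !linear0 addr0.
Qed.

Lemma kdeg_diff s M p (w : koszul s M) : kdeg p.+1 w -> kdeg p (kdiff w).
Proof.
elim: s p w => [|a s IH] p w /=; first by case: p.
move=> [h1 h2]; split; first by apply: kdegD; [apply: IH | apply: kdegZ].
case: p h1 h2 => [|p] h1 h2; last by apply/kdegN/IH.
by rewrite (kdiff_deg0 h2) oppr0.
Qed.

Lemma kdeg_gt s M p (w : koszul s M) : (size s < p)%N -> kdeg p w -> w = 0.
Proof.
elim: s p w => [|a s IH] [|p] //= [u v] hs /= [hu hv].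
have -> : u = 0 by apply: IH hu; apply: ltnW.
by have -> : v = 0 by apply: IH hv.
Qed.

Section Map.
Variables (V W : lmodType R) (f : {linear V -> W}).

Lemma kmap_linear s : linear (@kmap s V W f).
Proof.
elim: s => [|a s IH] c x y; first by rewrite /= linearP.
by rewrite /= !IH.
Qed.
HB.instance Definition _ s := GRing.isLinear.Build R (koszul s V) (koszul s W) _
  (@kmap s V W f) (@kmap_linear s).

Lemma kmap_diff s (w : koszul s V) : kdiff (kmap f w) = kmap f (kdiff w).
Proof.
elim: s w => [|a s IH] w /=; first by rewrite linear0.
by rewrite linearD linearN linearZ /= !IH.
Qed.

Lemma kmap_deg s p (w : koszul s V) : kdeg p w -> kdeg p (kmap f w).
Proof.
elim: s p w => [|a s IH] [|p] //=; first by move=> w ->; rewrite linear0.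
  by move=> [u v] /= [/IH h ->]; rewrite linear0.
by move=> [u v] /= [/IH h /IH h'].
Qed.

Lemma kmap_surj s p (w : koszul s W) : (forall y, exists x, f x = y) ->
  kdeg p w -> exists2 w', kdeg p w' & kmap f w' = w.
Proof.
move=> fs; elim: s p w => [|a s IH] [|p] /=.
- by move=> w _; have [x <-] := fs w; exists x.
- by move=> w ->; exists 0; rewrite ?linear0.
- move=> [u v] /= [/IH[u' hu <-] ->]; exists (u', 0) => //=.
  by rewrite linear0.
move=> [u v] /= [/IH[u' hu <-] /IH[v' hv <-]]; by exists (u', v').
Qed.

Lemma kmap_inj s : injective f -> injective (@kmap s V W f).
Proof.
move=> fi; elim: s => [|a s IH] //= [u v] [u' v'] /= [/IH -> /IH ->] //.
Qed.

Lemma kmap_kin s (v : V) : kmap f (kin s v) = kin s (f v).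
Proof. by elim: s => //= a s ->; rewrite linear0. Qed.
End Map.

Lemma kmap_exact s p U V W (i : {linear U -> V}) (f : {linear V -> W}) (w : koszul s V) :
  (forall v, f v = 0 -> exists u, i u = v) ->
  kdeg p w -> kmap f w = 0 -> exists2 w', kdeg p w' & kmap i w' = w.
Proof.
move=> h; elim: s p w => [|a s IH] [|p] /=.
- by move=> w _ /h[u <-]; exists u.
- by move=> w -> _; exists 0; rewrite ?linear0.
- move=> [u v] /= [hu ->] [/(IH _ _ hu)[u' hu' <-] _]; exists (u', 0) => //=.
  by rewrite linear0.
move=> [u v] /= [hu hv] [/(IH _ _ hu)[u' hu' <-] /(IH _ _ hv)[v' hv' <-]].
by exists (u', v').
Qed.

Lemma kmap_scale s V b (w : koszul s V) : kmap (scale_lin b (id_lin V)) w = b *: w.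
Proof. by elim: s w => [|a s IH] //= [u v] /=; rewrite !IH. Qed.

Lemma kmap_comp0 s U V W (i : {linear U -> V}) (f : {linear V -> W}) (w : koszul s U) :
  (forall u, f (i u) = 0) -> kmap f (kmap i w) = 0.
Proof.
move=> h; elim: s w => [|a s IH] w //=; by rewrite !IH.
Qed.

Lemma kin_linear s M : linear (@kin s M).
Proof.
elim: s => [|a s IH] c x y //=.
by rewrite IH pairZ pairD scaler0 addr0.
Qed.
HB.instance Definition _ s M := GRing.isLinear.Build R M (koszul s M) _
  (@kin s M) (@kin_linear s M).

Lemma kin_deg s M (v : M) : kdeg 0 (kin s v).
Proof. by elim: s => //= a s IH. Qed.

Lemma kin_diff s M (v : M) : kdiff (kin s v) = 0.
Proof. exact/kdiff_deg0/kin_deg. Qed.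

Lemma kin_exists s M (w : koszul s M) : kdeg 0 w -> exists v, kin s v = w.
Proof.
elim: s w => [|a s IH] /=; first by move=> w; exists w.
by move=> [u v] /= [/IH[x <-] ->]; exists x.
Qed.

(** H_0 of the Koszul complex is M / (s) M; membership in (s) M thus becomes a statement about
    boundaries. *)
Lemma kin_bound s M (v : M) :
  v \in ideal_gen s ** M <-> exists2 w, kdeg 1 w & kdiff w = kin s v.
Proof.
elim: s v => [|a s IH] v.
  split=> [/gmul_nil -> |[w _ /= <-]]; first by exists 0; rewrite ?linear0.
  exact: subm0.
split=> [/gmul_cons[u [w [/IH[z hz e] ->]]]|[[u z] /= [hu hz] [e1 e2]]].
  exists (z, kin s u); first by split=> //=; apply: kin_deg.
  by rewrite /= e kin_diff oppr0 linearD linearZ /= addrC.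
have [y ey] := kin_exists hz; apply/gmul_cons; exists y, (v - a *: y).
split; last by rewrite addrC subrK.
apply/IH; exists u => //.
by rewrite linearB linearZ /= ey -e1 addrK.
Qed.

Lemma homotopy_cons a s M (h : {linear koszul s M -> koszul s M}) :
  linear (fun w : koszul (a :: s) M => ((h w.1, - h w.2) : koszul (a :: s) M)).
Proof.
move=> c [u v] [u' v']; rewrite /= !linearP pairZ pairD; congr (_, _).
Qed.

Lemma homotopy_head a s M :
  linear (fun w : koszul (a :: s) M => ((0, w.1) : koszul (a :: s) M)).
Proof. by move=> c [u v] [u' v']; rewrite /= pairZ pairD scaler0 addr0. Qed.

(** On the cone over [a], moving the first factor into the second is a homotopy for [a]. A homotopy
    h on the smaller complex extends as (h, -h), the sign matching that of [kdiff] on the shifted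
    copy. *)
Lemma koszul_homotopy s M b : b \in ideal_gen s ->
  exists h : {linear koszul s M -> koszul s M},
    (forall p w, kdeg p w -> kdeg p.+1 (h w)) /\
    forall w, kdiff (h w) + h (kdiff w) = b *: w.
Proof.
elim: s b => [|a s IH] b.
  move=> /generated_nil ->; exists (scale_lin 0 (id_lin _)); split=> [p w _|w] /=.
    by rewrite scale0r.
  by rewrite !scale0r addr0.
move=> /generated_cons[c [b' [/IH[h [hdeg hP]] ->]]].
exists (add_lin (scale_lin c (mklin (@homotopy_head a s M))) (mklin (@homotopy_cons a s M h))).
split=> [p [u v] [/= hu hv]|[u v]].
  rewrite scaler0 add0r; split; first exact: hdeg.
  apply: kdegD; first exact: kdegZ.
  case: p hu hv => [|p] hu hv; last by apply/kdegN/hdeg.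
  by rewrite hv linear0 oppr0; apply: kdeg0.
have ku w : kdiff (h w) = b' *: w - h (kdiff w) by rewrite -hP addrK.
rewrite /= !scaler0 !add0r !pairZ !pairD scaler0 add0r; congr (_, _).
  rewrite ku scalerBr [h (_ + _)]linearD [h (a *: _)]linearZ /=.
  by rewrite addrACA !subrK addrC scalerDl scalerA (mulrC a c).
have e1 : kdiff (c *: u - h v) = c *: kdiff u - kdiff (h v) by rewrite linearB linearZ.
rewrite /= e1 [h (- _)]linearN opprK.
rewrite ku scalerDr opprB !addrA subrK addrAC subrK.
by rewrite addrC scalerDl scalerA.
Qed.

Lemma mulM_pair J V W (v : V) (w : W) :
  (v, w) \in J ** (V * W)%type <-> v \in J ** V /\ w \in J ** W.
Proof.
split=> [h|[hv hw]].
  have lf : linear (fun w : (V * W)%type => w.1) by [].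
  have lg : linear (fun w : (V * W)%type => w.2) by [].
  by split; [apply: (lin_mulM (mklin lf) h) | apply: (lin_mulM (mklin lg) h)].
have lf : linear (fun v : V => (v, 0) : (V * W)%type).
  by move=> a x y; rewrite pairZ pairD scaler0 addr0.
have lg : linear (fun w : W => (0, w) : (V * W)%type).
  by move=> a x y; rewrite pairZ pairD scaler0 addr0.
have -> : (v, w) = mklin lf v + mklin lg w by rewrite /= pairD addr0 add0r.
by apply: submD; apply: lin_mulM.
Qed.

Lemma finite_pair V W : finite_module V -> finite_module W ->
  finite_module (V * W)%type.
Proof.
move=> [s hs] [t ht].
have lf : linear (fun v : V => (v, 0) : (V * W)%type).
  by move=> a x y; rewrite pairZ pairD scaler0 addr0.
have lg : linear (fun w : W => (0, w) : (V * W)%type).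
  by move=> a x y; rewrite pairZ pairD scaler0 addr0.
exists (map (mklin lf) s ++ map (mklin lg) t) => -[v w].
have -> : (v, w) = mklin lf v + mklin lg w by rewrite /= pairD addr0 add0r.
apply: submD.
  apply: (@generatedS _ _ (map (mklin lf) s)); last by apply/generated_map; exists v.
  by move=> y hy; rewrite mem_cat hy.
apply: (@generatedS _ _ (map (mklin lg) t)); last by apply/generated_map; exists w.
by move=> y hy; rewrite mem_cat hy orbT.
Qed.

Lemma finite_koszul s M : finite_module M -> finite_module (koszul s M).
Proof. by move=> hM; elim: s => //= a s IH; apply: finite_pair. Qed.

(** Regularity stated on elements of [M] rather than of its quotients; the condition that M differs
    from (s) M is kept apart in [regular_sequenceP]. *)
Definition regular_on M s := forall i, (i < size s)%N -> forall v : M,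
  s`_i *: v \in ideal_gen (take i s) ** M -> v \in ideal_gen (take i s) ** M.

Lemma regular_sequenceP M s : regular_sequence M s <->
  regular_on M s /\ exists v : M, v \notin ideal_gen s ** M.
Proof.
split=> [[h [y hy]]|[h [z hz]]]; split.
- move=> i hi v hv; apply/quotpi_eq0; apply: (h i hi).
  by rewrite -linearZ; apply/quotpi_eq0.
- have [v ev] := quotpi_surj y; exists v; apply: contra hy => /quotpi_eq0 e.
  by rewrite -ev e.
- move=> i hi y; have [v <-] := quotpi_surj y; rewrite -linearZ => /quotpi_eq0 hv.
  by apply/quotpi_eq0; apply: h.
by exists (quotpi _ z); apply: contra hz => /eqP/quotpi_eq0.
Qed.

(** Regularity peeled off from the head. [M'] is any model of M / b M, so an induction can change
    the module without nesting quotient types. *)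
Fixpoint regular_rec s M : Prop :=
  if s is b :: s' then
    (forall v : M, b *: v = 0 -> v = 0) /\
    exists (M' : lmodType R) (f : {linear M -> M'}),
      [/\ forall w, exists v, f v = w, forall v, f v = 0 <-> exists u, v = b *: u
        & regular_rec s' M']
  else True.

Lemma regular_on_rec M s t : regular_on M (s ++ t) ->
  regular_rec t (quotmod (ideal_gen s ** M)).
Proof.
elim: t s => [|b t IH] s // h.
have et : take (size s) (s ++ b :: t) = s by rewrite take_size_cat.
split=> [y|].
  have [v <-] := quotpi_surj y; rewrite -linearZ => /quotpi_eq0 hv.
  apply/quotpi_eq0; have := h (size s); rewrite et size_cat /= nth_cat ltnn subnn /=.
  by apply=> //; rewrite addnS ltnS leq_addr.
exists (quotmod (ideal_gen (rcons s b) ** M)).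
have [|g gP] := factor_surj (f := quotpi (ideal_gen (rcons s b) ** M))
  (@quotpi_surj _ _ (ideal_gen s ** M)).
  move=> v /quotpi_eq0 hv; apply/quotpi_eq0/gmul_rcons; exists 0, v.
  by rewrite scaler0 add0r.
exists g; split.
- by move=> w; have [v <-] := quotpi_surj w; exists (quotpi _ v).
- move=> y; have [v <-] := quotpi_surj y; rewrite gP; split.
    move=> /quotpi_eq0/gmul_rcons[u [w [hw ->]]]; exists (quotpi _ u).
    have /quotpi_eq0 e := hw; by rewrite linearD e addr0 linearZ.
  case=> z; have [u <-] := quotpi_surj z; rewrite -linearZ => e.
  apply/quotpi_eq0/gmul_rcons; exists u, (v - b *: u).
  split; last by rewrite addrC subrK.
  by apply/quotpi_eq0; rewrite linearB e subrr.
by apply: IH; rewrite cat_rcons.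
Qed.

Lemma regular_rec_iso s M M' (f : {linear M -> M'}) :
  injective f -> (forall w, exists v, f v = w) -> regular_rec s M' -> regular_rec s M.
Proof.
case: s => // b s fi fs [h [N [g [gs g0 hN]]]]; split.
  by move=> v e; apply: fi; rewrite linear0; apply: h; rewrite -linearZ e linear0.
exists N, (comp_lin g f); split=> //.
  by move=> w; have [y <-] := gs w; have [v <-] := fs y; exists v.
move=> v; rewrite comp_linE g0; split=> [[u e]|[u ->]].
  by have [u' e'] := fs u; exists u'; apply: fi; rewrite linearZ /= e'.
by exists (f u); rewrite linearZ.
Qed.

Lemma regular_onP M s : regular_on M s -> regular_rec s M.
Proof.
move=> h; apply: (regular_rec_iso (f := quotpi (ideal_gen [::] ** M))).
- by apply: inj_lin => v /quotpi_eq0/gmul_nil.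
- exact: quotpi_surj.
exact: (@regular_on_rec M [::] s).
Qed.

(** Depth sensitivity of the Koszul complex. For 0 -> M -> M -> M' -> 0 given by b, the vanishing of
    H_(p+1)(s; M') makes b injective on H_p(s; M), while a power of b lies in (s) and kills this
    homology. *)
Lemma koszul_acyclic s (t : seq R) M :
  (forall b : R, b \in t -> exists n, b ^+ n \in ideal_gen s) -> regular_rec t M ->
  forall p, (size s < p + size t)%N -> kexact s M p.
Proof.
elim: t M => [|b t IH] M ht.
  move=> _ p; rewrite addn0 => hp w hw _; exists 0; first exact: kdeg0.
  by rewrite linear0 (kdeg_gt hp hw).
move=> [binj [M' [f [fs f0 hM']]]] p hp w hw dw.
have {}IH : kexact s M' p.+1.
  apply: IH hM' _ _ => [c hc|]; first by apply: ht; rewrite in_cons hc orbT.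
  by rewrite addSn -addnS.
have step (w' : koszul s M) : kdeg p w' -> kdiff w' = 0 -> (exists2 u, kdeg p.+1 u & kdiff u = b *: w') ->
    exists2 u, kdeg p.+1 u & kdiff u = w'.
  move=> hw' dw' [u hu eu].
  have [||v hv ev] := IH (kmap f u); first exact: kmap_deg.
    rewrite kmap_diff eu -kmap_scale.
    by apply: kmap_comp0 => x; apply/f0; exists x.
  have [v' hv' e'] := kmap_surj fs hv.
  have [|||z hz ez] := @kmap_exact s p.+1 M M M' (scale_lin b (id_lin M)) f (u - kdiff v').
  - by move=> x /f0[y ->]; exists y.
  - by apply: kdegB => //; apply: kdeg_diff.
  - by rewrite linearB /= -kmap_diff e' ev subrr.
  exists z => //; apply/eqP; rewrite -subr_eq0; apply/eqP.
  have : b *: (kdiff z - w') = 0.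
    have ez' : b *: z = u - kdiff v' by rewrite -ez kmap_scale.
    have -> : b *: (kdiff z - w') = kdiff (b *: z) - b *: w' by rewrite scalerBr [kdiff (b *: z)]linearZ.
    by rewrite ez' linearB /= eu kdiffK subr0 subrr.
  rewrite -kmap_scale => e0.
  apply: (kmap_inj (f := scale_lin b (id_lin M))); last by rewrite e0 linear0.
  by apply: inj_lin => x; apply: binj.
have [n hn] := ht b (mem_head _ _).
have [h [hdeg hP]] := koszul_homotopy M hn.
have : exists2 u, kdeg p.+1 u & kdiff u = b ^+ n *: w.
  by exists (h w); [apply: hdeg | rewrite -hP dw linear0 addr0].
elim: n {hn h hdeg hP} => [|n IHn]; first by rewrite expr0 scale1r.
rewrite exprS -scalerA => h; apply/IHn/step => //; first exact: kdegZ.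
by rewrite linearZ /= dw scaler0.
Qed.

End Koszul.

Section Depth.
Variables (R : comNzRingType) (m : ideal R).
Hypothesis hnoeth : noetherian_ring R.
Hypothesis hlocal : local_ring m.
Implicit Types (M : lmodType R) (s : seq R).

Lemma regular_rcons M s a : regular_on M s ->
  (forall v : M, a *: v \in ideal_gen s ** M -> v \in ideal_gen s ** M) ->
  regular_on M (rcons s a).
Proof.
move=> hs ha i; rewrite size_rcons ltnS leq_eqVlt => /orP[/eqP->|hi] v.
  by rewrite -cats1 take_size_cat // nth_cat ltnn subnn; apply: ha.
rewrite -cats1 take_cat hi nth_cat hi; exact: hs.
Qed.

(** Exactness for the cone over [a] makes [a] surjective on H_p of the smaller complex for p > 0,
    which Nakayama then kills, and injective on H_0. A new element enters the complex at the head
    but a regular sequence at the end, whence the reversal. *)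
Lemma koszul_regular s M : finite_module M -> {subset s <= m} ->
  (forall p, (0 < p)%N -> kexact s M p) -> regular_on M (rev s).
Proof.
move=> hM; elim: s => [|a s IH] hs hex; first by [].
have ham : a \in m by apply: hs; rewrite mem_head.
have {}IH : regular_on M (rev s).
  apply: IH => [b hb|p hp]; first by apply: hs; rewrite in_cons hb orbT.
  move=> w hw dw.
  pose U := msub (fun w : koszul s M => kdeg p w /\ kdiff w = 0).
  have UP z : z \in U <-> kdeg p z /\ kdiff z = 0.
    apply: msubP; first by split; [apply: kdeg0 | rewrite linear0].
    move=> c x y [h1 h2] [h3 h4]; split; first exact: kdeg_lin.
    by rewrite linearP /= h2 h4 scaler0 addr0.
  pose N := msub (fun w : koszul s M => exists2 w', kdeg p.+1 w' & kdiff w' = w).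
  have NP z : z \in N <-> exists2 w', kdeg p.+1 w' & kdiff w' = z.
    apply: msubP; first by exists 0; [apply: kdeg0 | rewrite linear0].
    move=> c x y [x' h1 h2] [y' h3 h4]; exists (c *: x' + y'); first exact: kdeg_lin.
    by rewrite linearP /= h2 h4.
  apply/NP; apply: (nakayama hnoeth hlocal (U := U) (finite_koszul s hM)); last exact/UP.
  move=> z /UP[hz dz].
  have [||[u v] /= [hu hv] [eu ev]] := hex p hp ((z, 0) : koszul (a :: s) M).
  - by split=> //=; case: (p) => [|q] //; apply: kdeg0.
  - by rewrite /= scaler0 addr0 dz linear0 oppr0.
  exists (a *: v).
    apply: mem_ideal_mul => //; apply/UP; split=> //.
    by apply: oppr_inj; rewrite ev oppr0.
  by rewrite -eu addrK; apply/NP; exists u.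
rewrite rev_cons; apply: regular_rcons => // v.
have e : ideal_gen (rev s) ** M =i ideal_gen s ** M.
  by apply: gmul_eq_mem => c; rewrite mem_rev.
rewrite !e => /kin_bound[u hu eu].
have [||[u' v'] /= [_ hv'] [_ ev]] := hex 1%N isT ((- u, kin s v) : koszul (a :: s) M).
- by split=> /=; [apply: kdegN | apply: kin_deg].
- by rewrite /= linearN /= eu kin_diff linearZ /= addNr oppr0.
apply/kin_bound; exists (- v'); first exact: kdegN.
by rewrite linearN.
Qed.

(** * Regularity and depth tested on a system of parameters *)

Section ParameterSystems.
Variable x : seq R.
Hypothesis hx : primary_to m (ideal_gen x).

Lemma param_sub : {subset x <= m}.
Proof.
move=> a ha; have [_ _ h] := hx; apply/h; exists 1%N; rewrite expr1.
exact: mem_generated.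
Qed.

Lemma param_power b : b \in m -> exists n, b ^+ n \in ideal_gen x.
Proof. by have [_ _ h] := hx; move/h. Qed.

(** Elements of [m] have powers in (x), so a regular sequence of the same length makes the Koszul
    complex of [rev x] exact in positive degrees, which in turn makes [x] regular. *)
Lemma regular_param M s : finite_module M -> {subset s <= m} -> regular_on M s ->
  size s = size x -> regular_on M x.
Proof.
move=> hM hs /regular_onP hreg es; rewrite -(revK x); apply: koszul_regular => //.
  by move=> a; rewrite mem_rev; apply: param_sub.
move=> p hp; apply: koszul_acyclic hreg _ _.
  move=> b /hs/param_power[n hn]; exists n; apply: generatedS hn => c.
  by rewrite mem_rev.
by rewrite size_rev es -addn1 addnC leq_add2r.
Qed.

(** A regular sequence longer than [x] would make even H_0(x; M) = M / (x) M vanish. *)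
Lemma depth_param M : finite_module M -> regular_on M x ->
  (exists v : M, v \notin ideal_gen x ** M) -> depth m M (size x).
Proof.
move=> hM hreg hne; split.
  by exists x; split=> //; [exact: param_sub | apply/regular_sequenceP].
move=> s hs /regular_sequenceP[/regular_onP hreg' _]; rewrite leqNgt; apply/negP => hlt.
case: hne => v /negP; apply; apply/kin_bound.
apply: (koszul_acyclic (t := s)) => //; last 2 first.
- exact: kin_deg.
- exact: kin_diff.
by move=> b /hs/param_power.
Qed.

Lemma maximal_CM_regular M : krull_dim R (size x) -> maximal_CM m M -> regular_on M x.
Proof.
move=> [hd1 hd2] [hM [d [[p hp] hd2'] [[s [es sm /regular_sequenceP[hs _]]] _]]].
apply: regular_param hs _ => //; rewrite es; apply/eqP.
by rewrite eqn_leq (hd2 _ _ hp); case: hd1 => q /hd2' ->.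
Qed.

Lemma maximal_CM_intro M : krull_dim R (size x) -> finite_module M -> regular_on M x ->
  (exists v : M, v \notin ideal_gen x ** M) -> maximal_CM m M.
Proof. by move=> hd hM hx1 hx2; split=> //; exists (size x) => //; apply: depth_param. Qed.

Lemma maximal_CM_nonzero M : maximal_CM m M -> exists v : M, v != 0.
Proof.
move=> [hM [d _ [[s [_ _ [_ [y hy]]]] _]]]; have [v ev] := quotpi_surj y.
by exists v; apply: contra hy => /eqP e; rewrite -ev e linear0.
Qed.

End ParameterSystems.
End Depth.

(** * Ext from an injective resolution of the ring *)

Section ShortExact.
Variable R : comNzRingType.
Implicit Types (U V W A B C M N : lmodType R).

Definition short_exact A B C (i : {linear A -> B}) (p : {linear B -> C}) :=
  [/\ injective i, forall c, exists b, p b = c & forall b, p b = 0 <-> exists a, i a = b].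

Lemma short_exact_quot V (U : submodClosed V) : short_exact (subval U) (quotpi U).
Proof.
split; [exact: subval_inj | exact: quotpi_surj |] => v; split.
  by move=> /quotpi_eq0 /subval_exists.
by case=> u <-; apply/quotpi_eq0/subvalP.
Qed.

Lemma short_exact_ker V W (p : {linear V -> W}) : (forall c, exists b, p b = c) ->
  short_exact (subval (mker p)) p.
Proof.
move=> ps; split; [exact: subval_inj | exact: ps | move=> v].
split=> [/in_mker/subval_exists //|[u <-]]; exact/in_mker/subvalP.
Qed.

Definition lin_of V W (h : Hom V W) : {linear V -> W} :=
  mklin (asboolW (valP h) : linear (val h)).
Definition hom_of V W (f : {linear V -> W}) : Hom V W :=
  exist _ (f : V -> W) (asboolT (fun a x y => linearP f a x y : _ = _)).
Lemma homD V W (f g : Hom V W) v : lin_of (f + g) v = lin_of f v + lin_of g v.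
Proof. by []. Qed.
Lemma homN V W (f : Hom V W) v : lin_of (- f) v = - lin_of f v.
Proof. by []. Qed.
Lemma homZ V W a (f : Hom V W) v : lin_of (a *: f) v = a *: lin_of f v.
Proof. by []. Qed.
Lemma hom0 V W v : lin_of (0 : Hom V W) v = 0.
Proof. by []. Qed.
Lemma hom_ext V W (f g : Hom V W) : (forall v, lin_of f v = lin_of g v) -> f = g.
Proof. by move=> h; apply: val_inj; apply/funext. Qed.
Lemma hom_ofK V W (f : {linear V -> W}) v : lin_of (hom_of f) v = f v.
Proof. by []. Qed.
End ShortExact.

Section Dual.
Variable R : comNzRingType.
Implicit Types (V W N : lmodType R).

Lemma postcomp_linear N V W (f : {linear V -> W}) :
  linear (fun g : Hom N V => hom_of (comp_lin f (lin_of g))).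
Proof. by move=> a g h; apply: hom_ext => v; rewrite homD homZ !hom_ofK /= linearP. Qed.
Definition postcomp N V W (f : {linear V -> W}) : {linear Hom N V -> Hom N W} :=
  mklin (@postcomp_linear N V W f).

Lemma finite_dual N : noetherian_ring R -> finite_module N ->
  finite_module (Hom N R^o).
Proof.
move=> hnoeth /finite_cover[k [p ps]].
have lev : linear (fun g : Hom N R^o => \row_j lin_of g (p (delta_mx 0 j))).
  by move=> a g h; apply/rowP => j; rewrite !mxE.
apply: (finite_inj hnoeth (f := mklin lev)); last exact: finite_rV.
apply: inj_lin => g /rowP hg; apply: hom_ext => v; have [u <-] := ps v.
rewrite -comp_linE (lin_comb_basis (comp_lin (lin_of g) p)) hom0 big1 // => j _.
by have := hg j; rewrite !mxE comp_linE => ->; rewrite scaler0.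
Qed.
End Dual.

Section InjectiveResolution.
Variable R : comNzRingType.
Variables (E : nat -> lmodType R) (e : {linear R^o -> E 0%N})
  (dE : forall n, {linear E n -> E n.+1}).
Hypothesis Einj : forall n, injective_module (E n).
Hypothesis einj : injective e.
Hypothesis Eexact0 : mim e =i mker (dE 0%N).
Hypothesis EexactS : forall n, mim (dE n) =i mker (dE n.+1).
Implicit Types (A B C M N : lmodType R).

(** Coboundaries of the complex Hom(N, E); nothing maps into degree 0, where only the zero map
    counts. *)
Definition null n N : {linear N -> E n} -> Prop :=
  match n with
  | 0 => fun f => forall v, f v = 0
  | n'.+1 => fun f => exists g : {linear N -> E n'}, forall v, f v = dE n' (g v)
  end.
Definition cocycle n N (f : {linear N -> E n}) := forall v, dE n (f v) = 0.
(* [ext_zero n N] says that [Ext^n(N, R)], computed from [E], vanishes. *)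
Definition ext_zero n N := forall f : {linear N -> E n}, cocycle f -> null f.

Lemma dEd n v : dE n.+1 (dE n v) = 0.
Proof. by apply/in_mker; rewrite -EexactS; apply/in_mim; exists v. Qed.

Lemma dEe r : dE 0 (e r) = 0.
Proof. by apply/in_mker; rewrite -Eexact0; apply/in_mim; exists r. Qed.

Lemma dE_exact n v : dE n.+1 v = 0 -> exists w, dE n w = v.
Proof. by move=> /in_mker; rewrite -EexactS => /in_mim. Qed.

Lemma cocycle0 N (f : {linear N -> E 0}) : cocycle f ->
  exists g : {linear N -> R^o}, forall v, e (g v) = f v.
Proof.
move=> h; apply: factor_inj => // v; apply/in_mim.
by rewrite Eexact0; apply/in_mker.
Qed.

Lemma null_lin n N a (f g k : {linear N -> E n}) : null f -> null g ->
  (forall v, k v = a *: f v + g v) -> null k.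
Proof.
case: n f g k => [|n] f g k /=.
  by move=> hf hg h v; rewrite h hf hg scaler0 addr0.
move=> [f' hf] [g' hg] h; exists (add_lin (scale_lin a f') g') => v.
by rewrite h hf hg /= linearP.
Qed.

Lemma null_ext n N (f g : {linear N -> E n}) : null f -> (forall v, g v = f v) -> null g.
Proof.
case: n f g => [|n] f g /=; first by move=> hf h v; rewrite h.
by move=> [k hk] h; exists k => v; rewrite h.
Qed.

Lemma ext_zero_retract n M N (i : {linear N -> M}) (p : {linear M -> N}) :
  (forall v, p (i v) = v) -> ext_zero n M -> ext_zero n N.
Proof.
move=> ip h f cf; have : null (comp_lin f p) by apply: h => v; rewrite comp_linE.
case: n f cf h => [|n] f cf h /=; first by move=> hf v; rewrite -(hf (i v)) /= ip.
by case=> g hg; exists (comp_lin g i) => v; rewrite comp_linE -hg /= ip.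
Qed.

Lemma ext_zero_rV n k : ext_zero n.+1 'rV[R]_k.
Proof.
move=> f cf; have /choice[g hg] i : exists w, dE n w = f (delta_mx 0 i) by apply: dE_exact.
exists (lin_comb g) => v; rewrite (lin_comb_basis f) lin_combE linear_sum.
by apply: eq_bigr => i _; rewrite linearZ /= hg.
Qed.

Lemma ext_zero_ring n : ext_zero n.+1 (R^o : lmodType R).
Proof.
move=> f cf; have [w hw] := dE_exact (cf 1).
have lg : linear (fun r : R^o => r *: w) by move=> a x y; rewrite scalerDl scalerA.
exists (mklin lg) => r; rewrite linearZ /= hw -linearZ /=; congr (f _).
by rewrite [RHS]mulr1.
Qed.

(** * Fragments of the long exact sequence of Ext *)

Section Exact.
Variables (A B C : lmodType R) (i : {linear A -> B}) (p : {linear B -> C}).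
Hypothesis hip : short_exact i p.

Let ii : injective i. Proof. by case: hip. Qed.
Let ps c : exists b, p b = c. Proof. by case: hip. Qed.
Let pi a : p (i a) = 0. Proof. by case: hip => _ _ h; apply/h; exists a. Qed.
Let kerp b : p b = 0 -> exists a, i a = b. Proof. by case: hip => _ _ h /h. Qed.

Lemma factor_exact N (f : {linear B -> N}) : (forall a, f (i a) = 0) ->
  exists g : {linear C -> N}, forall b, g (p b) = f b.
Proof. by move=> h; apply: factor_surj => // b /kerp[a <-]. Qed.

Lemma extend_exact n (f : {linear A -> E n}) :
  exists g : {linear B -> E n}, forall a, g (i a) = f a.
Proof. exact: Einj. Qed.

Lemma null_extend n (f : {linear A -> E n}) : null f ->
  exists g : {linear B -> E n}, cocycle g /\ forall a, g (i a) = f a.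
Proof.
case: n f => [|n] f /=.
  move=> h; exists (lin_of (0 : Hom B (E 0))); split=> [v|a].
    by rewrite hom0 linear0.
  by rewrite h hom0.
case=> g hg; have [g' hg'] := extend_exact g.
exists (comp_lin (dE n) g'); split=> v; first exact: dEd.
by rewrite comp_linE hg' hg.
Qed.

Lemma ext_zero_mid n : ext_zero n A -> ext_zero n C -> ext_zero n B.
Proof.
move=> hA hC f cf.
have /hA : cocycle (comp_lin f i) by move=> a; apply: cf.
case: n f cf hA hC => [|n] f cf hA hC /=.
  move=> h; have [g hg] := factor_exact h.
  have /hC hg0 : cocycle g by move=> c; have [b <-] := ps c; rewrite hg.
  by move=> v; rewrite -hg hg0.
case=> g hg; have [g' hg'] := extend_exact g.
have [|k hk] := factor_exact (f := sub_lin f (comp_lin (dE n) g')).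
  by move=> a; rewrite /= hg' -hg subrr.
have /hC[k' hk'] : cocycle k.
  by move=> c; have [b <-] := ps c; rewrite hk /= linearB cf dEd subrr.
exists (add_lin g' (comp_lin k' p)) => v.
by rewrite /= linearD -hk' hk /= addrC subrK.
Qed.

Lemma ext_zero_right n : ext_zero n A -> ext_zero n.+1 B -> ext_zero n.+1 C.
Proof.
move=> hA hB f cf.
have /hB[g hg] : cocycle (comp_lin f p) by move=> b; apply: cf.
have /hA : cocycle (comp_lin g i) by move=> a; rewrite comp_linE -hg /= pi linear0.
move=> /null_extend[h [ch hh]].
have [|k hk] := factor_exact (f := sub_lin g h); first by move=> a; rewrite /= hh subrr.
exists k => c; have [b <-] := ps c.
by rewrite hk linearB ch subr0 -hg.
Qed.

(** The differential of any extension of [f] factors through [C] and represents the connecting image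
    of [f] in Ext^(n+1)(C, R). As this class is zero, the extension can be corrected to a
    cocycle. *)
Lemma ext_extend n (f : {linear A -> E n}) : ext_zero n.+1 C -> cocycle f ->
  exists h : {linear B -> E n}, cocycle h /\ forall a, h (i a) = f a.
Proof.
move=> hC cf; have [f' hf'] := extend_exact f.
have [|k hk] := factor_exact (f := comp_lin (dE n) f'); first by move=> a; rewrite /= hf' cf.
have /hC[g hg] : cocycle k by move=> c; have [b <-] := ps c; rewrite hk dEd.
exists (sub_lin f' (comp_lin g p)); split=> v; last by rewrite /= pi linear0 subr0 hf'.
by rewrite /= linearB -hg hk subrr.
Qed.

Lemma ext_zero_left n : ext_zero n.+1 C -> ext_zero n B -> ext_zero n A.
Proof.
move=> hC hB f cf; have [h [ch hh]] := ext_extend hC cf.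
have := hB h ch; case: n f cf h ch hh hC hB => [|n] f cf h ch hh hC hB /=.
  by move=> h0 a; rewrite -hh.
by case=> g hg; exists (comp_lin g i) => a; rewrite -hh hg.
Qed.

Lemma ext_one_extend : ext_zero 1 C -> forall f : {linear A -> R^o},
  exists h : {linear B -> R^o}, forall a, h (i a) = f a.
Proof.
move=> hC f; have [|h [ch hh]] := ext_extend (f := comp_lin e f) hC.
  by move=> a; apply: dEe.
have [g hg] := cocycle0 ch; exists g => a; apply: einj.
by rewrite hg hh.
Qed.

Lemma extend_ext_one : ext_zero 1 B -> (forall f : {linear A -> R^o},
  exists h : {linear B -> R^o}, forall a, h (i a) = f a) -> ext_zero 1 C.
Proof.
move=> hB hext f cf.
have /hB[g hg] : cocycle (comp_lin f p) by move=> b; apply: cf.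
have /cocycle0[chi hchi] : cocycle (comp_lin g i).
  by move=> a; rewrite comp_linE -hg /= pi linear0.
have [psi hpsi] := hext chi.
have [|k hk] := factor_exact (f := sub_lin g (comp_lin e psi)).
  by move=> a; rewrite /= hpsi hchi subrr.
exists k => c; have [b <-] := ps c.
by rewrite hk linearB /= dEe subr0 -hg.
Qed.

(** Since Ext^(n+1)(B, R) = 0, the connecting map embeds Ext^(n+1)(A, R) into Ext^(n+2)(C, R), and
    annihilators are inherited. *)
Lemma ext_kill_left n (c : R) : ext_zero n.+1 B ->
  (forall f : {linear C -> E n.+2}, cocycle f -> null (scale_lin c f)) ->
  forall f : {linear A -> E n.+1}, cocycle f -> null (scale_lin c f).
Proof.
move=> hB hC f cf; have [f' hf'] := extend_exact f.
have [|k hk] := factor_exact (f := comp_lin (dE n.+1) f').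
  by move=> a; rewrite /= hf' cf.
have [g hg] : null (scale_lin c k).
  by apply: hC => y; have [b <-] := ps y; rewrite hk dEd.
have /hB[l hl] : cocycle (sub_lin (scale_lin c f') (comp_lin g p)).
  by move=> b; rewrite /= linearB -hg /= hk linearZ /= subrr.
exists (comp_lin l i) => a.
by rewrite comp_linE -hl /= pi linear0 subr0 hf'.
Qed.

End Exact.

(** The obstruction to extending [f] to [B] is its connecting image in Ext^1(C, R), which [c]
    annihilates. *)
Lemma ext_kill_one A B C (i : {linear A -> B}) (p : {linear B -> C}) (c : R) :
  short_exact i p ->
  (forall f : {linear C -> E 1}, cocycle f -> null (scale_lin c f)) ->
  forall f : {linear A -> R^o}, exists h : {linear B -> R^o}, forall a, h (i a) = c *: f a.
Proof.
move=> hip hC f; have [ii ps kerp] := hip.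
have pi a : p (i a) = 0 by apply/kerp; exists a.
have [f' hf'] := extend_exact hip (comp_lin e f).
have [|k hk] := factor_exact hip (f := comp_lin (dE 0) f').
  by move=> a; rewrite /= hf' dEe.
have [g hg] : null (scale_lin c k).
  by apply: hC => y; have [b <-] := ps y; rewrite hk dEd.
have /cocycle0[l hl] : cocycle (sub_lin (scale_lin c f') (comp_lin g p)).
  by move=> b; rewrite /= linearB -hg /= hk linearZ /= subrr.
exists l => a; apply: einj.
by rewrite hl /= pi linear0 subr0 hf' linearZ.
Qed.

Lemma ext_zero_shift n k N M (i : {linear N -> 'rV[R]_k}) (p : {linear 'rV[R]_k -> M}) :
  short_exact i p -> ext_zero n.+1 N <-> ext_zero n.+2 M.
Proof.
move=> h; split=> h'; first exact: (ext_zero_right h h' (@ext_zero_rV _ _)).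
exact: (ext_zero_left h h' (@ext_zero_rV _ _)).
Qed.

Section Finite.
Variable m : ideal R.
Hypothesis hnoeth : noetherian_ring R.
Hypothesis hlocal : local_ring m.

Definition null_sub n N : submodClosed (Hom N (E n)) := msub (fun f => null (lin_of f)).

Lemma null_subP n N (f : Hom N (E n)) : f \in null_sub n N <-> null (lin_of f).
Proof.
apply: msubP => [|a x y hx hy]; last exact: (null_lin hx hy).
by case: n f => [|n] f //=; exists (lin_of (0 : Hom N (E n))) => v; rewrite hom0 linear0.
Qed.

(** Finite generation of Ext^n(N, R), by dimension shifting down to the dual of a finite module. *)
Lemma ext_fg n N : finite_module N ->
  exists s : seq (Hom N (E n)), (forall f, f \in s -> cocycle (lin_of f)) /\
    forall f : Hom N (E n), cocycle (lin_of f) ->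
      exists2 w, w \in generated s & f - w \in null_sub n N.
Proof.
elim: n N => [|n IH] N hN.
  have [t ht] := finite_dual hnoeth hN; exists (map (postcomp N e) t); split.
    by move=> _ /mapP[u hu ->] v; rewrite /= dEe.
  move=> f /cocycle0[g hg]; exists (postcomp N e (hom_of g)).
    by apply/generated_map; exists (hom_of g).
  by apply/null_subP => v; rewrite homD homN /= hg subrr.
have [k [p ps]] := finite_cover hN; have hip := short_exact_ker ps.
have [_ _ kerp] := hip.
have [|s [hs1 hs2]] := IH (submod (mker p)).
  by apply: finite_submod => //; apply: finite_rV.
set i := subval (mker p) in hip kerp.
(* [D h] represents the connecting image of the cocycle [h]; it is 0 by default when [h] is not a
   cocycle. *)
have /choice[D hD] (h : Hom (submod (mker p)) (E n)) : exists D : Hom N (E n.+1),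
    cocycle (lin_of h) -> exists h' : {linear 'rV[R]_k -> E n},
    (forall a, h' (i a) = lin_of h a) /\ forall u, lin_of D (p u) = dE n (h' u).
  have [ch|] := pselect (cocycle (lin_of h)); last by exists 0.
  have [h' eh'] := extend_exact hip (lin_of h).
  have [|D eD] := factor_exact hip (f := comp_lin (dE n) h').
    by move=> a; rewrite comp_linE eh'.
  by exists (hom_of D) => _; exists h'; split=> // u; rewrite hom_ofK eD.
exists (map D s); split.
  move=> _ /mapP[h /hs1 ch ->] v; have [u <-] := ps v.
  by have [h' [_ ->]] := hD h ch; rewrite dEd.
(* [D] is chosen pointwise and need not be linear, so its values are combined through a linearly
   closed predicate. *)
have QP : forall w, w \in msub (fun w => exists (w' : {linear 'rV[R]_k -> E n}) (Dw : Hom N (E n.+1)),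
    [/\ forall a, w' (i a) = lin_of w a, Dw \in generated (map D s)
      & forall u, lin_of Dw (p u) = dE n (w' u)]) <->
    exists (w' : {linear 'rV[R]_k -> E n}) (Dw : Hom N (E n.+1)),
    [/\ forall a, w' (i a) = lin_of w a, Dw \in generated (map D s)
      & forall u, lin_of Dw (p u) = dE n (w' u)].
  apply: msubP.
    exists (lin_of (0 : Hom 'rV[R]_k (E n))), 0; split=> [a||u]; rewrite ?hom0 ?linear0 //.
    exact: subm0.
  move=> a x y [x' [Dx [h1 h2 h3]]] [y' [Dy [h4 h5 h6]]].
  exists (add_lin (scale_lin a x') y'), (a *: Dx + Dy); split=> [v||u].
  - by rewrite homD homZ -h1 -h4.
  - by apply: submD => //; apply: submZ.
  by rewrite homD homZ h3 h6 linearP.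
have {}QP w : w \in generated s -> exists (w' : {linear 'rV[R]_k -> E n}) (Dw : Hom N (E n.+1)),
    [/\ forall a, w' (i a) = lin_of w a, Dw \in generated (map D s)
      & forall u, lin_of Dw (p u) = dE n (w' u)].
  move=> hw; apply/QP; move: w hw; apply: generated_sub => h hh; apply/QP.
  have [h' [eh eD]] := hD h (hs1 h hh); exists h', (D h); split=> //.
  by apply: mem_generated; apply: map_f.
move=> f cf; have [g hg] : null (comp_lin (lin_of f) p).
  by apply: ext_zero_rV => u; apply: cf.
have /hs2[w /QP[w' [Dw [hw1 hw2 hw3]]] hb] : cocycle (lin_of (hom_of (comp_lin g i))).
  move=> a; rewrite hom_ofK comp_linE -hg comp_linE.
  have -> : p (i a) = 0 by apply/kerp; exists a.
  by rewrite linear0.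
exists Dw => //; have [b' [cb' hb']] := null_extend hip ((null_subP _).1 hb).
have [|l hl] := factor_exact hip (f := sub_lin (sub_lin g w') b').
  by move=> a; rewrite /= hb' homD homN hw1 hom_ofK subrr.
apply/null_subP; exists l => v; have [u <-] := ps v.
by rewrite homD homN hw3 hl /= !linearB cb' subr0 -hg.
Qed.

(** As Ext^(n+1)(C, R) = 0, multiplication by [a] is surjective on Ext^n(N, R). Nakayama is applied
    to the span of finitely many representing cocycles. *)
Lemma ext_zero_nakayama n N C (a : R) (p : {linear N -> C}) :
  finite_module N -> a \in m -> short_exact (scale_lin a (id_lin N)) p ->
  ext_zero n.+1 C -> ext_zero n N.
Proof.
move=> hN ha hip hC f cf; have [s [hs1 hs2]] := ext_fg n hN.
have hnull : {subset generated s <= null_sub n N}.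
  apply: (nakayama_gen hnoeth hlocal) => h /hs1 ch.
  have [h' [ch' hh']] := ext_extend hip hC ch.
  have [w hw hb] := hs2 (hom_of h') ch'.
  exists (a *: w); first exact: mem_ideal_mul.
  have -> : h - a *: w = a *: (hom_of h' - w).
    apply: hom_ext => v; rewrite homD homN !homZ homD homN scalerBr -hh' hom_ofK.
    by congr (_ - _); rewrite /= linearZ.
  exact: submZ.
have [w /hnull hw hb] := hs2 (hom_of f) cf.
have : hom_of f \in null_sub n N by rewrite -(subrK w (hom_of f)); apply: submD.
by move=> /null_subP hf; apply: (null_ext hf).
Qed.

End Finite.

Lemma homology_zero (U V W : lmodType R) (f : {linear U -> V}) (g : {linear V -> W}) :
  (forall h : homology f g, h = 0) <-> forall v, g v = 0 -> exists u, f u = v.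
Proof.
split=> [h v gv|h q].
  have [z hz] : exists z, subval (mker g) z = v by apply/subval_exists/in_mker.
  have /quotpi_eq0 := h (quotpi _ z).
  by rewrite -hz => /in_mim.
have [z <-] := quotpi_surj q; apply/quotpi_eq0/in_mim/h/in_mker; exact: valP.
Qed.

(** * Comparison with Ext from a free resolution *)

Section FreeResolution.
Variables (M : lmodType R) (F : free_resolution M).
Let P k : lmodType R := 'rV[R]_(res_rank F k).

Let dual_exact k := forall f : {linear P k.+1 -> R^o},
  (forall v, f (res_diff F k.+1 v) = 0) ->
  exists g : {linear P k -> R^o}, forall u, f u = g (res_diff F k u).

(** [S] is the k-th syzygy. For n = 0, a functional killing the next differential is one on the
    kernel of [p], and Ext^1(S, R) decides whether it extends to the free module; larger n shift to
    the next syzygy. *)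
Lemma ext_zero_dual_exact n k (S : lmodType R) (p : {linear P k -> S}) :
  (forall v, exists u, p u = v) -> mim (res_diff F k) =i mker p ->
  ext_zero n.+1 S <-> dual_exact (k + n).
Proof.
elim: n k S p => [|n IH] k S p ps hp; have hip := short_exact_ker ps.
  have [q hq] : exists q : {linear P k.+1 -> submod (mker p)},
      forall u, subval (mker p) (q u) = res_diff F k u.
    apply: factor_inj => [|u]; first exact: subval_inj.
    by apply: subval_exists; rewrite -hp; apply/in_mim; exists u.
  have qs a : exists u, q u = a.
    have : subval _ a \in mim (res_diff F k) by rewrite hp; apply: subvalP.
    by move=> /in_mim[u hu]; exists u; apply: (@subval_inj _ _ (mker p)); rewrite hq.
  rewrite addn0; split=> [hS f hf|hd].
    have [|chi hchi] := factor_surj (f := f) qs.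
      move=> u qu0; have : u \in mker (res_diff F k) by apply/in_mker; rewrite -hq qu0 linear0.
      by rewrite -res_exactS => /in_mim[w <-]; apply: hf.
    have [psi hpsi] := ext_one_extend hip hS chi.
    by exists psi => u; rewrite -hq hpsi hchi.
  apply: (extend_ext_one hip); first exact: ext_zero_rV.
  move=> f; have [|psi hpsi] := hd (comp_lin f q).
    move=> v; rewrite comp_linE; have -> : q (res_diff F k.+1 v) = 0.
      apply: (@subval_inj _ _ (mker p)); rewrite hq linear0.
      by apply/in_mker; rewrite -res_exactS; apply/in_mim; exists v.
    exact: linear0.
  exists psi => a; have [u <-] := qs a.
  by rewrite hq -hpsi.
rewrite -(ext_zero_shift n hip) addnS -addSn.
have [q hq] : exists q : {linear P k.+1 -> submod (mker p)},
    forall u, subval (mker p) (q u) = res_diff F k u.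
  apply: factor_inj => [|u]; first exact: subval_inj.
  by apply: subval_exists; rewrite -hp; apply/in_mim; exists u.
apply: (IH k.+1 _ q).
  move=> a; have : subval _ a \in mim (res_diff F k) by rewrite hp; apply: subvalP.
  by move=> /in_mim[u hu]; exists u; apply: (@subval_inj _ _ (mker p)); rewrite hq.
move=> u; rewrite res_exactS; apply/idP/idP => /in_mker h; apply/in_mker.
  by apply: (@subval_inj _ _ (mker p)); rewrite hq linear0.
by rewrite -hq h linear0.
Qed.

Lemma ext_zeroP n : ext_zero n.+1 M <-> forall c : Ext F R^o n.+1, c = 0.
Proof.
rewrite (ext_zero_dual_exact n (@res_aug_surj _ _ F) (@res_exact0 _ _ F)) add0n.
rewrite (homology_zero (precomp (W := R^o) (res_diff F n)) (precomp (res_diff F n.+1))).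
split=> [h f hf|h f hf].
  have [v|g hg] := h (lin_of f); first by have := congr1 (fun c => lin_of c v) hf.
  by exists (hom_of g); apply: hom_ext => u; rewrite hg.
have [|g hg] := h (hom_of f); first by apply: hom_ext => v; rewrite hom0 -(hf v).
by exists (lin_of g) => u; have := congr1 (fun c => lin_of c u) hg.
Qed.
End FreeResolution.
End InjectiveResolution.

Section Resolutions.
Variable R : comNzRingType.
Hypothesis hnoeth : noetherian_ring R.

Lemma free_resolution_exists (M : lmodType R) : finite_module M -> exists F : free_resolution M, True.
Proof.
move=> /finite_cover[n0 [p0 ps0]].
(* The target module of the current cover is part of the state, so that the resolution becomes an
   iteration. *)
pose state := {n : nat & {W : lmodType R & {linear 'rV[R]_n -> W}}}.
pose rk (t : state) := projT1 t.
pose mp (t : state) : {linear 'rV[R]_(rk t) -> projT1 (projT2 t)} := projT2 (projT2 t).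
have next (t : state) : exists n (q : {linear 'rV[R]_n -> 'rV[R]_(rk t)}), mim q =i mker (mp t).
  have [|n [q qs]] := @finite_cover R (submod (mker (mp t))).
    by apply: finite_submod => //; apply: finite_rV.
  exists n, (comp_lin (subval _) q) => v; apply/idP/idP.
    by move=> /in_mim[u <-]; apply: subvalP.
  by move=> /subval_exists[a <-]; have [u <-] := qs a; apply/in_mim; exists u.
pose nq t := cid (next t); pose q t := cid (projT2 (nq t)).
pose step (t : state) : state := existT _ (projT1 (nq t)) (existT _ _ (projT1 (q t))).
pose t0 : state := existT _ n0 (existT _ M p0).
unshelve eexists (@FreeResolution R M (fun n => rk (iter n step t0))
  (fun n => projT1 (q (iter n step t0))) p0 ps0 _ _) => //.
  exact: (projT2 (q t0)).
move=> n; exact: (projT2 (q (iter n.+1 step t0))).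
Qed.
End Resolutions.

(** * Injective modules *)

Section Baer.
Variable R : comNzRingType.
Implicit Types (A B C M N E : lmodType R).

(** Zorn's lemma on sets [X] of pairs whose span with the graph [G0] of the given map stays
    single-valued. A maximal one is total: for a missing b, the ideal of all r with r b in the
    domain maps to [E], and the element [w0] representing this map lets (b, [w0]) be adjoined. *)
Lemma baer_criterion E :
  (forall (J : ideal R) (f : {linear submod J -> E}),
     exists w, forall r : submod J, f r = (val r : R) *: w) ->
  injective_module E.
Proof.
move=> hE A B i f ii.
pose T := (B * E)%type : lmodType R.
pose G0 : set T := fun z : T => exists a, z = (i a, f a).
pose S (X : set T) := mspan (X `|` G0)%classic.
pose P (X : set T) := forall w, ((0, w) : T) \in S X -> w = 0.
(* Finitely many elements of the union lie in one member of the chain; the empty set covers the case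
   where all of them come from [G0]. *)
have chain (F : set (set T)) n (g : 'I_n -> T) : total_on F subset ->
    (forall k, (\bigcup_(X in F) X `|` G0)%classic (g k)) ->
    exists X, (X = set0 \/ F X) /\ forall k, (X `|` G0)%classic (g k).
  move=> tF; elim: n g => [|n IH] g hg; first by exists set0; split; [left | case].
  have [|X [hX hXg]] := IH (fun k => g (lift ord0 k)); first by move=> k; apply: hg.
  case: (hg ord0) => [[Y FY Yg]|g0].
    case: hX => [X0|FX].
      exists Y; split=> [|k]; first by right.
      have [j ->|->] := unliftP ord0 k; last by left.
      by case: (hXg j) => [|h]; [rewrite X0 | right].
    have [XY|YX] := tF _ _ FX FY.
      exists Y; split=> [|k]; first by right.
      have [j ->|->] := unliftP ord0 k; last by left.
      by case: (hXg j) => h; [left; apply: XY | right].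
    exists X; split=> [|k]; first by right.
    by have [j ->|->] := unliftP ord0 k; [apply: hXg | left; apply: YX].
  exists X; split=> // k.
  by have [j ->|->] := unliftP ord0 k; [apply: hXg | right].
have [|A0 [PA Amax]] := @Zorn_bigcup T P.
  move=> F FP tF w /asboolP[n [a [g [Sg e]]]].
  have [X [hX hXg]] := chain F n g tF Sg.
  have PX : P X.
    case: hX => [->|/FP //] w' hw'.
    have G0P : forall z, z \in msub G0 <-> G0 z.
      apply: msubP; first by exists 0; rewrite !linear0.
      by move=> c _ _ [x ->] [y ->]; exists (c *: x + y); rewrite !linearP.
    have /G0P[y [ey ->]] : ((0, w') : T) \in msub G0.
      by move: (0, w') hw'; apply: mspan_sub => z [//|hz]; apply/G0P.
    by have -> : y = 0; [apply: ii; rewrite -ey linear0 | rewrite linear0].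
  by apply: PX; apply/asboolP; exists n, a, g.
have A0S z : A0 z -> z \in S A0 by move=> h; apply: mem_mspan; left.
have tot b : exists w, ((b, w) : T) \in S A0.
  apply: contrapT => hb.
  pose Jp (r : R^o) := exists w, ((r *: b, w) : T) \in S A0.
  have JP : forall r, r \in msub Jp <-> Jp r.
    apply: msubP; first by exists 0; rewrite scale0r; apply: subm0.
    move=> a x y [w hw] [z hz]; exists (a *: w + z).
    have -> : (((a *: x + y) *: b, a *: w + z) : T) = a *: (x *: b, w) + (y *: b, z).
      by rewrite pairZ pairD scalerDl scalerA.
    by apply: submD => //; apply: submZ.
  have [||a u w u' w' h h'|h hh] :=
      @linear_of_rel R (submod (msub Jp)) E (fun r w => (((val r : R) *: b, w) : T) \in S A0).
  - by move=> r; apply/JP; apply: valP.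
  - by move=> w; rewrite linear0 scale0r; apply: PA.
  - have -> : (((val (a *: u + u') : R) *: b, a *: w + w') : T) =
        a *: ((val u : R) *: b, w) + ((val u' : R) *: b, w').
      by rewrite pairZ pairD linearP /= scalerDl scalerA.
    by apply: submD => //; apply: submZ.
  have [w0 hw0] := hE _ h.
  apply: (Amax (A0 `|` (fun z : T => z = (b, w0)))%classic).
    split; first by move=> z; left.
    by move=> /(_ (b, w0)) hz; apply: hb; exists w0; apply/A0S/hz; right.
  move=> w.
  have QP : forall z, z \in msub (fun z : T => exists (c : R) y, y \in S A0 /\ z = c *: (b, w0) + y) <->
      exists (c : R) y, y \in S A0 /\ z = c *: (b, w0) + y.
    apply: msubP; first by exists 0, 0; rewrite subm0 scale0r addr0.
    move=> a _ _ [c [y [hy ->]]] [c' [y' [hy' ->]]]; exists (a * c + c'), (a *: y + y'); split.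
      by apply: submD => //; apply: submZ.
    by rewrite scalerDl scalerDr scalerA addrACA.
  move=> hw; have /QP[c [[y1 y2] [hy [e1 e2]]]] :
      ((0, w) : T) \in msub (fun z : T => exists (c : R) y, y \in S A0 /\ z = c *: (b, w0) + y).
    move: (0, w) hw; apply: mspan_sub => z hz; apply/QP; case: hz => [[hz|->]|hz].
    - by exists 0, z; rewrite scale0r add0r; split=> //; apply: A0S.
    - by exists 1, 0; rewrite subm0 scale1r addr0.
    by exists 0, z; rewrite scale0r add0r; split=> //; apply: mem_mspan; right.
  have ey1 : y1 = (- c) *: b by apply/eqP; rewrite scaleNr -addr_eq0 addrC -e1.
  have [r hr] : exists r : submod (msub Jp), subval _ r = - c.
    by apply/subval_exists/JP; exists y2; rewrite -ey1.
  have h1 := hh r; rewrite -[val r]/(subval _ r) hr in h1.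
  have : ((0, h r - y2) : T) \in S A0.
    by have := submB h1 hy; rewrite ey1 /= -[_ - _]/((_ - _, _ - _) : T) /= subrr.
  move=> /PA/eqP; rewrite subr_eq0 => /eqP eh.
  by rewrite e2 -eh hw0 -[val r]/(subval _ r) hr scaleNr subrr.
have [|w|a v w v' w' h h'|g hg] := @linear_of_rel R B E (fun b w => ((b, w) : T) \in S A0).
- exact: tot.
- exact: PA.
- exact: (submD (submZ a h) h').
exists g => a; apply/eqP; rewrite -subr_eq0; apply/eqP/PA.
have h2 : ((i a, f a) : T) \in S A0 by apply: mem_mspan; right; exists a.
by have := submB (hg (i a)) h2; rewrite -[_ - _]/((_ - _, _ - _) : T) /= subrr.
Qed.

End Baer.

(** * Divisible groups and coinduced modules *)

Section IntegerModules.

Lemma additive_int_linear (A D : lmodType int) (f : A -> D) :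
  {morph f : x y / x + y} -> linear f.
Proof.
move=> fD n x y; rewrite fD; congr (_ + _).
have f0 : f 0 = 0 by apply: (addrI (f 0)); rewrite -fD !addr0.
have fN z : f (- z) = - f z by apply: (addrI (f z)); rewrite -fD !subrr.
have fnat k z : f (z *+ k) = f z *+ k.
  by elim: k => [|k IH]; rewrite ?mulr0n // !mulrS fD IH.
rewrite -[n]intz !scaler_int; case: n => n; first exact: fnat.
by rewrite !NegzE !mulrNz fN -!pmulrn fnat.
Qed.

(** By Baer's criterion: a nonzero ideal of the integers is generated by an element [k1] of least
    absolute value, and dividing the image of [k1] by [k1] gives the required element. *)
Lemma divisible_injective (D : lmodType int) :
  (forall (k : int) (d : D), k != 0 -> exists d', k *: d' = d) -> injective_module D.
Proof.
move=> hD; apply: baer_criterion => J f.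
have [[k [kJ k0]]|hno] := pselect (exists k : int, k \in J /\ k != 0); last first.
  exists 0 => r; rewrite scaler0; have -> : r = 0; last exact: linear0.
  apply: (@subval_inj _ _ J); rewrite linear0; apply/eqP; apply: contrapT => h.
  by apply: hno; exists (subval J r); split; [apply: subvalP | apply/negP].
have hex : exists n, `[< exists k : int, [/\ k \in J, k != 0 & `|k|%N = n] >].
  by exists `|k|%N; apply/asboolP; exists k.
case: (ex_minnP hex) => n /asboolP[k1 [k1J k10 ek1]] nmin.
have dvd (r : int) : r \in J -> r = (r %/ k1)%Z * k1.
  move=> rJ; rewrite {1}(divz_eq r k1); set q := (r %/ k1)%Z; set s := (r %% k1)%Z.
  have sJ : s \in J.
    have -> : s = r - q * k1 by rewrite /s /q {2}(divz_eq r k1) addrC addKr.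
    by apply: submB => //; apply: mem_idealMl.
  have [->|s0] := eqVneq s 0; first by rewrite addr0.
  have : (n <= `|s|)%N by apply: nmin; apply/asboolP; exists s.
  rewrite -ek1 leqNgt => /negP[].
  have := ltz_mod r k10; have := modz_ge0 r k10; rewrite -/s.
  by case: (s) => // t _; rewrite -abszE ltz_nat.
have [u hu] := subval_exists k1J.
have [w hw] := hD k1 (f u) k10; exists w => r.
have rJ : (val r : int) \in J by apply: valP.
have er : r = ((val r : int) %/ k1)%Z *: u.
  apply: (@subval_inj _ _ J); rewrite linearZ hu; exact: dvd.
rewrite {1}er linearZ /= -hw scalerA; congr (_ *: _).
by rewrite -dvd.
Qed.

End IntegerModules.

Section Coinduction.
Variables (R : comNzRingType) (D : lmodType int).

(** Hom_Z(R, D), right adjoint to restriction of scalars, with R acting through the argument. *)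
Definition coind : Type := Hom (zmodule R : lmodType int) D.
HB.instance Definition _ := GRing.Zmodule.copy coind (Hom (zmodule R : lmodType int) D).

Lemma mul_int_linear (a : R) : linear (fun r : zmodule R => (r : R) * a : zmodule R).
Proof. by apply: additive_int_linear => x y; apply: mulrDl. Qed.

Definition coind_scale (a : R) (f : coind) : coind :=
  hom_of (comp_lin (lin_of (f : Hom (zmodule R) D)) (mklin (mul_int_linear a))).

Lemma coind_scaleE a (f : coind) r : val (coind_scale a f) r = val f (r * a).
Proof. by []. Qed.

Lemma coind_scaleA a b (f : coind) : coind_scale a (coind_scale b f) = coind_scale (a * b) f.
Proof. by apply: hom_ext => r /=; rewrite mulrA. Qed.
Lemma coind_scale1 : left_id 1 coind_scale.
Proof. by move=> f; apply: hom_ext => r /=; rewrite mulr1. Qed.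
Lemma coind_scaleDr : right_distributive coind_scale +%R.
Proof. by move=> a f g; apply: hom_ext. Qed.
Lemma coind_scaleDl (f : coind) : {morph coind_scale^~ f : a b / a + b}.
Proof.
move=> a b; apply: hom_ext => r /=; rewrite mulrDr.
exact: (linearD (lin_of (f : Hom (zmodule R) D))).
Qed.
HB.instance Definition _ := GRing.Zmodule_isLmodule.Build R coind
  coind_scaleA coind_scale1 coind_scaleDr coind_scaleDl.

(** By adjunction, evaluation at 1 identifies R-linear maps A -> Hom_Z(R, D) with additive maps A ->
    D, which extend. *)
Lemma coind_injective : injective_module D -> injective_module (coind : lmodType R).
Proof.
move=> hD A B i f ii.
have li : linear (i : zmodule A -> zmodule B).
  by apply: additive_int_linear => x y; apply: (linearD i).
have lf : linear (fun a : zmodule A => val (f a) (1 : zmodule R)).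
  by apply: additive_int_linear => x y; rewrite (linearD f).
have [g hg] := hD (zmodule A) (zmodule B) (mklin li) (mklin lf) ii.
have lm (b : B) : linear (fun r : zmodule R => (r : R) *: b : zmodule B).
  by apply: additive_int_linear => x y; exact: (scalerDl b (x : R) (y : R)).
have lh : linear (fun b : B => hom_of (comp_lin g (mklin (lm b))) : coind).
  move=> a x y; apply: hom_ext => r /=.
  rewrite scalerDr scalerA; exact: (linearD g).
exists (mklin lh) => a; apply: hom_ext => r /=.
have -> : r *: i a = i ((r : R) *: a) by rewrite linearZ.
transitivity (val (f ((r : R) *: a)) (1 : R)); first exact: hg.
have -> : f ((r : R) *: a) = coind_scale (r : R) (f a) by rewrite linearZ.
by rewrite coind_scaleE mul1r.
Qed.
End Coinduction.

(** * Embeddings into injectives and an injective resolution of R *)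

Section Hull.
Variable R : comNzRingType.
Implicit Types M : lmodType R.

Section DivisibleHull.
Variable M : lmodType R.
Let V : lmodType int := (M -> zmodule rat).
Implicit Types s t : seq (int * M).

Let formal s : V := fun x => \sum_(p <- s) (x == p.2)%:Q *~ p.1.

Let formal_cons p s x : formal (p :: s) x = (x == p.2)%:Q *~ p.1 + formal s x.
Proof. by rewrite /formal big_cons. Qed.
Let formal_nil x : formal [::] x = 0.
Proof. by rewrite /formal big_nil. Qed.

(** Both sums are regrouped over a common list of elements of [M], where the integer coefficients
    are determined by their images in [rat]. So evaluation in [M] is well defined on coefficient
    functions. *)
Let formal_eq s t : formal s = formal t ->
  \sum_(p <- s) p.2 *~ p.1 = \sum_(p <- t) p.2 *~ p.1.
Proof.
have expand s' (r : seq M) : uniq r -> {subset [seq p.2 | p <- s'] <= r} ->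
    \sum_(p <- s') p.2 *~ p.1 = \sum_(x <- r) x *~ (\sum_(p <- s') (x == p.2)%:Z * p.1).
  move=> ur hr; transitivity (\sum_(x <- r) \sum_(p <- s') x *~ ((x == p.2)%:Z * p.1)).
    rewrite exchange_big [LHS]big_seq [RHS]big_seq; apply: eq_bigr => p hp.
    rewrite (bigD1_seq p.2) //=; last by apply: hr; apply: map_f.
    rewrite eqxx mul1r big1 ?addr0 // => x /negbTE ->.
    by rewrite mul0r mulr0z.
  by apply: eq_bigr => x _; rewrite -mulrz_sumr.
have cast s' (x : M) : formal s' x = (\sum_(p <- s') (x == p.2)%:Z * p.1)%:~R.
  rewrite /formal (raddf_sum (intmul (1 : rat))); apply: eq_bigr => p _.
  exact: (esym (mulrzA (1 : rat) _ _)).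
move=> est; pose r := undup ([seq p.2 | p <- s] ++ [seq p.2 | p <- t]).
rewrite (expand s r) ?(expand t r) ?undup_uniq //.
- apply: eq_bigr => x _; congr (_ *~ _); apply: (@intr_inj rat).
  by rewrite -!cast est.
- by move=> x hx; rewrite mem_undup mem_cat hx orbT.
by move=> x hx; rewrite mem_undup mem_cat hx.
Qed.

Let rel (f : V) := exists s, f = formal s /\ \sum_(p <- s) p.2 *~ p.1 = 0.

Let relP f : f \in msub rel <-> rel f.
Proof.
apply: msubP.
  by exists [::]; rewrite big_nil; split=> //; apply/funext => x; rewrite /formal big_nil.
move=> n _ _ [s [-> hs]] [t [-> ht]].
exists ([seq (n * p.1, p.2) | p <- s] ++ t); split.
  apply/funext => x; rewrite /formal big_cat big_map /=; congr (_ + _).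
  transitivity ((\sum_(p <- s) (x == p.2)%:Q *~ p.1) *~ n); first by [].
  by rewrite mulrz_suml; apply: eq_bigr => p _ /=; rewrite mulrC mulrzA.
rewrite big_cat big_map /= ht addr0.
transitivity ((\sum_(p <- s) p.2 *~ p.1) *~ n); last by rewrite hs mul0rz.
rewrite mulrz_suml; by apply: eq_bigr => p _; rewrite mulrC mulrzA.
Qed.

(* [M] is the quotient of the formal integral combinations of its elements by
   the relations [rel], so it embeds in the divisible group [Q^M / rel]. *)
Lemma divisible_hull : exists (D : lmodType int) (f : M -> D),
  [/\ injective_module D, {morph f : x y / x + y} & injective f].
Proof.
exists (quotmod (msub rel)), (fun v => quotpi _ (formal [:: (1, v)])).
have fD : {morph (fun v => quotpi (msub rel) (formal [:: (1, v)])) : x y / x + y}.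
  move=> x y; apply/eqP; rewrite -subr_eq0 -linearD -linearB; apply/eqP/quotpi_eq0/relP.
  exists [:: (1, x + y); (-1, x); (-1, y)]; split.
    apply/funext => z; rewrite -[LHS]/(formal [:: (1, x + y)] z -
      (formal [:: (1, x)] z + formal [:: (1, y)] z)).
    by rewrite !formal_cons !formal_nil /= !addr0 !mulrN1z opprD.
  by rewrite !big_cons big_nil /= addr0 !mulrN1z mulr1z -opprD subrr.
split=> // [|x y exy].
  apply: divisible_injective => k q k0; have [f <-] := quotpi_surj q.
  exists (quotpi _ ((fun x => (f x : rat) / k%:~R) : V)); rewrite -linearZ; congr (quotpi _ _).
  apply/funext => x; transitivity (((f x : rat) / k%:~R) *~ k); first by [].
  by rewrite -mulrzr divfK // intr_eq0.
have /quotpi_eq0/relP[s [es hs]] : quotpi (msub rel)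
    (formal [:: (1, x)] - formal [:: (1, y)]) = 0 by rewrite linearB exy subrr.
have : formal ([:: (1, x); (-1, y)]) = formal s.
  rewrite -es; apply/funext => z.
  rewrite -[RHS]/(formal [:: (1, x)] z - formal [:: (1, y)] z).
  by rewrite !formal_cons !formal_nil /= !addr0 mulrN1z.
move=> /formal_eq; rewrite hs !big_cons big_nil /= addr0 mulr1z mulrN1z.
by move=> /eqP; rewrite subr_eq0 => /eqP.
Qed.
End DivisibleHull.

(* The last clause makes the resolution below stop at an injective cosyzygy. *)
Lemma hull_exists M : exists (E : lmodType R) (i : {linear M -> E}),
  [/\ injective_module E, injective i
    & injective_module M -> forall e, exists v, i v = e].
Proof.
have [hM|hM] := pselect (injective_module M).
  by exists M, (id_lin M); split=> // _ e; exists e.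
have [D [f [hD fD fi]]] := divisible_hull M.
have lf (v : M) : linear (fun r : zmodule R => f ((r : R) *: v)).
  by apply: additive_int_linear => x y; rewrite -fD -scalerDl.
have lg : linear (fun v : M => hom_of (mklin (lf v)) : coind R D).
  move=> a x y; apply: hom_ext => r /=.
  by rewrite scalerDr scalerA fD.
exists (coind R D : lmodType R), (mklin lg); split=> //; first exact: coind_injective.
move=> x y /(congr1 (fun h : coind R D => val h 1)) /=.
by rewrite !scale1r => /fi.
Qed.

Definition hull M : lmodType R := projT1 (cid (hull_exists M)).
Definition hull_in M : {linear M -> hull M} := projT1 (cid (projT2 (cid (hull_exists M)))).
Lemma hullP M : [/\ injective_module (hull M), injective (@hull_in M)
    & injective_module M -> forall e, exists v, hull_in M v = e].
Proof. exact: (projT2 (cid (projT2 (cid (hull_exists M))))). Qed.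

Fixpoint cosyzygy n : lmodType R :=
  if n is n'.+1 then quotmod (mim (hull_in (cosyzygy n'))) else R^o.
Definition inj_res n : lmodType R := hull (cosyzygy n).
Definition inj_aug : {linear R^o -> inj_res 0} := hull_in (cosyzygy 0).
Definition inj_diff n : {linear inj_res n -> inj_res n.+1} :=
  comp_lin (hull_in (cosyzygy n.+1)) (quotpi (mim (hull_in (cosyzygy n)))).

Lemma inj_diff_ker n v : inj_diff n v = 0 <-> exists w, hull_in (cosyzygy n) w = v.
Proof.
have [_ hi _] := hullP (cosyzygy n.+1); rewrite -in_mim -quotpi_eq0.
split=> [h|h]; first by apply: hi; rewrite linear0.
by rewrite /inj_diff comp_linE h linear0.
Qed.

Lemma inj_res_injective n : injective_module (inj_res n).
Proof. by case: (hullP (cosyzygy n)). Qed.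
Lemma inj_aug_inj : injective inj_aug.
Proof. by case: (hullP (cosyzygy 0)). Qed.
Lemma inj_res_exact0 : mim inj_aug =i mker (inj_diff 0).
Proof.
move=> v; apply/idP/idP => [/in_mim h|/in_mker/inj_diff_ker h].
  exact/in_mker/inj_diff_ker.
exact/in_mim.
Qed.
Lemma inj_res_exactS n : mim (inj_diff n) =i mker (inj_diff n.+1).
Proof.
move=> v; apply/idP/idP => [/in_mim[w <-]|/in_mker/inj_diff_ker[q <-]].
  by apply/in_mker/inj_diff_ker; exists (quotpi _ w).
by have [w <-] := quotpi_surj q; apply/in_mim; exists w.
Qed.

(** Ext^(d+1)(R/J, R) = 0 extends every map from J to the d-th cosyzygy over R, so Baer's criterion
    applies to that cosyzygy. Since [hull_in] is onto for injective modules, all later cosyzygies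
    vanish. *)
Lemma gorenstein_of_ext_zero d :
  (forall J : ideal R, ext_zero inj_diff d.+1 (quotmod J)) -> Gorenstein R.
Proof.
move=> hext; exists inj_res, inj_aug, inj_diff; split.
- exact: inj_res_injective.
- exact: inj_aug_inj.
- exact: inj_res_exact0.
- exact: inj_res_exactS.
have hd : injective_module (cosyzygy d).
  apply: baer_criterion => J f; have [_ hi _] := hullP (cosyzygy d).
  have [|h [ch hh]] := ext_extend inj_res_injective inj_res_exactS (short_exact_quot J)
    (f := comp_lin (hull_in _) f) (hext J).
    by move=> a; apply/inj_diff_ker; exists (f a).
  have /inj_diff_ker[w hw] := ch 1; exists w => r.
  apply: hi; rewrite linearZ /= hw -linearZ /= -[LHS](hh r); congr (h _).
  by rewrite [RHS]mulr1.
have zinj (M : lmodType R) : (forall v : M, v = 0) -> injective_module M.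
  move=> h0 A B i f _; exists (lin_of (0 : Hom B M)) => a; by rewrite [RHS](h0 (f a)) hom0.
have hz k : forall v : cosyzygy (d + k).+1, v = 0.
  elim: k => [|k IH]; first rewrite addn0.
    move=> q; have [v <-] := quotpi_surj q; apply/quotpi_eq0/in_mim.
    by case: (hullP (cosyzygy d)) => _ _; apply.
  rewrite addnS => q; have [v <-] := quotpi_surj q; apply/quotpi_eq0/in_mim.
  by case: (hullP (cosyzygy (d + k).+1)) => _ _; apply; apply: zinj.
exists d => k /subnKC <- v.
have hk : forall w : cosyzygy (d.+1 + (k - d.+1)), w = 0 by rewrite addSn; apply: hz.
case: (hullP (cosyzygy (d.+1 + (k - d.+1)))) => _ _ /(_ (zinj _ hk) v)[w <-].
by rewrite (hk w) linear0.
Qed.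

End Hull.

(** * Horizontal linkage *)

Section Dot.
Variable R : comNzRingType.
Implicit Types (M : lmodType R).

Definition dot n (u z : 'rV[R]_n) : R := \sum_i u 0 i * z 0 i.

Lemma dotC n (u z : 'rV[R]_n) : dot u z = dot z u.
Proof. by apply: eq_bigr => i _; rewrite mulrC. Qed.

Lemma dot_linear n (u : 'rV[R]_n) : linear (dot u : 'rV[R]_n -> R^o).
Proof.
move=> a x y; rewrite /dot scaler_sumr -big_split; apply: eq_bigr => i _ /=.
by rewrite !mxE mulrDr mulrCA.
Qed.
Definition dot_lin n (u : 'rV[R]_n) : {linear 'rV[R]_n -> R^o} := mklin (dot_linear u).

Lemma dotDl n a (u v z : 'rV[R]_n) : dot (a *: u + v) z = a * dot u z + dot v z.
Proof. by rewrite dotC (dot_linear z a u v) !(dotC z). Qed.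

Lemma dotDr n (u v z : 'rV[R]_n) : dot u (v + z) = dot u v + dot u z.
Proof. exact: (linearD (dot_lin u)). Qed.
Lemma dotBr n (u v z : 'rV[R]_n) : dot u (v - z) = dot u v - dot u z.
Proof. exact: (linearB (dot_lin u)). Qed.
Lemma dotZr n a (u v : 'rV[R]_n) : dot u (a *: v) = a * dot u v.
Proof. by have := dot_linear u a v 0; rewrite addr0 => ->; rewrite [dot u 0](linear0 (dot_lin u)) addr0. Qed.
Lemma dot_sumr n k (u : 'rV[R]_n) (F : 'I_k -> 'rV[R]_n) :
  dot u (\sum_i F i) = \sum_i dot u (F i).
Proof. exact: (linear_sum (dot_lin u)). Qed.

Lemma dot0l n (z : 'rV[R]_n) : dot 0 z = 0.
Proof. by rewrite dotC; apply: (linear0 (dot_lin z)). Qed.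

Lemma dot_delta n (u : 'rV[R]_n) i : dot u (delta_mx 0 i) = u 0 i.
Proof.
rewrite /dot (bigD1 i) //= mxE !eqxx mulr1 big1 ?addr0 // => j ne.
by rewrite mxE eqxx (negbTE ne) mulr0.
Qed.

Lemma functional_dot n (f : {linear 'rV[R]_n -> R^o}) : exists w, forall u, f u = dot w u.
Proof.
exists (\row_i f (delta_mx 0 i)) => u; rewrite (lin_comb_basis f); apply: eq_bigr => i _.
by rewrite mxE mulrC.
Qed.

Lemma transpose_subproof n k (f : {linear 'rV[R]_n -> 'rV[R]_k}) :
  linear (fun w => \row_j dot w (f (delta_mx 0 j))).
Proof. by move=> a x y; apply/rowP => j; rewrite !mxE dotDl. Qed.
Definition transpose n k (f : {linear 'rV[R]_n -> 'rV[R]_k}) : {linear 'rV[R]_k -> 'rV[R]_n} :=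
  mklin (transpose_subproof f).

Lemma transposeE n k (f : {linear 'rV[R]_n -> 'rV[R]_k}) w v :
  dot (transpose f w) v = dot w (f v).
Proof.
transitivity (comp_lin (dot_lin w) f v); last by [].
by rewrite [RHS]lin_comb_basis /dot; apply: eq_bigr => j _; rewrite mxE mulrC.
Qed.

Lemma dot_ext n (u v : 'rV[R]_n) : (forall z, dot u z = dot v z) -> u = v.
Proof. by move=> h; apply/rowP => i; rewrite -!dot_delta. Qed.

Lemma dot_mulM (J : ideal R) n (u z : 'rV[R]_n) : z \in J ** 'rV[R]_n -> dot u z \in J.
Proof.
move=> /mulM_rV h; apply: (subm_sum (U := J)) => i _; exact: mem_idealMl.
Qed.

(** When [p] is onto, these are the functionals factoring through [M]: the dual of [M] inside the
    dual of its cover. *)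
Definition annihilated n M (p : {linear 'rV[R]_n -> M}) (u : 'rV[R]_n) :=
  forall z, p z = 0 -> dot u z = 0.
End Dot.

Section Linkage.
Variables (R : comNzRingType) (m : ideal R).
Hypothesis hnoeth : noetherian_ring R.
Hypothesis hlocal : local_ring m.
Implicit Types (M : lmodType R).

Lemma minimal_presentation_exists M : finite_module M -> exists D, minimal_presentation m M D.
Proof.
move=> /(mincover_exists hnoeth hlocal)[t [p [ps pm]]].
have [|s [q [qs qm]]] := @mincover_exists R m hnoeth hlocal (submod (mker p)).
  by apply: finite_submod => //; apply: finite_rV.
exists (FreeMap (comp_lin (subval (mker p)) q)), p; split=> //= v.
- apply/idP/idP; first by move=> /in_mim[u <-]; apply: subvalP.
  by move=> /subval_exists[a <-]; have [u <-] := qs a; apply/in_mim; exists u.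
- by move=> /in_mker/pm.
by move=> /in_mker h; apply: qm; apply: (@subval_inj _ _ (mker p)); rewrite linear0.
Qed.

Lemma minpresP M : finite_module M -> minimal_presentation m M (minpres m M).
Proof.
move=> /minimal_presentation_exists h; rewrite /minpres; case: pselect => // ex.
exact: (projT2 (cid ex)).
Qed.

(* [lambda M] is the module of functionals on a minimal cover of [M], modulo
   those vanishing on the relations. *)
Lemma lambda_cover M t (p : {linear 'rV[R]_t -> M}) : mincover m p ->
  exists theta : {linear 'rV[R]_t -> lambda m M},
    (forall v, exists u, theta u = v) /\ forall u, theta u = 0 <-> annihilated p u.
Proof.
move=> hp; have [ps pm] := hp.
have hM : finite_module M by apply: finite_surj ps (finite_rV R t).
have [eps [es eD em _]] := minpresP hM.
rewrite /lambda /syzygy /transpose_module.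
move: (minpres m M) eps es eD em => D eps es eD em.
have [g [g' [gK g'K gP]]] := mincover_unique hnoeth hlocal hp (conj es (fun u h => em u ((in_mker _ _).2 h))).
pose DT := transpose D.
set T := quotmod _.
have leps : linear (fun w => quotpi (mim (precomp (W := R^o) D)) (hom_of (dot_lin w))).
  move=> a x y; rewrite -linearP; congr (quotpi _ _); apply: hom_ext => v.
  by rewrite homD homZ !hom_ofK /= dotDl.
pose eps2 : {linear 'rV[R]_(src_rank D) -> T} := mklin leps.
have e2s q : exists w, eps2 w = q.
  have [h <-] := quotpi_surj q; have [w hw] := functional_dot (lin_of h).
  by exists w; rewrite /=; congr (\pi _); apply: hom_ext => v; rewrite hw.
have e2k w : eps2 w = 0 <-> exists w', DT w' = w.
  rewrite [eps2 w]/(quotpi _ _) quotpi_eq0 in_mim; split=> [[h eh]|[w' <-]].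
    have [w' hw'] := functional_dot (lin_of h); exists w'; apply: dot_ext => z.
    by rewrite transposeE -hw'; have := congr1 (fun h => lin_of h z) eh.
  by exists (hom_of (dot_lin w')); apply: hom_ext => v; rewrite hom_ofK /= transposeE.
have kerD v : eps v = 0 <-> exists u, D u = v by rewrite -in_mker -eD in_mim.
(* The transposed matrix has the entries of [D], which lie in [m] because the image of [D] is the
   kernel of a minimal cover. *)
have e2m : mincover m eps2.
  split=> // _ /e2k[w <-]; apply/mulM_rV => j; rewrite mxE; apply: dot_mulM.
  by apply/em/in_mker/kerD; exists (delta_mx 0 j).
have hT : finite_module T by apply: finite_surj e2s (finite_rV R _).
have [eps3 [es3 eD3 em3 _]] := minpresP hT.
move: (minpres m T) eps3 es3 eD3 em3 => D3 eps3 es3 eD3 em3.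
have [h [h' [hK h'K hP]]] := mincover_unique hnoeth hlocal e2m (conj es3 (fun u h => em3 u ((in_mker _ _).2 h))).
(* The presentations of [M] and of its transpose inside [lambda] are arbitrary choices: [G] carries
   functionals on the given cover to the chosen one, and [h] carries the syzygy of the transpose to
   the chosen one. *)
pose G := transpose g'; pose G' := transpose g.
have GG' w : G (G' w) = w by apply: dot_ext => z; rewrite !transposeE g'K.
have [|theta ht] := factor_inj (f := comp_lin h (comp_lin DT G)) (@subval_inj _ _ (mim D3)).
  move=> u; apply: subval_exists; rewrite eD3; apply/in_mker.
  by rewrite comp_linE hP; apply/e2k; exists (G u).
exists theta; split=> [a|u].
  have : eps2 (h' (subval _ a)) = 0 by rewrite -hP h'K; apply/in_mker; rewrite -eD3; apply: subvalP.
  move=> /e2k[w hw]; exists (G' w); apply: (@subval_inj _ _ (mim D3)).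
  by rewrite ht !comp_linE GG' hw h'K.
have -> : theta u = 0 <-> DT (G u) = 0.
  split=> [e|e]; last by apply: (@subval_inj _ _ (mim D3)); rewrite ht !comp_linE e !linear0.
  by rewrite -[LHS]hK; have := ht u; rewrite !comp_linE => <-; rewrite e !linear0.
split=> [e z pz|hu].
  have /kerD[v hv] : eps (g z) = 0 by rewrite gP.
  by rewrite -(gK z) -transposeE -hv -transposeE -/DT e dot0l.
apply: dot_ext => z; rewrite !transposeE dot0l.
apply: hu; rewrite -gP g'K; apply/kerD; by exists z.
Qed.

(** If no functional on [M] hits a unit on the basis of the cover, the cover of [lambda M] by
    functionals is again minimal. Then [lambda (lambda M)] is the same free module modulo the double
    annihilator of the relations, and an embedding in a free module shows that this adds nothing to
    them. *)
Lemma torsionless_linked M t k (p : {linear 'rV[R]_t -> M}) (j : {linear M -> 'rV[R]_k}) :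
  mincover m p -> (forall u, annihilated p u -> u \in m ** 'rV[R]_t) -> injective j ->
  horizontally_linked m M.
Proof.
move=> hp hann ji; split; first by apply: finite_surj hp.1 (finite_rV R t).
have [theta [ts tk]] := lambda_cover hp.
have ht : mincover m theta by split=> // u /tk/hann.
have [theta' [ts' tk']] := lambda_cover ht.
apply: (iso_of_kernels hp.1 ts') => u; rewrite tk'; split=> [pu z /tk hz|hu].
  by rewrite dotC; apply: hz.
apply: ji; rewrite linear0; apply/rowP => l; rewrite mxE.
have lf : linear (fun v => (j (p v)) 0 l : R^o) by move=> a x y; rewrite !linearP !mxE.
have [w hw] := functional_dot (mklin lf).
rewrite -[LHS]/(mklin lf u) hw dotC; apply: hu; apply/tk => z pz.
by rewrite -hw /= pz linear0 mxE.
Qed.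

End Linkage.

(** * Ulrich ideals and modules *)

Section QuotBasis.
Variable R : comNzRingType.
Implicit Types (M N V : lmodType R) (I J : ideal R).

Definition quot_basis I N k (q : {linear 'rV[R]_k -> N}) :=
  (forall v, exists u, q u = v) /\ forall u, q u = 0 <-> u \in I ** 'rV[R]_k.

Lemma ffun_cover_subproof I k :
  linear (fun u : 'rV[R]_k => [ffun i => quotpi I (u 0 i)] : {ffun 'I_k -> quotmod I}).
Proof.
move=> a x y; apply/ffunP => i; rewrite !ffunE !mxE.
exact: (linearP (quotpi I)).
Qed.
Definition ffun_cover I k := mklin (@ffun_cover_subproof I k).

Lemma ffun_coverP I k : quot_basis I (ffun_cover I k).
Proof.
split=> [f|u].
  have /choice[r hr] i : exists r, quotpi I r = f i by apply: quotpi_surj.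
  by exists (\row_i r i); apply/ffunP => i; rewrite ffunE mxE hr.
rewrite mulM_rV; split=> [e i|h].
  by apply/(quotpi_eq0 I); have /ffunP/(_ i) := e; rewrite !ffunE.
by apply/ffunP => i; rewrite !ffunE; apply/(quotpi_eq0 I).
Qed.

Lemma free_over_quotP I N : free_over_quot I N <->
  exists k (q : {linear 'rV[R]_k -> N}), quot_basis I q.
Proof.
split=> [[k /isomorphic_sym/isomorphicP[g [gi gs]]]|[k [q [qs qk]]]]; exists k.
  exists (comp_lin g (ffun_cover I k)); have [fs fk] := ffun_coverP I k; split=> [v|u].
    by have [w <-] := gs v; have [u <-] := fs w; exists u.
  rewrite -fk; split=> [e|e]; last by rewrite comp_linE e linear0.
  by apply: gi; rewrite linear0.
have [fs fk] := ffun_coverP I k.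
by apply: (iso_of_kernels qs fs) => u; rewrite qk fk.
Qed.

Lemma regular_rV n s : regular_on (R^o : lmodType R) s -> regular_on 'rV[R]_n s.
Proof.
move=> hs i hi v /mulM_rV hv; apply/mulM_rV => j; apply/mulM_ring/(hs i hi)/mulM_ring.
by have := hv j; rewrite mxE.
Qed.

(** Induction from the end: regularity puts the last coefficient in the ideal of the earlier
    elements, and substituting sum s_k z_k for it leaves a relation among these with coefficients
    c_k + a z_k. *)
Lemma regular_relation s (c : nat -> R) : regular_on (R^o : lmodType R) s ->
  \sum_(k < size s) s`_k * c k = 0 -> forall k, (k < size s)%N -> c k \in ideal_gen s.
Proof.
elim/last_ind: s c => [|s a IH] c // hs.
rewrite size_rcons big_ord_recr /= nth_rcons ltnn eqxx => e.
have hs' : regular_on (R^o : lmodType R) s.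
  move=> i hi v; have := hs i; rewrite size_rcons (ltnW _) // => /(_ isT v).
  by rewrite nth_rcons hi -cats1 takel_cat // ltnW.
have e' : \sum_(k < size s) s`_k * c k + a * c (size s) = 0.
  rewrite -[RHS]e; congr (_ + _); apply: eq_bigr => k _.
  by rewrite nth_rcons ltn_ord.
have hc : c (size s) \in ideal_gen s.
  apply/mulM_ring; have := hs (size s); rewrite size_rcons ltnSn => /(_ isT (c (size s))).
  rewrite nth_rcons ltnn eqxx -cats1 take_size_cat //; apply; apply/mulM_ring.
  have -> : a *: (c (size s) : R^o) = - \sum_(k < size s) s`_k * c k.
    by apply/eqP; rewrite -addr_eq0 addrC; apply/eqP.
  apply: (submN (U := ideal_gen s)); apply: (subm_sum (U := ideal_gen s)) => k _.
  by apply: mem_idealMr; apply: mem_generated; apply: mem_nth.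
have /mulM_ring/gmulP[z hz] := hc.
pose z' k := if insub k is Some j then z j else 0.
have z'E (j : 'I_(size s)) : z' j = z j by rewrite /z' valK.
have hz' : c (size s) = \sum_(k < size s) s`_k * z' k.
  by rewrite hz; apply: eq_bigr => k _; rewrite z'E.
have ss : {subset ideal_gen s <= ideal_gen (rcons s a)}.
  by apply: (@generatedS _ R^o) => b hb; rewrite mem_rcons in_cons hb orbT.
have h k : (k < size s)%N -> c k + a * z' k \in ideal_gen s.
  move: k; apply: (IH (fun k => c k + a * z' k) hs').
  rewrite -[RHS]e' hz' mulr_sumr -big_split; apply: eq_bigr => k _ /=.
  by rewrite mulrDr mulrCA.
move=> k; rewrite ltnS leq_eqVlt => /orP[/eqP->|hk]; first exact: ss.
rewrite -(addrK (a * z' k) (c k)); apply: (submB (U := ideal_gen (rcons s a))).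
  exact/ss/h.
by apply: mem_idealMr; apply: mem_generated; rewrite mem_rcons mem_head.
Qed.

End QuotBasis.

(** * Generators of I modulo Q *)

Section UlrichIdeal.
Variables (R : comNzRingType) (m I : ideal R) (x : seq R).
Hypothesis hnoeth : noetherian_ring R.
Hypothesis hlocal : local_ring m.
Hypothesis hI : primary_to m I.
Hypothesis hx : primary_to m (ideal_gen x).
Hypothesis hreg : regular_on (R^o : lmodType R) x.
Hypothesis hQI : {subset ideal_gen x <= I}.
Hypothesis hI2 : ideal_mul I I =i ideal_mul (ideal_gen x) I.
Hypothesis hfree : free_over_quot I (quotmod (mtrace I (ideal_mul I I))).
Hypothesis hne : exists2 a : R, a \in I & a \notin ideal_gen x.
Let Q := ideal_gen x.
Implicit Types (M N V : lmodType R).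

Lemma ideal_sub_max : {subset I <= m}.
Proof. by have [_ _ h] := hI; move=> a ha; apply/h; exists 1%N; rewrite expr1. Qed.

Lemma ideal_not1 : (1 : R) \notin I. Proof. by case: hI. Qed.

Lemma ideal_square_sub (a b : R) : a \in I -> b \in I -> a * b \in Q.
Proof.
move=> ha hb; apply/mulM_ring.
have : a * b \in ideal_mul I I by apply: (mem_ideal_mul ha hb).
by rewrite hI2; apply: ideal_mulS => // c _; apply: mem_fullmod.
Qed.

(** As I^2 = Q I, the sum equals some sum x_k b_k with b_k in I, and the differences c_k - b_k lie
    in Q because x is regular. *)
Lemma param_indep (c : nat -> R) :
  \sum_(k < size x) x`_k * c k \in ideal_mul I I ->
  forall k, (k < size x)%N -> c k \in I.
Proof.
rewrite hI2 => h k hk.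
have P v : v \in msub (fun v : R^o => exists b : nat -> R, (forall k, b k \in I) /\
    v = \sum_(k < size x) x`_k * b k) <-> exists b : nat -> R, (forall k, b k \in I) /\
    v = \sum_(k < size x) x`_k * b k.
  apply: msubP.
    exists (fun=> 0); split=> [_|]; first exact: (subm0 I).
    by rewrite big1 // => i _; rewrite mulr0.
  move=> a _ _ [b [hb ->]] [b' [hb' ->]]; exists (fun k => a * b k + b' k); split.
    by move=> i; apply: (submD (U := I)) => //; apply: mem_idealMl.
  rewrite scaler_sumr -big_split; apply: eq_bigr => i _ /=.
  by rewrite mulrDr mulrCA.
have : exists b : nat -> R, (forall k, b k \in I) /\
    \sum_(k < size x) x`_k * c k = \sum_(k < size x) x`_k * b k.
  apply/P; move: (\sum_(k < size x) x`_k * c k) h.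
  apply: (@ideal_mul_sub _ (ideal_gen x) R^o I) => a b ha hb; apply/P.
  have /mulM_ring/gmulP[z ->] := ha.
  pose z' k := if insub k is Some j then z j else 0.
  have z'E (j : 'I_(size x)) : z' j = z j by rewrite /z' valK.
  exists (fun k => z' k * b); split=> [i|]; first exact: mem_idealMl.
  rewrite scaler_suml; apply: eq_bigr => i _.
  by rewrite z'E mulrA.
case=> b [hb e]; rewrite -(subrK (b k) (c k)); apply: (submD (U := I)) => //.
apply/hQI/(regular_relation (c := fun k => c k - b k) hreg) => //.
under eq_bigr do rewrite mulrBr.
by rewrite sumrB e subrr.
Qed.

Lemma param_indep_rV n (w : nat -> 'rV[R]_n) :
  \sum_(k < size x) x`_k *: w k \in (ideal_mul I I) ** 'rV[R]_n ->
  forall k, (k < size x)%N -> w k \in I ** 'rV[R]_n.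
Proof.
move=> /mulM_rV h k hk; apply/mulM_rV => i.
apply: (param_indep (c := fun k => w k 0 i)) => //.
by have := h i; rewrite summxE; under eq_bigr do rewrite mxE.
Qed.

(** For each generator of [m] in turn, multiply by its largest power that keeps the product outside
    [I]. *)
Lemma socle_exists : exists2 a : R, a \notin I & forall b, b \in m -> a * b \in I.
Proof.
have [s hs] := hnoeth m.
have [a ha h] : exists2 a : R, a \notin I & forall b, b \in s -> a * b \in I.
  have : {subset s <= m} by move=> b hb; rewrite hs; apply: mem_generated.
  elim: s {hs} => [|b s IH] hs; first by exists 1; rewrite ?ideal_not1.
  have [|a ha h] := IH; first by move=> c hc; apply: hs; rewrite in_cons hc orbT.
  have [_ _ /(_ b)[hb _]] := hI; have [n hn] := hb (hs b (mem_head _ _)).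
  have hex : exists n, a * b ^+ n \in I by exists n; apply: mem_idealMl.
  case: (ex_minnP hex) => [[|k]]; first by rewrite expr0 mulr1 (negbTE ha).
  move=> hk kmin; exists (a * b ^+ k).
    by apply/negP => /kmin; rewrite ltnn.
  move=> c; rewrite in_cons => /orP[/eqP->|/h hc]; first by rewrite -mulrA -exprSr.
  by rewrite mulrAC; apply: mem_idealMr.
exists a => // b; rewrite hs => /generatedP[c ->].
rewrite mulr_sumr; apply: (subm_sum (U := I)) => i _.
by rewrite -[c i *: _]/(c i * _) mulrCA; apply/mem_idealMl/h/mem_nth.
Qed.

(* Minimal generators [y] of [I/Q] together with [x] generate [I] minimally: if
   [c_k] were a unit in [sum c_k x_k + sum b_j y_j] in [I^2], multiplying by a
   socle element of [R/I] would contradict the independence of [x] modulo [I].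
   Minimal generators of the free module [I/I^2] form a basis. *)
Lemma ulrich_ideal_basis : exists r (y : 'I_r -> R),
  [/\ (0 < r)%N, forall j, y j \in I,
      forall a, a \in I -> exists b : 'I_r -> R, a - \sum_j b j * y j \in Q
    & forall b : 'I_r -> R, \sum_j b j * y j \in Q -> forall j, b j \in I].
Proof.
have hIf : finite_module (submod I).
  apply: finite_submod => //; exists [:: 1 : R^o] => a.
  by apply/generated_cons; exists a, 0; rewrite subm0 addr0; split=> //; rewrite [RHS]mulr1.
have [r [p [ps pm]]] := mincover_exists hnoeth hlocal (finite_quot (mtrace I Q) hIf).
have /choice[y0 hy0] j : exists a, quotpi (mtrace I Q) a = p (delta_mx 0 j) by apply: quotpi_surj.
pose y j : R := subval I (y0 j).
have yI j : y j \in I by apply: subvalP.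
have pE u : p u = quotpi (mtrace I Q) (lin_comb y0 u).
  by rewrite (lin_comb_basis p) lin_combE linear_sum; apply: eq_bigr => j _; rewrite linearZ /= -hy0.
have yE u : subval I (lin_comb y0 u) = \sum_j u 0 j * y j.
  by rewrite lin_combE linear_sum; apply: eq_bigr => j _; rewrite linearZ.
have pQ u : p u = 0 <-> \sum_j u 0 j * y j \in Q by rewrite pE quotpi_eq0 -yE.
have gen (a : R) : a \in I -> exists b : 'I_r -> R, a - \sum_j b j * y j \in Q.
  move=> /subval_exists[a' <-]; have [u hu] := ps (quotpi _ a').
  exists (fun j => u 0 j); rewrite -yE -linearB.
  have : quotpi (mtrace I Q) (a' - lin_comb y0 u) = 0 by rewrite linearB -pE hu subrr.
  by move=> /quotpi_eq0.
have /choice[x0 hx0] (k : 'I_(size x)) : exists a, subval I a = x`_k.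
  by apply/subval_exists/hQI/mem_generated/mem_nth.
pose z (k : 'I_(size x + r)) := match fintype.split k with inl k => x0 k | inr j => y0 j end.
pose W := quotmod (mtrace I (ideal_mul I I)).
pose P : {linear 'rV[R]_(size x + r) -> W} := comp_lin (quotpi _) (lin_comb z).
have zE u : subval I (lin_comb z u) =
    \sum_k u 0 (lshift r k) * x`_k + \sum_j u 0 (rshift (size x) j) * y j.
  rewrite lin_combE linear_sum big_split_ord /=; congr (_ + _); apply: eq_bigr => k _.
    by rewrite /z (unsplitK (inl k)) -hx0.
  by rewrite /z (unsplitK (inr k)).
have PE u : P u = 0 <-> \sum_k u 0 (lshift r k) * x`_k +
    \sum_j u 0 (rshift (size x) j) * y j \in ideal_mul I I.
  by rewrite comp_linE quotpi_eq0 -zE.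
have I2Q a : a \in ideal_mul I I -> a \in Q.
  by move: a; apply: ideal_mul_sub => a b; apply: ideal_square_sub.
have xQ (u : 'I_(size x) -> R) : \sum_k u k * x`_k \in Q.
  by apply: (subm_sum (U := Q)) => k _; apply/mem_idealMl/mem_generated/mem_nth.
have hP : mincover m P.
  split=> [w|u /PE hu].
    have [a <-] := quotpi_surj w; have [b hb] := gen _ (subvalP a).
    have /mulM_ring/gmulP[c hc] := hb.
    exists (\row_k match fintype.split k with inl k => c k | inr j => b j end).
    rewrite comp_linE; congr (quotpi _ _); apply: (@subval_inj _ _ I).
    rewrite zE -(subrK (\sum_j b j * y j) (subval I a)) hc; congr (_ + _); apply: eq_bigr => k _.
      by rewrite mxE (unsplitK (inl k)) mulrC.
    by rewrite mxE (unsplitK (inr k)).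
  set u1 := fun k => u 0 (lshift r k) in hu; set u2 := fun j => u 0 (rshift (size x) j) in hu.
  have u2m j : u2 j \in m.
    have /pm/mulM_rV/(_ j) : p (\row_j u2 j) = 0.
      apply/pQ; have := submB (I2Q _ hu) (xQ u1); rewrite addrC addKr.
      by under [X in _ -> X \in _]eq_bigr do rewrite mxE.
    by rewrite mxE.
  have [s sI sm] := socle_exists.
  have u1m k : u1 k \in m.
    apply: contraT => /(local_unit hnoeth hlocal)[e he]; case/negP: sI.
    pose c k := s * (if insub k is Some j then u1 j else 0).
    have cE (j : 'I_(size x)) : c j = s * u1 j by rewrite /c valK.
    have /(_ k (ltn_ord k)) : forall k, (k < size x)%N -> c k \in I.
      apply: param_indep.
      have -> : \sum_(k < size x) x`_k * c k =
          s * (\sum_k u1 k * x`_k + \sum_j u2 j * y j) - \sum_j (s * u2 j) * y j.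
        rewrite mulrDr [X in _ + X - _]mulr_sumr.
        under [X in _ - X]eq_bigr do rewrite -mulrA.
        by rewrite addrK mulr_sumr; apply: eq_bigr => j _; rewrite cE mulrC mulrA.
      apply: (submB (U := ideal_mul I I)); first exact: (submZ s hu).
      apply: (subm_sum (U := ideal_mul I I)) => j _.
      by apply: (mem_ideal_mul (sm _ (u2m j)) (yI j)).
    by rewrite cE => h; rewrite -(mulr1 s) -he mulrCA; apply: mem_idealMl.
  apply/mulM_rV => k; rewrite -(splitK k); case: (fintype.split k) => j; [exact: u1m | exact: u2m].
have /free_over_quotP[k [q [qs qk]]] := hfree.
have hker := min_gens_basis hnoeth hlocal hP qs qk.
exists r, y; split=> //.
  rewrite lt0n; apply/negP => /eqP r0; have [a aI /negP aQ] := hne; apply: aQ.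
  have [b] := gen a aI; rewrite big1 ?subr0 // => j _.
  by have := ltn_ord j; rewrite {2}r0.
move=> b hb j; have /mulM_ring/gmulP[c hc] := hb.
pose u : 'rV[R]_(size x + r) :=
  \row_k match fintype.split k with inl k => - c k | inr j => b j end.
suff Pu : P u = 0.
  by have /mulM_rV/(_ (rshift (size x) j)) := hker u Pu; rewrite mxE (unsplitK (inr j)).
apply/PE; rewrite /u.
under eq_bigr do rewrite mxE (unsplitK (inl _)).
under [X in _ + X]eq_bigr do rewrite mxE (unsplitK (inr _)).
rewrite hc; have -> : \sum_(k0 < size x) - c k0 * x`_k0 = - \sum_(k0 < size x) x`_k0 *: c k0.
  by rewrite -sumrN; apply: eq_bigr => i _; rewrite mulNr mulrC.
by rewrite addNr; apply: (subm0 (ideal_mul I I)).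
Qed.

End UlrichIdeal.

(** * Ulrich modules, reduction modulo parameters and Ext *)

Section UlrichModule.
Variables (R : comNzRingType) (m I : ideal R) (x : seq R).
Hypothesis hnoeth : noetherian_ring R.
Hypothesis hlocal : local_ring m.
Hypothesis hI : primary_to m I.
Hypothesis hx : primary_to m (ideal_gen x).
Hypothesis hreg : regular_on (R^o : lmodType R) x.
Hypothesis hQI : {subset ideal_gen x <= I}.
Hypothesis hI2 : ideal_mul I I =i ideal_mul (ideal_gen x) I.
Hypothesis hfree : free_over_quot I (quotmod (mtrace I (ideal_mul I I))).
Hypothesis hne : exists2 a : R, a \in I & a \notin ideal_gen x.
Let Q := ideal_gen x.
Implicit Types (M N V : lmodType R).

(** Kernel in I F means that M/IM is free over R/I on the images of the basis of F, and n > 0 stands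
    for M being nonzero. *)
Definition ulrich_cover M n (p : {linear 'rV[R]_n -> M}) :=
  [/\ (0 < n)%N, forall v, exists u, p u = v, forall u, p u = 0 -> u \in I ** 'rV[R]_n,
      regular_on M x & {subset I ** M <= ideal_gen x ** M}].

Lemma ulrich_cover_mincover M n (p : {linear 'rV[R]_n -> M}) :
  ulrich_cover p -> mincover m p.
Proof.
case=> _ ps pI _ _; split=> // u /pI; apply: ideal_mulS => //.
exact: ideal_sub_max hI.
Qed.

Lemma ulrich_cover_ker M n (p : {linear 'rV[R]_n -> M}) u :
  ulrich_cover p -> p u \in I ** M -> u \in I ** 'rV[R]_n.
Proof.
move=> [_ ps pI _ _] /(mulM_surj ps)[w hw e]; rewrite -(subrK w u); apply: submD => //.
by apply: pI; rewrite linearB e subrr.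
Qed.

Lemma ulrich_module_of_cover M n (p : {linear 'rV[R]_n -> M}) :
  krull_dim R (size x) -> ulrich_cover p -> Ulrich_module m I (ideal_gen x) M.
Proof.
move=> hd hp; have [n0 ps pI hM hIQ] := hp; split.
- apply: (maximal_CM_intro hx) => //; first exact: finite_surj ps (finite_rV R n).
  exists (p (delta_mx 0 (Ordinal n0))); apply/negP => h.
  have : delta_mx 0 (Ordinal n0) \in I ** 'rV[R]_n.
    by apply: (ulrich_cover_ker hp); apply: ideal_mulS h.
  move=> /mulM_rV/(_ (Ordinal n0)); rewrite mxE !eqxx; exact/negP/(ideal_not1 hI).
- by move=> v; apply/idP/idP; [apply: hIQ | apply: ideal_mulS].
apply/free_over_quotP; exists n, (comp_lin (quotpi _) p); split=> [v|u].
  by have [w <-] := quotpi_surj v; have [u <-] := ps w; exists u.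
rewrite comp_linE quotpi_eq0; split; first exact: ulrich_cover_ker.
exact: lin_mulM.
Qed.

Lemma cover_of_ulrich_module M : krull_dim R (size x) ->
  Ulrich_module m I (ideal_gen x) M -> exists n (p : {linear 'rV[R]_n -> M}), ulrich_cover p.
Proof.
move=> hd [hM hIQ /free_over_quotP[k [q [qs qk]]]].
have [n [p [ps pm]]] := mincover_exists hnoeth hlocal hM.1.
exists n, p; have hIm := ideal_sub_max hI.
have hq : mincover m (comp_lin (quotpi (I ** M)) p).
  split=> [v|u].
    by have [w <-] := quotpi_surj v; have [u <-] := ps w; exists u.
  rewrite comp_linE => /quotpi_eq0/(mulM_surj ps)[w hw e].
  rewrite -(subrK w u); apply: submD; last by apply: ideal_mulS hw.
  by apply: pm; rewrite linearB e subrr.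
have hker := min_gens_basis hnoeth hlocal hq qs qk.
split=> //.
- rewrite lt0n; apply/negP => /eqP n0.
  have [v /eqP] := maximal_CM_nonzero hM; apply; have [u <-] := ps v.
  have -> : u = 0; last exact: linear0.
  by apply/rowP => -[i hi]; exfalso; rewrite n0 in hi.
- by move=> u pu; apply: hker; rewrite comp_linE pu linear0.
- exact: maximal_CM_regular hM.
by move=> v; rewrite hIQ.
Qed.

(** I F lies in ker p + Q F because I M = Q M. This turns multiples of basis vectors by elements of
    I into relations of [M], up to Q F. *)
Lemma ulrich_cover_split M n (p : {linear 'rV[R]_n -> M}) u : ulrich_cover p ->
  u \in I ** 'rV[R]_n -> exists z w, [/\ p z = 0, w \in ideal_gen x ** 'rV[R]_n & u = z + w].
Proof.
move=> [_ ps _ _ hIQ] /(lin_mulM p)/hIQ/(mulM_surj ps)[w hw e].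
by exists (u - w), w; rewrite subrK linearB e subrr.
Qed.

(** A functional with a unit coordinate gives f : M -> R with value 1, and then I lies in f(I M),
    hence in f(Q M) and in Q. *)
Lemma ulrich_cover_stable M n (p : {linear 'rV[R]_n -> M}) u : ulrich_cover p ->
  annihilated p u -> u \in m ** 'rV[R]_n.
Proof.
move=> [_ ps _ _ hIQ] hu; apply/mulM_rV => i; apply: contraT => hui.
have [b hb] := local_unit hnoeth hlocal hui.
have [f hf] := factor_surj (f := dot_lin u) ps hu.
have fv : f (p (b *: delta_mx 0 i)) = 1 by rewrite hf /= dotZr dot_delta.
have [a aI /negP] := hne; case; apply/mulM_ring.
have -> : a = f (a *: p (b *: delta_mx 0 i)) by rewrite linearZ fv [RHS]mulr1.
by apply/lin_mulM/hIQ/mem_mulM.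
Qed.

Definition tower M i : lmodType R := quotmod (ideal_gen (take i x) ** M).

Lemma gmul_take M i (v : M) : (i < size x)%N -> v \in ideal_gen (take i.+1 x) ** M <->
  exists u w, w \in ideal_gen (take i x) ** M /\ v = x`_i *: u + w.
Proof. by move=> hi; rewrite (take_nth 0 hi); apply: gmul_rcons. Qed.

Lemma tower_exact M i : (i < size x)%N -> regular_on M x ->
  exists p : {linear tower M i -> tower M i.+1},
    short_exact (scale_lin x`_i (id_lin (tower M i))) p /\ forall v, p (quotpi _ v) = quotpi _ v.
Proof.
move=> hi hM.
have [|p hp] := factor_surj (f := quotpi (ideal_gen (take i.+1 x) ** M))
  (@quotpi_surj _ _ (ideal_gen (take i x) ** M)).
  move=> v /quotpi_eq0 hv; apply/quotpi_eq0/gmul_take => //.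
  by exists 0, v; rewrite scaler0 add0r.
exists p; split=> //; split.
- apply: inj_lin => q; have [v <-] := quotpi_surj q; rewrite scale_idE -linearZ.
  by move=> /quotpi_eq0 hv; apply/quotpi_eq0/(hM i hi).
- by move=> q; have [v <-] := quotpi_surj q; exists (quotpi _ v).
move=> q; have [v <-] := quotpi_surj q; rewrite hp quotpi_eq0 gmul_take //.
split=> [[u [w [hw ->]]]|[r]].
  exists (quotpi _ u); have /quotpi_eq0 e := hw.
  by rewrite linearD e addr0 linearZ.
have [u <-] := quotpi_surj r; rewrite scale_idE => e.
exists u, (v - x`_i *: u); split; last by rewrite addrC subrK.
by apply/quotpi_eq0; rewrite linearB linearZ -e subrr.
Qed.

Lemma tower0_iso M : injective (quotpi (ideal_gen (take 0 x) ** M)).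
Proof. by apply: inj_lin => v /quotpi_eq0; rewrite take0 => /gmul_nil. Qed.

Lemma tower_top M v : quotpi (ideal_gen (take (size x) x) ** M) v = 0 <-> v \in ideal_gen x ** M.
Proof. by rewrite quotpi_eq0 take_size. Qed.

Section WithResolution.
Variables (E : nat -> lmodType R) (e : {linear R^o -> E 0%N})
  (dE : forall n, {linear E n -> E n.+1}).
Hypothesis Einj : forall n, injective_module (E n).
Hypothesis einj : injective e.
Hypothesis Eexact0 : mim e =i mker (dE 0%N).
Hypothesis EexactS : forall n, mim (dE n) =i mker (dE n.+1).

Lemma ext_zero_iso n M N (f : {linear M -> N}) : injective f ->
  (forall w, exists v, f v = w) -> ext_zero dE n M <-> ext_zero dE n N.
Proof.
move=> fi fs; have [g gP] := factor_surj (f := id_lin M) fs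
  (fun v (h : f v = 0) => fi _ _ (etrans h (esym (linear0 f)))).
split; last exact: (ext_zero_retract (i := f) (p := g)).
apply: (ext_zero_retract (i := g) (p := f)) => w.
by have [v <-] := fs w; rewrite gP.
Qed.

(** Each further parameter is regular and raises by one the degree beyond which Ext vanishes. *)
Lemma ext_zero_tower_ring n i : (i <= size x)%N -> (i <= n)%N ->
  ext_zero dE n.+1 (tower R^o i).
Proof.
elim: i n => [|i IH] n hi hn.
  apply/(ext_zero_iso n.+1 (@tower0_iso R^o) (@quotpi_surj _ _ _)).
  exact: ext_zero_ring EexactS _.
case: n hn => // n hn; have [p [hp _]] := tower_exact hi hreg.
by apply: (ext_zero_right Einj EexactS hp); apply: IH => //; apply: ltnW.
Qed.

(** Primitives are found on each copy of R/I separately and added up. *)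
Lemma ext_zero_basis n N k (q : {linear 'rV[R]_k -> N}) : quot_basis I q ->
  ext_zero dE n.+1 (quotmod I) -> ext_zero dE n.+1 N.
Proof.
move=> [qs qk] hI' f cf.
have /choice[iota hiota] j : exists iota : {linear quotmod I -> N},
    forall r, iota (quotpi I r) = q (r *: delta_mx 0 j).
  apply: (factor_surj (f := comp_lin q (mulv_lin (delta_mx 0 j))) (@quotpi_surj _ _ I)) => r /quotpi_eq0 hr.
  by apply/qk/mem_mulM.
have /choice[g hg] j : exists g : {linear quotmod I -> E n},
    forall v, f (iota j v) = dE n (g v).
  by have [|g hg] := hI' (comp_lin f (iota j)); [move=> v; apply: cf | exists g].
have [G hG] := sum_lin (fun j => comp_lin (g j) (comp_lin (quotpi I) (coord_lin R j))).
have [|h hh] := factor_surj (f := G) qs.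
  move=> u /qk/mulM_rV hu; rewrite hG big1 // => j _; rewrite !comp_linE.
  have -> : quotpi I (coord_lin R j u) = 0 by apply/(quotpi_eq0 I); apply: hu.
  exact: linear0.
exists h => v; have [u <-] := qs v; rewrite hh hG linear_sum.
rewrite {1}[u]row_sum_delta !linear_sum; apply: eq_bigr => j _.
by rewrite -hiota hg.
Qed.

Lemma ext_zero_basis_inv n N k (q : {linear 'rV[R]_k -> N}) : (0 < k)%N -> quot_basis I q ->
  ext_zero dE n N -> ext_zero dE n (quotmod I).
Proof.
move=> k0 [qs qk]; pose j := Ordinal k0.
have [||i hi] := factor_surj (p := quotpi I) (f := comp_lin q (mulv_lin (delta_mx 0 j))).
- exact: quotpi_surj.
- by move=> r /quotpi_eq0 hr; apply/qk/mem_mulM.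
have [|p hp] := factor_surj (f := comp_lin (quotpi I) (coord_lin R j)) qs.
  by move=> u /qk/mulM_rV hu; apply/(quotpi_eq0 I); apply: hu.
apply: (ext_zero_retract (i := i) (p := p)) => r; have [a <-] := quotpi_surj r.
by rewrite hi hp !comp_linE; congr (quotpi I _); rewrite /= !mxE !eqxx mulr1.
Qed.

(** In 0 -> I/Q -> R/Q -> R/I -> 0 the middle term has no Ext in degrees n + 1 and n + 2, so the
    outer terms exchange vanishing. Going down uses that R/I is a retract of I/Q, whose rank is
    positive. *)
Lemma ext_zero_quot_step n : (size x <= n)%N ->
  ext_zero dE n.+1 (quotmod I) <-> ext_zero dE n.+2 (quotmod I).
Proof.
move=> hn; have [r [y [r0 yI gen indep]]] := ulrich_ideal_basis hnoeth hlocal hI hreg hQI hI2 hfree hne.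
(* The tower of R ends in the quotient by Q R, which has the elements of Q but is another submodule
   term. *)
pose U := Q ** R^o : ideal R.
have UQ a : a \in U <-> a \in Q by apply: mulM_ring.
have hU l : (size x <= l)%N -> ext_zero dE l.+1 (quotmod U).
  move=> hl; have := ext_zero_tower_ring (leqnn _) hl.
  by rewrite /tower take_size.
pose A := quotmod (mtrace I Q).
have [|i hi] := factor_surj (p := quotpi (mtrace I Q)) (f := comp_lin (quotpi U) (subval I))
  (@quotpi_surj _ _ _).
  by move=> a /quotpi_eq0 ha; apply/quotpi_eq0/UQ.
have [|p hp] := factor_surj (p := quotpi U) (f := quotpi I) (@quotpi_surj _ _ _).
  by move=> a /quotpi_eq0/UQ ha; apply/(quotpi_eq0 I); apply: hQI.
have hip : short_exact i p.
  split.
  - apply: inj_lin => q; have [a <-] := quotpi_surj q; rewrite hi comp_linE.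
    by move=> /quotpi_eq0/UQ ha; apply/quotpi_eq0.
  - by move=> q; have [a <-] := quotpi_surj q; exists (quotpi U a).
  move=> q; have [a <-] := quotpi_surj q; rewrite hp quotpi_eq0; split.
    by move=> /subval_exists[b <-]; exists (quotpi _ b); rewrite hi.
  case=> q'; have [b <-] := quotpi_surj q'; rewrite hi comp_linE => eb.
  have /quotpi_eq0/UQ/hQI hab : quotpi U (a - subval I b) = 0 by rewrite linearB eb subrr.
  by rewrite -(subrK (subval I b) a); apply: submD => //; apply: subvalP.
have /choice[y0 hy0] j : exists a, subval I a = y j by apply/subval_exists/yI.
have yE u : subval I (lin_comb y0 u) = \sum_j u 0 j * y j.
  by rewrite lin_combE linear_sum; apply: eq_bigr => j _; rewrite linearZ /= -hy0.
have hA : quot_basis I (comp_lin (quotpi (mtrace I Q)) (lin_comb y0)).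
  split=> [q|u].
    have [a <-] := quotpi_surj q; have [b hb] := gen _ (subvalP a); exists (\row_j b j).
    rewrite comp_linE; apply/eqP; rewrite -subr_eq0 -linearB -oppr_eq0 -linearN opprB.
    apply/eqP/quotpi_eq0; rewrite -[_ \in _]/(subval I _ \in Q) linearB yE.
    by under eq_bigr do rewrite mxE.
  rewrite comp_linE quotpi_eq0 -[_ \in mtrace _ _]/(subval I _ \in Q) yE mulM_rV.
  split=> [h|h]; first exact: indep h.
  by apply: (subm_sum (U := Q)) => j _; apply: (ideal_square_sub hI2).
split=> h.
  apply: (ext_zero_right Einj EexactS hip); first exact: (ext_zero_basis hA).
  by apply: hU; apply: leqW.
apply: (ext_zero_basis_inv r0 hA); apply: (ext_zero_left Einj EexactS hip) => //.
exact: hU.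
Qed.

Lemma ext_zero_quot_all n k : (size x <= n)%N -> (size x <= k)%N ->
  ext_zero dE n.+1 (quotmod I) -> ext_zero dE k.+1 (quotmod I).
Proof.
have up a b : (size x <= a)%N -> ext_zero dE a.+1 (quotmod I) <->
    ext_zero dE (a + b).+1 (quotmod I).
  move=> ha; elim: b => [|b IH]; first by rewrite addn0.
  by rewrite IH addnS ext_zero_quot_step // (leq_trans ha) // leq_addr.
move=> hn hk h; apply/(up _ n hk); rewrite addnC.
by apply/(up _ k hn).
Qed.

(** The top of the tower, M/QM, is a power of R/I, with no Ext in degrees above d. Each step down
    the tower lowers this bound by one, by Nakayama. *)
Lemma ext_zero_ulrich M n (p : {linear 'rV[R]_n -> M}) : ulrich_cover p ->
  (forall l, (size x <= l)%N -> ext_zero dE l.+1 (quotmod I)) ->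
  forall l, ext_zero dE l.+1 M.
Proof.
move=> hp hI'; have [n0 ps pI hM hIQ] := hp.
have hMf : finite_module M by apply: finite_surj ps (finite_rV R n).
suff h i l : (i <= size x)%N -> (size x - i <= l)%N -> ext_zero dE l.+1 (tower M (size x - i)).
  move=> l; apply/(ext_zero_iso l.+1 (@tower0_iso M) (@quotpi_surj _ _ _)).
  by have := h (size x) l (leqnn _); rewrite subnn; apply.
elim: i l => [|i IH] l hi hl.
  rewrite subn0 in hl *.
  have hq : quot_basis I (comp_lin (quotpi (ideal_gen (take (size x) x) ** M)) p).
    split=> [v|u].
      by have [w <-] := quotpi_surj v; have [u <-] := ps w; exists u.
    rewrite comp_linE tower_top; split=> [h|h]; last exact/hIQ/lin_mulM.
    by apply: (ulrich_cover_ker hp); apply: ideal_mulS h.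
  exact: (ext_zero_basis hq (hI' _ hl)).
have hlt : (size x - i.+1 < size x)%N by rewrite ltn_subrL (leq_trans _ hi).
have [q [hq _]] := tower_exact hlt hM.
apply: (ext_zero_nakayama Einj einj Eexact0 EexactS hnoeth hlocal _ _ hq).
- exact: finite_quot.
- by apply: (param_sub hx); apply: mem_nth.
rewrite -subSn // subSS; apply: IH; first exact: ltnW.
by rewrite -(subSS i) subSn // ltnS.
Qed.

(** The resolution controls only Ext into R, so the lift is made by hand. On a free cover of [N] the
    map lifts one step; on the relations [Z] this lift is x_i times a map [h], which lifts to R by
    induction and extends to the cover. Subtracting x_i times the extension makes the lift descend
    to [N]. *)
Lemma lift_tower i N (f : {linear N -> tower R^o i}) : (i <= size x)%N -> finite_module N ->
  (forall n, ext_zero dE n.+1 N) ->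
  exists g : {linear N -> R^o}, forall v, quotpi _ (g v) = f v.
Proof.
elim: i N f => [|i IH] N f hi hN hE.
  by apply: factor_inj => [|v]; [exact: tower0_iso | exact: quotpi_surj].
have [p [hp pE]] := tower_exact hi hreg; have [pi ps pk] := hp.
have [k [c cs]] := finite_cover hN; have hc := short_exact_ker cs.
set Z := submod (mker c) in hc; have [ci _ ck] := hc.
have hZ : finite_module Z by apply: finite_submod => //; apply: finite_rV.
have hEZ n : ext_zero dE n.+1 Z by apply/(ext_zero_shift Einj EexactS n hc).
have [g hg] := lift_free (comp_lin f c) ps.
have [|h hh] := factor_inj (f := comp_lin g (subval (mker c))) pi.
  move=> z; apply/pk; rewrite comp_linE hg comp_linE.
  have -> : c (subval (mker c) z) = 0 by apply/ck; exists z.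
  exact: linear0.
have [h' hh'] := IH Z h (ltnW hi) hZ hEZ.
have [h'' hh''] := ext_one_extend Einj einj Eexact0 EexactS hc (hE 0%N) h'.
have [|l hl] := factor_exact hc (f := sub_lin g (scale_lin x`_i (comp_lin (quotpi _) h''))).
  move=> z; rewrite /sub_lin /= hh''; apply/eqP; rewrite subr_eq0; apply/eqP.
  have := hh z; rewrite scale_idE comp_linE => <-.
  by rewrite -hh'.
have [g' hg'] := IH N l (ltnW hi) hN hE.
exists g' => v; have [u <-] := cs v; rewrite -pE hg' hl.
have -> : sub_lin g (scale_lin x`_i (comp_lin (quotpi _) h'')) u =
  g u - scale_lin x`_i (id_lin _) (quotpi _ (h'' u)) by [].
rewrite linearB hg comp_linE.
by have -> : p (scale_lin x`_i (id_lin _) (quotpi _ (h'' u))) = 0;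
   [apply/pk; exists (quotpi _ (h'' u)) | rewrite subr0].
Qed.

(** Modulo the earlier parameters, [h] is the last parameter times a map that lifts to R;
    subtracting this term leaves one parameter fewer. *)
Lemma hom_in_param i N (h : {linear N -> R^o}) : (i <= size x)%N -> finite_module N ->
  (forall n, ext_zero dE n.+1 N) -> (forall v, h v \in ideal_gen (take i x)) ->
  exists H : nat -> {linear N -> R^o}, forall v, h v = \sum_(k < i) x`_k * H k v.
Proof.
elim: i h => [|i IH] h hi hN hE hh.
  exists (fun=> h) => v; rewrite big_ord0.
  by apply/gmul_nil/mulM_ring; have := hh v; rewrite take0.
have [p [hp pE]] := tower_exact hi hreg; have [pi ps pk] := hp.
have [|g hg] := factor_inj (f := comp_lin (quotpi _) h) pi.
  by move=> v; apply/pk; rewrite comp_linE pE; apply/quotpi_eq0/mulM_ring.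
have [g' hg'] := lift_tower g (ltnW hi) hN hE.
have [|//|//|v|H hH] := IH (sub_lin h (scale_lin x`_i g')); first exact: ltnW.
  apply/(@mulM_ring R)/quotpi_eq0.
  have -> : sub_lin h (scale_lin x`_i g') v = h v - x`_i *: g' v by [].
  have hgv := hg v; rewrite comp_linE scale_idE -hg' -linearZ in hgv.
  by rewrite linearB -hgv subrr.
exists (fun k => if k == i then g' else H k) => v.
rewrite big_ord_recr /= eqxx.
transitivity (sub_lin h (scale_lin x`_i g') v + x`_i * g' v); first by rewrite /= subrK.
rewrite hH; congr (_ + _); apply: eq_bigr => k _.
by rewrite ltn_eqF.
Qed.

(** * The dual of the relations of an Ulrich module *)

Section LambdaUlrich.
Variables (M : lmodType R) (n : nat) (p : {linear 'rV[R]_n -> M}).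
Hypothesis hp : ulrich_cover p.
Hypothesis hE : forall l, ext_zero dE l.+1 M.

Let hc : short_exact (subval (mker p)) p. Proof. by case: hp => _ ps _ _ _; apply: short_exact_ker. Qed.
Let Z := submod (mker p).
Let hZ : finite_module Z. Proof. by apply: finite_submod => //; apply: finite_rV. Qed.
Let hEZ l : ext_zero dE l.+1 Z. Proof. exact/(ext_zero_shift Einj EexactS l hc). Qed.

Let extend (f : {linear Z -> R^o}) : exists u, forall z : Z, f z = dot u (subval _ z).
Proof.
have [h hh] := ext_one_extend Einj einj Eexact0 EexactS hc (@hE 0%N) f.
by have [u hu] := functional_dot h; exists u => z; rewrite -hh.
Qed.

(* Every map [I/Q -> R/Q], here [y_j0 |-> c] and [y_j |-> 0] for the other [j],
   is multiplication by a scalar [t]: it lifts from the relations of [M] to [R]. *)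
Lemma param_colon_aux r (y : 'I_r -> R) (j0 : 'I_r) (c : R) :
  (forall j, y j \in I) ->
  (forall a, a \in I -> exists b : 'I_r -> R, a - \sum_j b j * y j \in Q) ->
  (forall b : 'I_r -> R, \sum_j b j * y j \in Q -> forall j, b j \in I) ->
  (forall a, a \in I -> a * c \in Q) ->
  exists t : R, forall (a : R) (b : 'I_r -> R), a \in I -> a - \sum_j b j * y j \in Q ->
    t * a - b j0 * c \in Q.
Proof.
move=> yI gen indep hcol; have [n0 ps pI hM hIQ] := hp.
pose i0 := Ordinal n0.
have zI (z : Z) : subval (mker p) z 0 i0 \in I.
  by have /mulM_rV := pI _ ((in_mker _ _).1 (subvalP z)); apply.
pose pi := quotpi (ideal_gen (take (size x) x) ** R^o).
have top (a : R) : pi a = 0 <-> a \in Q.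
  by rewrite /pi tower_top mulM_ring.
(* The entry of a relation at [i0] lies in I. Its coefficient along [y j0], times [c], is well
   defined modulo Q because that coefficient is determined modulo I and I c lies in Q. *)
have [|w|a z w z' w' [b [hb ->]] [b' [hb' ->]]|f hf] := @linear_of_rel R Z (tower R^o (size x))
  (fun z w => exists b : 'I_r -> R, subval (mker p) z 0 i0 - \sum_j b j * y j \in Q /\
     w = pi (b j0 * c)).
- by move=> z; have [b hb] := gen _ (zI z); exists (pi (b j0 * c)), b.
- case=> b [hb ->]; apply/top; apply: hcol; apply: indep.
  by move: hb; rewrite linear0 mxE sub0r => /(submN (U := Q)); rewrite opprK.
- exists (fun j => a * b j + b' j); split; last by rewrite -linearP mulrDl -mulrA.
  rewrite linearP !mxE.
  have -> : \sum_j (a * b j + b' j) * y j = a * (\sum_j b j * y j) + \sum_j b' j * y j.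
    by rewrite mulr_sumr -big_split; apply: eq_bigr => j _; rewrite mulrDl mulrA.
  by rewrite opprD addrACA -mulrBr; apply: (submD (U := Q)) => //; apply: mem_idealMl.
have [g hg] := lift_tower f (leqnn _) hZ hEZ; have [u hu] := extend g.
(* [a] times the basis vector is a relation up to Q F, so its product with the entry of [u] is
   computed by [g] modulo Q. *)
exists (u 0 i0) => a b aI hab.
have [|z [w [pz wQ ezw]]] := ulrich_cover_split (u := a *: delta_mx 0 i0) hp; first exact: mem_mulM.
have [z' ez] : exists z', subval (mker p) z' = z by apply/subval_exists/in_mker.
have wQ0 : w 0 i0 \in Q by have /mulM_rV := wQ; apply.
have za : z 0 i0 = a - w 0 i0.
  have -> : z = a *: delta_mx 0 i0 - w by rewrite ezw addrK.
  by rewrite !mxE !eqxx mulr1.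
have [b' [hb' fz]] := hf z'.
have bb : (b j0 - b' j0) * c \in Q.
  apply: hcol; apply: (indep (fun j => b j - b' j)).
  have -> : \sum_j (b j - b' j) * y j = \sum_j b j * y j - \sum_j b' j * y j.
    by rewrite -sumrB; apply: eq_bigr => j _; rewrite mulrBl.
  rewrite ez za in hb'.
  have -> : \sum_j b j * y j - \sum_j b' j * y j =
     (a - w 0 i0 - \sum_j b' j * y j) - (a - \sum_j b j * y j) + w 0 i0 by ring.
  exact: (submD (submB hb' hab) wQ0).
have gz : g z' - b' j0 * c \in Q by apply/top; rewrite linearB hg fz subrr.
have ua : u 0 i0 * a = g z' + dot u w.
  by rewrite hu ez -dotDr -ezw dotZr dot_delta mulrC.
have -> : u 0 i0 * a - b j0 * c = (g z' - b' j0 * c) + dot u w - (b j0 - b' j0) * c.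
  by rewrite ua; ring.
apply: (submB (U := Q)) => //; apply: (submD (U := Q)) => //; exact: dot_mulM.
Qed.

(** The map I/Q -> R/Q sending y_j0 to [c] is multiplication by some t, so that c is congruent to t
    y_j0 modulo Q. *)
Lemma param_colon (c : R) : (forall a, a \in I -> a * c \in Q) -> c \in I.
Proof.
move=> hcol.
have [r [y [r0 yI gen indep]]] := ulrich_ideal_basis hnoeth hlocal hI hreg hQI hI2 hfree hne.
pose d j k : R := (k == j :> 'I_r)%:R.
have dE' j : \sum_k d j k * y k = y j.
  rewrite (bigD1 j) //= /d eqxx mul1r big1 ?addr0 // => k /negbTE ->.
  by rewrite mul0r.
have dP j : y j - \sum_k d j k * y k \in Q by rewrite dE' subrr; apply: (subm0 Q).
have I2Q a b : a \in I -> b \in I -> a * b \in Q by apply: ideal_square_sub.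
pose j0 := Ordinal r0.
(* Rank one: for l <> j0, the map sending y_j0 to y_l and killing the other generators is
   multiplication by some t. From t y_l in Q follows t in I, hence t y_j0 in Q, and finally y_l in
   Q, which is absurd. *)
have uniq_j l : l = j0.
  apply/eqP; apply: contraT => ne.
  have [|t ht] := param_colon_aux (c := y l) j0 yI gen indep; first by move=> a aI; apply: I2Q.
  have tI : t \in I.
    have := ht (y l) (d l) (yI l) (dP l); rewrite {1}/d eq_sym (negbTE ne) mul0r subr0.
    rewrite -(dE' l) mulr_sumr => h; rewrite -[t]mulr1.
    have := indep (fun k => t * d l k) _ l; rewrite /d eqxx; apply.
    by under eq_bigr do rewrite -mulrA.
  have := ht (y j0) (d j0) (yI j0) (dP j0); rewrite {1}/d eqxx mul1r => h.
  have yQ : y l \in Q.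
    rewrite -[y l](subKr (t * y j0)); apply: (submB (U := Q)) => //; exact: I2Q.
  have := indep (d l) _ l; rewrite dE' /d eqxx => /(_ yQ) h1.
  by have := ideal_not1 hI; rewrite h1.
have [t ht] := param_colon_aux j0 yI gen indep hcol.
have := ht (y j0) (d j0) (yI j0) (dP j0); rewrite {1}/d eqxx mul1r => h.
rewrite -[c](subKr (t * y j0)); apply: (submB (U := I)); last exact: hQI.
exact: mem_idealMl.
Qed.

Variables (L : lmodType R) (theta : {linear 'rV[R]_n -> L}).
Hypothesis ts : forall v, exists u, theta u = v.
Hypothesis tk : forall u, theta u = 0 <-> annihilated p u.

(** An element of [L] is the restriction of a functional to the relations. If its values lie in the
    ideal of the first k parameters, it splits as sum x_l H_l, and each H_l extends to the cover. *)
Lemma dual_in_param k u : (k <= size x)%N ->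
  (forall z, p z = 0 -> dot u z \in ideal_gen (take k x)) ->
  theta u \in ideal_gen (take k x) ** L.
Proof.
move=> hk hu.
have [|H hH] := hom_in_param (i := k) (h := comp_lin (dot_lin u) (subval (mker p))) hk hZ hEZ.
  by move=> z; apply: hu; apply/in_mker/subvalP.
have /choice[w hw] l := extend (H l).
have -> : theta u = \sum_(l < k) x`_l *: theta (w l).
  apply/eqP; rewrite -subr_eq0; apply/eqP.
  have -> : \sum_(l < k) x`_l *: theta (w l) = theta (\sum_(l < k) x`_l *: w l).
    by rewrite linear_sum; apply: eq_bigr => l _; rewrite linearZ.
  rewrite -linearB; apply/tk => z pz.
  have [z' <-] : exists z', subval (mker p) z' = z by apply/subval_exists/in_mker.
  rewrite dotC dotBr ![dot (subval _ _) _]dotC.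
  rewrite -[dot u _]/(comp_lin (dot_lin u) (subval (mker p)) z') hH.
  rewrite dotC dot_sumr -sumrB big1 // => l _.
  by rewrite dotZr dotC -hw subrr.
apply: subm_sum => l _; apply: mem_mulM; apply: mem_generated.
by rewrite -(nth_take 0 (ltn_ord l)) mem_nth // size_take_min leq_min ltn_ord (leq_trans (ltn_ord l)).
Qed.

(** If u vanishes on the relations, then I u_i lies in Q by [ulrich_cover_split], so u_i lies in Q :
    I, contained in I. Regularity on [L] follows from regularity on R by [dual_in_param]. Since the
    relations lie in I F, elements of I times functionals take values in I^2 on them, hence in Q,
    which gives I L inside Q L. *)
Lemma lambda_ulrich_cover : ulrich_cover theta.
Proof.
have [n0 ps pI hM hIQ] := hp; split=> //.
- move=> u /tk hu; apply/mulM_rV => i; apply: param_colon => a aI.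
  have [|z [w [pz wQ ezw]]] := ulrich_cover_split (u := a *: delta_mx 0 i) hp; first exact: mem_mulM.
  have -> : a * u 0 i = dot u w.
    have -> : w = a *: delta_mx 0 i - z by rewrite ezw addrC addKr.
    by rewrite dotBr (hu _ pz) subr0 dotZr dot_delta.
  exact: dot_mulM.
- move=> k hk v; have [u <-] := ts v; rewrite -linearZ => /(mulM_surj ts)[w hw ew].
  apply: (dual_in_param (ltnW hk)) => z pz; apply/mulM_ring/(hreg hk)/mulM_ring.
  have -> : x`_k *: (dot u z : R^o) = dot w z.
    have /tk/(_ z pz) : theta (x`_k *: u - w) = 0 by rewrite linearB ew subrr.
    rewrite dotC dotBr dotZr !(dotC z) => /eqP.
    by rewrite subr_eq0 => /eqP.
  by rewrite dotC; apply: dot_mulM.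
apply: mulM_sub => a v aI; have [u <-] := ts v; rewrite -linearZ.
rewrite -{1}(take_size x); apply: dual_in_param => // z pz; rewrite take_size.
rewrite dotC dotZr dotC.
by apply: (ideal_square_sub hI2) => //; apply: dot_mulM; apply: pI.
Qed.
End LambdaUlrich.

End WithResolution.
End UlrichModule.

(** * The syzygies of R/I *)

Section KoszulMore.
Variable R : comNzRingType.
Implicit Types (U V W M N : lmodType R) (J : ideal R) (s : seq R) (p : nat).

Lemma fst_linear V W : linear (fun w : (V * W)%type => w.1). Proof. by []. Qed.
Lemma snd_linear V W : linear (fun w : (V * W)%type => w.2). Proof. by []. Qed.
Definition fst_lin V W : {linear (V * W)%type -> V} := mklin (@fst_linear V W).
Definition snd_lin V W : {linear (V * W)%type -> W} := mklin (@snd_linear V W).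

Fixpoint kout s M : koszul s M -> M :=
  match s return koszul s M -> M with
  | [::] => id
  | a :: s' => fun w => kout w.1
  end.
Lemma kout_linear s M : linear (@kout s M).
Proof. by elim: s => [|a s IH] c x y //=; rewrite IH. Qed.
Lemma kin_out s M v : kout (kin s v) = v :> M.
Proof. by elim: s. Qed.

Lemma kin_mulM J s M v : kin s v \in J ** koszul s M -> v \in J ** M.
Proof. by move=> /(lin_mulM (mklin (@kout_linear s M))); rewrite /= kin_out. Qed.

Lemma koszul_mulMS J (K : ideal R) s M : {subset J ** M <= K ** M} ->
  {subset J ** koszul s M <= K ** koszul s M}.
Proof.
move=> h; elim: s => [|a s IH] //= [u v] /mulM_pair[hu hv].
by apply/mulM_pair; split; apply: IH.
Qed.

Lemma kmap_mulM J s U V (f : {linear U -> V}) (w : koszul s U) :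
  (forall u, f u \in J ** V) -> kmap f w \in J ** koszul s V.
Proof.
move=> h; elim: s w => [|a s IH] w /=; first exact: h.
by apply/mulM_pair; split; apply: IH.
Qed.

Lemma mulM_mul J (K : ideal R) V a (v : V) : a \in J -> v \in K ** V ->
  a *: v \in (ideal_mul J K) ** V.
Proof.
move=> ha hv.
have P w : w \in msub (fun w : V => a *: w \in (ideal_mul J K) ** V) <->
    a *: w \in (ideal_mul J K) ** V.
  apply: (@msubP _ V (fun w => a *: w \in (ideal_mul J K) ** V)).
    by rewrite scaler0 subm0.
  move=> c x y hx hy; rewrite scalerDr; apply: submD => //.
  by rewrite scalerA mulrC -scalerA; apply: submZ.
apply/P; move: v hv; apply: mulM_sub => b w hb; apply/P.
by rewrite scalerA; apply: mem_mulM; apply: (mem_ideal_mul ha hb).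
Qed.

Lemma kdiff_annihilated s M (w : koszul s M) :
  (forall b, b \in s -> forall v : M, b *: v = 0) -> kdiff w = 0.
Proof.
elim: s w => [|a s IH] w h //; case: w => u v /=.
have hs : forall b, b \in s -> forall v : M, b *: v = 0.
  by move=> b hb; apply: h; rewrite in_cons hb orbT.
rewrite !IH //; have -> : a *: v = 0.
  elim: (s) v {hs IH h} (h a (mem_head _ _)) => [|b s' IH'] v' ha //=.
  by case: v' => u' v'; rewrite pairZ !IH'.
by rewrite addr0 oppr0.
Qed.

(* A basis over [R/I] of the Koszul homology in degree [p]. *)
Definition koszul_basis (I : ideal R) s M p (T : finType) (z : T -> koszul s M) :=
  [/\ forall t, kdeg p (z t) /\ kdiff (z t) = 0,
      forall w, kdeg p w -> kdiff w = 0 -> exists (c : T -> R) (w' : koszul s M),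
        kdeg p.+1 w' /\ w = \sum_t c t *: z t + kdiff w'
    & forall c : T -> R, (exists w' : koszul s M, kdeg p.+1 w' /\ \sum_t c t *: z t = kdiff w')
        <-> forall t, c t \in I].

Lemma koszul_quot_basis (I : ideal R) s p : exists (T : finType) (z : T -> koszul s (quotmod I)),
  [/\ forall t, kdeg p (z t), forall w, kdeg p w -> exists c : T -> R, w = \sum_t c t *: z t
    & forall c : T -> R, \sum_t c t *: z t = 0 <-> forall t, c t \in I].
Proof.
elim: s p => [|a s IH] [|p].
- exists unit, (fun=> quotpi I 1); split=> // [w _|c].
    have [r <-] := quotpi_surj w; exists (fun=> r).
    rewrite (big_pred1 tt); last by case.
    by rewrite -linearZ; congr (quotpi I _); rewrite [RHS]mulr1.
  rewrite (big_pred1 tt); last by case.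
  rewrite -linearZ quotpi_eq0 [c tt *: _]mulr1.
  by split=> [h []|]; [exact: h|apply].
- exists void, (fun t : void => match t with end); split=> [[]|w /= ->|c]; last by rewrite big_pred0 => [|[]]; split=> // _ [].
  by exists (fun=> 0); rewrite big_pred0 => [|[]].
- have [T [z [z1 z2 z3]]] := IH 0%N.
  exists T, (fun t => (z t, 0) : koszul (a :: s) (quotmod I)).
  have e (c : T -> R) : \sum_t c t *: ((z t, 0) : koszul (a :: s) (quotmod I)) = (\sum_t c t *: z t, 0).
    elim/big_rec2: _ => // t y _ _ ->.
    by rewrite pairZ pairD scaler0 addr0.
  split=> [t|[u v] /= [/z2[c ->] ->]|c]; first by split=> //; apply: z1.
    by exists c; rewrite e.
  by rewrite e -z3; split=> [[->]|->].
have [T [z [z1 z2 z3]]] := IH p.+1; have [T' [z' [z1' z2' z3']]] := IH p.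
exists (T + T')%type, (fun t => match t with inl t => (z t, 0) | inr t => (0, z' t) end
  : koszul (a :: s) (quotmod I)).
have e (c : T + T' -> R) : \sum_t c t *: (match t with inl t => (z t, 0) | inr t => (0, z' t) end
     : koszul (a :: s) (quotmod I)) = (\sum_t c (inl t) *: z t, \sum_t c (inr t) *: z' t).
  rewrite big_sumType /=.
  have -> : \sum_t c (inl t) *: ((z t, 0) : koszul (a :: s) (quotmod I)) =
      (\sum_t c (inl t) *: z t, 0).
    by elim/big_rec2: _ => // t y _ _ ->; rewrite pairZ pairD scaler0 addr0.
  have -> : \sum_t c (inr t) *: ((0, z' t) : koszul (a :: s) (quotmod I)) =
      (0, \sum_t c (inr t) *: z' t).
    by elim/big_rec2: _ => // t y _ _ ->; rewrite pairZ pairD scaler0 addr0.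
  by rewrite pairD addr0 add0r.
split=> [[t|t]|[u v] /= [/z2[c ->] /z2'[c' ->]]|c].
- by split; [apply: z1 | apply: kdeg0].
- by split; [apply: kdeg0 | apply: z1'].
- by exists (fun t => match t with inl t => c t | inr t => c' t end); rewrite e.
rewrite e; split=> [[/z3 h /z3' h'] [t|t] //|h].
have /z3 -> : forall t, c (inl t) \in I by move=> t; apply: h.
by have /z3' -> : forall t, c (inr t) \in I by move=> t; apply: h.
Qed.

Lemma cover_of_family (I : ideal R) M (T : finType) (v : T -> M) : (0 < #|T|)%N ->
  (forall w, exists c : T -> R, w = \sum_t c t *: v t) ->
  (forall c : T -> R, \sum_t c t *: v t = 0 -> forall t, c t \in I) ->
  exists n (p : {linear 'rV[R]_n -> M}), [/\ (0 < n)%N, forall w, exists u, p u = w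
        & forall u, p u = 0 -> u \in I ** 'rV[R]_n].
Proof.
move=> T0 gen rel; exists #|T|, (lin_comb (fun k => v (enum_val k))).
have e u : lin_comb (fun k => v (enum_val k)) u = \sum_t u 0 (enum_rank t) *: v t.
  rewrite lin_combE (reindex (@enum_rank T)) /=; last exact/onW_bij/enum_rank_bij.
  by apply: eq_bigr => t _; rewrite enum_rankK.
split=> // [w|u].
  have [c ->] := gen w; exists (\row_k c (enum_val k)); rewrite e.
  by apply: eq_bigr => t _; rewrite mxE enum_rankK.
rewrite e => h; apply/mulM_rV => k; rewrite -(enum_valK k).
exact: (rel (fun t => u 0 (enum_rank t))).
Qed.

End KoszulMore.

Section Syzygies.
Variables (R : comNzRingType) (m I : ideal R) (x : seq R).
Hypothesis hnoeth : noetherian_ring R.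
Hypothesis hlocal : local_ring m.
Hypothesis hI : primary_to m I.
Hypothesis hx : primary_to m (ideal_gen x).
Hypothesis hreg : regular_on (R^o : lmodType R) x.
Hypothesis hQI : {subset ideal_gen x <= I}.
Hypothesis hI2 : ideal_mul I I =i ideal_mul (ideal_gen x) I.
Hypothesis hfree : free_over_quot I (quotmod (mtrace I (ideal_mul I I))).
Hypothesis hne : exists2 a : R, a \in I & a \notin ideal_gen x.
Let Q := ideal_gen x.
Implicit Types (M N X : lmodType R).

(** Independence of x modulo I^2, carried through the cones. The extra sum over [t] collects the
    terms a v which the cones already removed contribute to the differential. In degree 0 the
    differential sees nothing, whence q > 0 for [h]. *)
Lemma koszul_indep n s t (w : nat -> koszul s 'rV[R]_n) (h : koszul s 'rV[R]_n) q :
  x = t ++ s -> kdeg q h ->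
  \sum_(k < size t) x`_k *: w k + kdiff h \in (ideal_mul I I) ** koszul s 'rV[R]_n ->
  (forall k, (k < size t)%N -> w k \in I ** koszul s 'rV[R]_n) /\
  ((0 < q)%N -> h \in I ** koszul s 'rV[R]_n).
Proof.
elim: s t w h q => [|a s IH] t w h q ex hq.
  rewrite cats0 in ex; rewrite /= addr0 -ex => hw; split.
    exact: (param_indep_rV hreg hQI hI2 hw).
  by case: q hq => // q /= -> _; apply: subm0.
case: h hq => u v /= [hu hv].
have ex' : x = rcons t a ++ s by rewrite cat_rcons.
have xa : x`_(size t) = a by rewrite ex nth_cat ltnn subnn.
set z := _ + _ => hz.
have hz1 : fst_lin _ _ z \in (ideal_mul I I) ** koszul s 'rV[R]_n by apply: lin_mulM.
have hz2 : snd_lin _ _ z \in (ideal_mul I I) ** koszul s 'rV[R]_n by apply: lin_mulM.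
have [|h1 h2] := IH (rcons t a) (fun k => if k == size t then v else (w k).1) u q ex' hu.
  rewrite size_rcons big_ord_recr /= eqxx xa; move: hz1.
  rewrite /z linearD linear_sum /= [kdiff u + _]addrC addrA.
  under [X in _ -> X + _ + _ \in _]eq_bigr => k _ do rewrite ltn_eqF //.
  by [].
have [q' hv'] : exists q', kdeg q' v by case: (q) hv => [->|q' h]; [exists 0%N; apply: kdeg0 | exists q'].
have [|h3 _] := IH (rcons t a) (fun k => if k == size t then 0 else (w k).2) (- v) q' ex' (kdegN hv').
  rewrite size_rcons big_ord_recr /= eqxx scaler0 addr0; move: hz2.
  rewrite /z linearD linear_sum /= linearN.
  under [X in _ -> X + _ \in _]eq_bigr => k _ do rewrite ltn_eqF //.
  by [].
split=> [k hk|q0].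
  have := h1 k; have := h3 k; rewrite size_rcons ltnS ltnW // ltn_eqF //.
  move=> /(_ isT) hk2 /(_ isT) hk1; rewrite [w k]surjective_pairing.
  exact/mulM_pair.
apply/mulM_pair; split; first exact: h2.
by have := h1 (size t); rewrite size_rcons ltnSn eqxx; apply.
Qed.

Lemma koszul_indep_diff n q (h : koszul x 'rV[R]_n) : kdeg q.+1 h ->
  kdiff h \in (ideal_mul I I) ** koszul x 'rV[R]_n -> h \in I ** koszul x 'rV[R]_n.
Proof.
move=> hq hh; have [|_ ->//] := @koszul_indep n x [::] (fun=> 0) h q.+1 erefl hq.
by rewrite big_ord0 add0r.
Qed.

Lemma koszul_rV_exact n q : (0 < q)%N -> kexact x ('rV[R]_n : lmodType R) q.
Proof.
move=> q0; apply: (koszul_acyclic (t := x)).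
- by move=> b hb; exists 1%N; rewrite expr1; apply: mem_generated.
- exact/regular_onP/regular_rV.
by rewrite -{1}[size x]add0n ltn_add2r.
Qed.

(* The properties of the syzygies of [R/I] that pass from a module to the kernel
   of its minimal cover; [j] counts the syzygies already taken. *)
Definition syzygy_class j X :=
  [/\ exists n (p : {linear 'rV[R]_n -> X}), [/\ (0 < n)%N, forall v, exists u, p u = v
        & forall u, p u = 0 -> u \in I ** 'rV[R]_n],
      {subset I ** X <= ideal_gen x ** X},
      forall q, (0 < q)%N -> exists (T : finType) (z : T -> koszul x X), koszul_basis I q z,
      forall q (w : koszul x X), (0 < q)%N -> kdeg q w -> kdiff w = 0 ->
        w \in ideal_gen x ** koszul x X -> exists2 w', kdeg q.+1 w' & kdiff w' = w
    & forall q, (0 < q)%N -> (size x < q + j)%N -> kexact x X q].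

(** * From a module to the kernel of its minimal cover *)

Section Step.
Variables (X : lmodType R) (j n : nat) (p : {linear 'rV[R]_n -> X}).
Hypothesis hX : syzygy_class j X.
Hypothesis n0 : (0 < n)%N.
Hypothesis ps : forall v, exists u, p u = v.
Hypothesis pI : forall u, p u = 0 -> u \in I ** 'rV[R]_n.
Let Z : lmodType R := submod (mker p).
Let i : {linear Z -> 'rV[R]_n} := subval (mker p).
Let hc : short_exact i p. Proof. exact: short_exact_ker. Qed.

Let ker_im q (w : koszul x 'rV[R]_n) : kdeg q w -> kmap p w = 0 ->
  exists2 w', kdeg q w' & kmap i w' = w.
Proof. by apply: kmap_exact => v; case: hc => _ _ h /h. Qed.
Let pi0 (w : koszul x Z) : kmap p (kmap i w) = 0.
Proof. by apply: kmap_comp0 => u; case: hc => _ _ h; apply/h; exists u. Qed.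
Let kinj : injective (@kmap R x Z 'rV[R]_n i). Proof. exact: kmap_inj. Qed.
Let kiD (a b : koszul x Z) : kmap i (a + b) = kmap i a + kmap i b.
Proof. exact: linearD. Qed.
Let iI z : i z \in I ** 'rV[R]_n. Proof. by apply: pI; apply/in_mker/subvalP. Qed.

(** In the complex of the free module, [w] bounds some [h], and [h] has coefficients in I by
    independence. Its image over [X] is a cycle in Q K(X), hence a boundary, and correcting [h] by a
    lift of it moves [h] into the complex of [Z]. *)
Let boundary_of_small q (w : koszul x Z) : kdeg q w -> kdiff w = 0 ->
  kmap i w \in (ideal_mul I I) ** koszul x 'rV[R]_n ->
  exists2 w', kdeg q.+1 w' & kdiff w' = w.
Proof.
move=> hw dw hs; have [_ hB _ hD _] := hX.
have [h hh eh] : exists2 h, kdeg q.+1 h & kdiff h = kmap i w.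
  case: q hw => [|q] hw; last first.
    by apply: koszul_rV_exact => //; [apply: kmap_deg | rewrite kmap_diff dw linear0].
  have [v ev] := kin_exists hw; rewrite -ev kmap_kin; apply/kin_bound.
  move: hs; rewrite -ev kmap_kin => /kin_mulM; apply: ideal_mulS => // a.
  by rewrite hI2; apply: ideal_mul_sub => b c hb hc'; apply: mem_idealMr.
have hhI : h \in I ** koszul x 'rV[R]_n by apply: (koszul_indep_diff hh); rewrite eh.
have [||||xi hxi exi] := hD q.+1 (kmap p h) => //.
- exact: kmap_deg.
- by rewrite kmap_diff eh pi0.
- by apply: koszul_mulMS hB _ _; apply: lin_mulM.
have [xi' hxi' exi'] := kmap_surj ps hxi.
have [||w' hw' ew'] := @ker_im q.+1 (h - kdiff xi').
- by apply: kdegB => //; apply: kdeg_diff.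
- by rewrite linearB /= -kmap_diff exi' exi subrr.
exists w' => //; apply: kinj.
by rewrite -kmap_diff ew' linearB /= kdiffK subr0.
Qed.

Let small_of_mulM (w : koszul x Z) : w \in ideal_gen x ** koszul x Z ->
  kmap i w \in (ideal_mul I I) ** koszul x 'rV[R]_n.
Proof.
move=> hw; have P v : v \in msub (fun w : koszul x Z => kmap i w \in (ideal_mul I I) ** koszul x 'rV[R]_n)
    <-> kmap i v \in (ideal_mul I I) ** koszul x 'rV[R]_n.
  apply: (@msubP _ (koszul x Z) (fun w => kmap i w \in (ideal_mul I I) ** koszul x 'rV[R]_n)).
    by rewrite linear0 subm0.
  by move=> a u v' hu hv; rewrite linearP; apply: submD => //; apply: submZ.
apply/P; move: w hw; apply: mulM_sub => a w ha; apply/P.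
by rewrite linearZ; apply: mulM_mul; [apply: hQI | apply: kmap_mulM].
Qed.

(** As Z lies in I F, the elements of I Z lie in I^2 F; in degree 0 such elements are boundaries,
    that is, elements of Q Z. *)
Lemma syzygy_ideal : {subset I ** Z <= ideal_gen x ** Z}.
Proof.
apply: mulM_sub => a z ha; apply/kin_bound; apply: boundary_of_small.
- exact: kin_deg.
- exact: kin_diff.
by rewrite kmap_kin; apply: (lin_mulM (@kin R x 'rV[R]_n)); rewrite linearZ; apply: mulM_mul.
Qed.

(** The connecting map H_(q+1)(X) -> H_q(Z) is injective since the complex of F is exact in degree q
    + 1. Its image consists of the cycles that bound over F: all of them for q > 0, the kernel of
    Z/QZ -> F/QF for q = 0. *)
Let connecting q : exists (T : finType) (z : T -> koszul x Z),
  [/\ forall t, [/\ kdeg q (z t), kdiff (z t) = 0 & exists2 h, kdeg q.+1 h & kdiff h = kmap i (z t)],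
      forall w, (exists2 h, kdeg q.+1 h & kdiff h = kmap i w) -> exists (c : T -> R) (w' : koszul x Z),
        kdeg q.+1 w' /\ w = \sum_t c t *: z t + kdiff w'
    & forall c : T -> R, (exists w' : koszul x Z, kdeg q.+1 w' /\ \sum_t c t *: z t = kdiff w')
        <-> forall t, c t \in I].
Proof.
have [_ _ hC _ _] := hX; have [T [z0 [z01 z02 z03]]] := hC q.+1 isT.
have /choice[h hh] t : exists h, kdeg q.+1 h /\ kmap p h = z0 t.
  by have [h h1 h2] := kmap_surj ps (z01 t).1; exists h.
have /choice[z hz] t : exists z, kdeg q z /\ kmap i z = kdiff (h t).
  have [||z h1 h2] := @ker_im q (kdiff (h t)); last by exists z.
    by apply/kdeg_diff/(hh t).1.
  by rewrite -kmap_diff (hh t).2 (z01 t).2.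
have isum (c : T -> R) : kmap i (\sum_t c t *: z t) = kdiff (\sum_t c t *: h t).
  rewrite !linear_sum; apply: eq_bigr => t _.
  by rewrite [LHS]linearZ [RHS]linearZ /= (hz t).2.
have psum (c : T -> R) : kmap p (\sum_t c t *: h t) = \sum_t c t *: z0 t.
  by rewrite linear_sum; apply: eq_bigr => t _; rewrite [LHS]linearZ /= (hh t).2.
have hdeg (c : T -> R) : kdeg q.+1 (\sum_t c t *: h t).
  by elim/big_ind: _ => [|a b|t _]; [exact: kdeg0 | exact: kdegD | apply/kdegZ/(hh t).1].
exists T, z; split=> [t|w [h' hh' eh']|c].
- split; [exact: (hz t).1 | | by exists (h t); [exact: (hh t).1 | rewrite (hz t).2]].
  by apply: kinj; rewrite -kmap_diff (hz t).2 kdiffK linear0.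
- have [||c [xi [hxi exi]]] := z02 (kmap p h'); first exact: kmap_deg.
    by rewrite kmap_diff eh' pi0.
  have [xi' hxi' exi'] := kmap_surj ps hxi.
  have [||w' hw' ew'] := @ker_im q.+1 (h' - \sum_t c t *: h t - kdiff xi').
  + by apply: kdegB; [apply: kdegB | apply: kdeg_diff].
  + by rewrite !linearB /= -kmap_diff exi' psum exi [X in X - _ - _]addrC addrK subrr.
  exists c, w'; split=> //; apply: kinj.
  rewrite kiD isum -kmap_diff ew' !linearB /= kdiffK subr0 eh'.
  by rewrite addrC subrK.
rewrite -z03; split=> [[w' [hw' ew']]|[xi [hxi exi]]].
  have [||xi hxi exi] := koszul_rV_exact (n := n) (ltn0Sn q) (w := \sum_t c t *: h t - kmap i w').
  - by apply: kdegB => //; apply: kmap_deg.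
  - by rewrite linearB [X in _ - X]kmap_diff -ew' isum subrr.
  exists (kmap p xi); split; first exact: kmap_deg.
  by rewrite kmap_diff exi linearB /= pi0 subr0 psum.
have [xi' hxi' exi'] := kmap_surj ps hxi.
have [||w' hw' ew'] := @ker_im q.+1 (\sum_t c t *: h t - kdiff xi').
- by apply: kdegB => //; apply: kdeg_diff.
- by rewrite linearB /= -kmap_diff exi' psum exi subrr.
exists w'; split=> //; apply: kinj.
by rewrite isum -kmap_diff ew' linearB /= kdiffK subr0.
Qed.

Let small_split u : u \in I ** 'rV[R]_n ->
  exists z, u - i z \in ideal_gen x ** 'rV[R]_n.
Proof.
have [_ hB _ _ _] := hX.
move=> /(lin_mulM p)/hB/(mulM_surj ps)[w hw ew].
have [_ _ /(_ (u - w))[h _]] := hc; have [|z ez] := h; first by rewrite linearB ew subrr.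
by exists z; rewrite ez opprB addrC subrK.
Qed.

(** Z/QZ is an extension of IF/QF, free over R/I on the vectors y_j e_l, by H_1(X), free by
    hypothesis. Lifts [b] of the former basis and images [v] of the latter generate Z, with
    relations only in I. *)
Lemma syzygy_cover : exists k (q : {linear 'rV[R]_k -> Z}), [/\ (0 < k)%N,
  forall v, exists u, q u = v & forall u, q u = 0 -> u \in I ** 'rV[R]_k].
Proof.
have [r [y [r0 yI gen indep]]] := ulrich_ideal_basis hnoeth hlocal hI hreg hQI hI2 hfree hne.
have [T [z [z1 z2 z3]]] := connecting 0.
have /choice[v hv] t : exists v, kin x v = z t by apply: kin_exists; case: (z1 t).
have vQ t : i (v t) \in ideal_gen x ** 'rV[R]_n.
  by apply/kin_bound; rewrite -kmap_kin hv; case: (z1 t).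
have /choice[b hb] (jl : 'I_r * 'I_n) :
    exists b, y jl.1 *: delta_mx 0 jl.2 - i b \in ideal_gen x ** 'rV[R]_n.
  by apply: small_split; apply: mem_mulM.
pose V (t : T + 'I_r * 'I_n) := match t with inl t => v t | inr jl => b jl end.
have VE (c : T + 'I_r * 'I_n -> R) : \sum_t c t *: V t =
    \sum_t c (inl t) *: v t + \sum_jl c (inr jl) *: b jl by rewrite big_sumType.
have delta_sum (c : 'I_r * 'I_n -> R) l :
    (\sum_jl c jl *: (y jl.1 *: delta_mx 0 jl.2 : 'rV[R]_n)) 0 l = \sum_k c (k, l) * y k.
  rewrite summxE.
  rewrite (eq_bigr (fun kl => (c (kl.1, kl.2) *: (y kl.1 *: delta_mx 0 kl.2 : 'rV[R]_n)) 0 l));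
    last by case.
  rewrite -(pair_bigA _ (fun k l' => (c (k, l') *: (y k *: delta_mx 0 l' : 'rV[R]_n)) 0 l)) /=.
  apply: eq_bigr => k _; rewrite (bigD1 l) //= !mxE !eqxx mulr1 big1 ?addr0 // => l' ne.
  by rewrite !mxE eq_sym (negbTE ne) !mulr0.
have b_delta (c : 'I_r * 'I_n -> R) :
    \sum_jl c jl *: (y jl.1 *: delta_mx 0 jl.2) - i (\sum_jl c jl *: b jl) \in ideal_gen x ** 'rV[R]_n.
  rewrite linear_sum -sumrB; apply: subm_sum => jl _.
  have -> : i (c jl *: b jl) = c jl *: i (b jl) by apply: linearZ.
  by rewrite -scalerBr; apply: submZ.
have kin_sum (c : T -> R) : kin x (\sum_t c t *: v t) = \sum_t c t *: z t.
  by rewrite linear_sum; apply: eq_bigr => t _; rewrite [LHS]linearZ /= hv.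
apply: (cover_of_family (v := V)).
- apply/card_gt0P; exists (inr (Ordinal r0, Ordinal n0)); by [].
- have SP w : w \in msub (fun w => exists c, w = \sum_t c t *: V t) <-> exists c, w = \sum_t c t *: V t.
    apply: (@msubP _ Z (fun w => exists c, w = \sum_t c t *: V t)).
      by exists (fun=> 0); rewrite big1 // => t _; rewrite scale0r.
    move=> a _ _ [c ->] [c' ->]; exists (fun t => a * c t + c' t).
    rewrite scaler_sumr -big_split; apply: eq_bigr => t _ /=.
    by rewrite scalerDl scalerA.
  move=> w; apply/SP; apply: (nakayama_top hnoeth hlocal) w.
    by apply: finite_submod => //; apply: finite_rV.
  move=> w; have /mulM_rV wI := iI w.
  have /choice[c hcl] l := gen _ (wI l).
  pose w1 := w - \sum_jl c jl.2 jl.1 *: b jl.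
  have w1Q : i w1 \in ideal_gen x ** 'rV[R]_n.
    have -> : i w1 = (i w - \sum_jl c jl.2 jl.1 *: (y jl.1 *: delta_mx 0 jl.2)) +
        (\sum_jl c jl.2 jl.1 *: (y jl.1 *: delta_mx 0 jl.2) - i (\sum_jl c jl.2 jl.1 *: b jl)).
      by rewrite linearB addrA subrK.
    apply: submD; last exact: (b_delta (fun jl => c jl.2 jl.1)).
    apply/mulM_rV => l; rewrite !mxE (delta_sum (fun jl => c jl.2 jl.1)).
    exact: hcl.
  have [|c' [w' [hw' ew']]] := z2 (kin x w1); first by rewrite kmap_kin; apply/kin_bound.
  have : w1 - \sum_t c' t *: v t \in ideal_gen x ** Z.
    by apply/kin_bound; exists w' => //; rewrite linearB /= kin_sum ew' addrC addKr.
  move=> hQ; exists (w1 - \sum_t c' t *: v t).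
    apply: ideal_mulS hQ => // a ha; apply: (ideal_sub_max hI); exact: hQI.
  apply/SP; exists (fun t => match t with inl t => c' t | inr jl => c jl.2 jl.1 end).
  rewrite VE opprB addrCA; congr (_ + _).
  by rewrite /w1 opprB addrCA subrr addr0.
move=> c; rewrite VE => e.
have hr jl : c (inr jl) \in I.
  case: jl => k l; apply: (indep (fun k => c (inr (k, l)))).
  rewrite -(delta_sum (fun jl => c (inr jl))); move: l {k}; apply/mulM_rV.
  rewrite -[X in X \in _](subrK (i (\sum_jl c (inr jl) *: b jl))).
  apply: submD; first exact: (b_delta (fun jl => c (inr jl))).
  have -> : \sum_jl c (inr jl) *: b jl = - \sum_t c (inl t) *: v t.
    by apply/eqP; rewrite -addr_eq0 addrC e.
  rewrite linearN; apply: submN; rewrite linear_sum; apply: subm_sum => t _.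
  by rewrite linearZ; apply: submZ.
suff hl t : c (inl t) \in I by case.
move: t; apply/(z3 (fun t => c (inl t))).
have : \sum_t c (inl t) *: v t \in ideal_gen x ** Z.
  have -> : \sum_t c (inl t) *: v t = - \sum_jl c (inr jl) *: b jl.
    by apply/eqP; rewrite -addr_eq0 e.
  apply: submN; apply: syzygy_ideal; apply: subm_sum => jl _; exact: mem_mulM.
by move=> /kin_bound[w hw ew]; exists w; rewrite -kin_sum ew.
Qed.

(** For q > 0, H_q(Z) is H_(q+1)(X), so each syzygy lowers by one the degree beyond which Koszul
    homology vanishes. *)
Lemma syzygy_step : syzygy_class j.+1 Z.
Proof.
have [_ hB hC hD hE] := hX; split.
- exact: syzygy_cover.
- exact: syzygy_ideal.
- move=> q q0; have [T [z [z1 z2 z3]]] := connecting q; exists T, z; split=> // [t|w hw dw].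
    by have [h1 h2 _] := z1 t.
  apply: z2; apply: koszul_rV_exact => //; first exact: kmap_deg.
  by rewrite kmap_diff dw linear0.
- move=> q w q0 hw dw hs; apply: boundary_of_small => //.
  exact: small_of_mulM.
move=> q q0 hq w hw dw.
have [||h hh eh] := koszul_rV_exact (n := n) q0 (w := kmap i w).
- exact: kmap_deg.
- by rewrite kmap_diff dw linear0.
have hq' : (size x < q.+1 + j)%N by rewrite addSnnS.
have [||xi hxi exi] := hE q.+1 isT hq' (kmap p h).
- exact: kmap_deg.
- by rewrite kmap_diff eh pi0.
have [xi' hxi' exi'] := kmap_surj ps hxi.
have [||w' hw' ew'] := @ker_im q.+1 (h - kdiff xi').
- by apply: kdegB => //; apply: kdeg_diff.
- by rewrite linearB /= -kmap_diff exi' exi subrr.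
exists w' => //; apply: kinj.
by rewrite -kmap_diff ew' linearB /= kdiffK subr0.
Qed.
End Step.
Lemma quot_annihilated (a : R) (q : (quotmod I : lmodType R)) : a \in I -> a *: q = 0.
Proof.
move=> ha; have [r <-] := quotpi_surj q; rewrite -linearZ; apply/quotpi_eq0.
exact: (mem_idealMr r ha).
Qed.

Lemma syzygy_base : syzygy_class 0 (quotmod I).
Proof.
(* The parameters kill R/I, so its Koszul homology is the complex itself, free over R/I. *)
have kd (w : koszul x (quotmod I)) : kdiff w = 0.
  apply: kdiff_annihilated => b hb v; apply: quot_annihilated.
  by apply: hQI; apply: mem_generated.
have small (V : lmodType R) (w : V) : (forall a (v : V), a \in I -> a *: v = 0) ->
    w \in I ** V -> w = 0.
  move=> hV hw; have P z : z \in msub (fun z : V => z = 0) <-> z = 0.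
    apply: (@msubP _ V (fun z => z = 0)) => // a _ _ -> ->.
    by rewrite scaler0 addr0.
  by apply/P; move: w hw; apply: mulM_sub => a w ha; apply/P; apply: hV.
have kann s a (w : koszul s (quotmod I)) : a \in I -> a *: w = 0.
  move=> ha; elim: s w => [|b s IH] w; first exact: quot_annihilated.
  by case: w => u v; rewrite pairZ !IH.
split.
- exists 1%N, (comp_lin (quotpi I) (coord_lin R 0)); split=> // [q|u].
    have [r <-] := quotpi_surj q; exists (const_mx r).
    by rewrite comp_linE; congr (quotpi I _); rewrite /= mxE.
  rewrite comp_linE => /quotpi_eq0 h; apply/mulM_rV => k; rewrite (ord1 k); exact: h.
- by move=> q /small -> //; [exact: subm0 | exact: quot_annihilated].
- move=> q _; have [T [z [z1 z2 z3]]] := koszul_quot_basis I x q; exists T, z; split=> [t|w hw _|c].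
  + by split; [apply: z1 | apply: kd].
  + have [c ->] := z2 w hw; exists c, 0; split; first exact: kdeg0.
    by rewrite linear0 addr0.
  by rewrite -z3; split=> [[w' [_ ->]]|->]; [apply: kd | exists 0; split; [apply: kdeg0 | rewrite kd]].
- move=> q w _ _ _ hw; exists 0; first exact: kdeg0.
  rewrite kd; apply/esym/small; first by move=> a v; apply: kann.
  by apply: ideal_mulS hw.
move=> q _; rewrite addn0 => hq w hw _; exists 0; first exact: kdeg0.
by rewrite kd (kdeg_gt hq hw).
Qed.

Lemma ulrich_cover_of_class j X n (p : {linear 'rV[R]_n -> X}) : (size x <= j)%N ->
  syzygy_class j X -> (0 < n)%N -> (forall v, exists u, p u = v) ->
  (forall u, p u = 0 -> u \in I ** 'rV[R]_n) -> ulrich_cover I x p.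
Proof.
move=> hj [_ hB _ _ hE] n0 ps pI; split=> //.
have hXf : finite_module X by apply: finite_surj ps (finite_rV R n).
have xm := param_sub hx.
apply: (regular_param hnoeth hlocal hx (s := rev x)) => //.
- by move=> a; rewrite mem_rev; apply: xm.
- apply: (koszul_regular hnoeth hlocal) => // q q0; apply: hE => //.
  by rewrite -add1n; apply: leq_add.
by rewrite size_rev.
Qed.

Section WithResolution.
Variables (E : nat -> lmodType R) (e : {linear R^o -> E 0%N})
  (dE : forall n, {linear E n -> E n.+1}).
Hypothesis Einj : forall n, injective_module (E n).
Hypothesis einj : injective e.
Hypothesis Eexact0 : mim e =i mker (dE 0%N).
Hypothesis EexactS : forall n, mim (dE n) =i mker (dE n.+1).

(** Dimension shifting along minimal covers; that I annihilates Ext is inherited from R/I through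
    the connecting maps. *)
Lemma syzygy_exists j : exists X, [/\ syzygy_class j X,
  forall n, ext_zero dE n.+1 X <-> ext_zero dE (n + j).+1 (quotmod I),
  forall n c (f : {linear X -> E n.+1}), c \in I -> cocycle dE f -> null dE (scale_lin c f)
  & (0 < j)%N -> exists k (i : {linear X -> 'rV[R]_k}), injective i].
Proof.
elim: j => [|j [X [hX hext hkill _]]].
  exists (quotmod I); split=> //; first exact: syzygy_base.
    by move=> n; rewrite addn0.
  move=> n c f hc _; exists (lin_of (0 : Hom (quotmod I) (E n))) => v.
  by rewrite hom0 linear0 /= -linearZ quot_annihilated // linear0.
have [[n [p [n0 ps pI]]] _ _ _ _] := hX.
have hc := short_exact_ker ps.
exists (submod (mker p)); split.
- exact: syzygy_step.
- by move=> k; rewrite (ext_zero_shift Einj EexactS k hc) hext addSnnS.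
- move=> k c f cI cf.
  apply: (ext_kill_left Einj EexactS hc _ _ cf); first exact: ext_zero_rV.
  by move=> g cg; apply: hkill.
by move=> _; exists n, (subval (mker p)); apply: subval_inj.
Qed.

(* Two regular elements on [lambda M] suffice: a functional [f] on the relations
   with [x_0 f] and [x_1 f] extendable gives an element of [lambda M]
   divisible by [x_0]. *)
Lemma lambda_regular_ext_one M n (p : {linear 'rV[R]_n -> M}) : (2 <= size x)%N ->
  mincover m p -> regular_on (lambda m M) x ->
  (forall c (f : {linear M -> E 1}), c \in I -> cocycle dE f -> null dE (scale_lin c f)) ->
  ext_zero dE 1 M.
Proof.
move=> hd hp hL hkill; have hc := short_exact_ker hp.1.
apply: (extend_ext_one einj Eexact0 hc); first exact: ext_zero_rV.
move=> f.
have xI k : (k < size x)%N -> x`_k \in I.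
  by move=> hk; apply: hQI; apply: mem_generated; apply: mem_nth.
have ext k : (k < size x)%N -> exists u, forall z, dot u (subval (mker p) z) = x`_k * f z.
  move=> hk; have [g cg|h hh] := ext_kill_one Einj einj Eexact0 EexactS (c := x`_k) hc _ f.
    by apply: hkill => //; apply: xI.
  by have [u hu] := functional_dot h; exists u => z; rewrite -hu hh.
have [u0 hu0] := ext 0%N (ltnW hd); have [u1 hu1] := ext 1%N hd.
have [theta [ts tk]] := lambda_cover hnoeth hlocal hp.
(* Both sides restrict to x_0 x_1 f on the relations. *)
have e01 : x`_1 *: theta u0 = x`_0 *: theta u1.
  apply/eqP; rewrite -subr_eq0 -!linearZ -linearB; apply/eqP/tk => z pz.
  have [z' <-] : exists z', subval (mker p) z' = z by apply/subval_exists/in_mker.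
  rewrite dotC dotBr !dotZr ![dot (subval _ _) _]dotC hu0 hu1.
  by rewrite mulrCA subrr.
have take1 (V : lmodType R) (v : V) : v \in ideal_gen (take 1 x) ** V <-> exists w, v = x`_0 *: w.
  by rewrite (take_nth 0 (ltnW hd)) take0 /=; apply: gmul_seq1.
have /take1[w hw] : theta u0 \in ideal_gen (take 1 x) ** lambda m M.
  by apply: (hL 1%N hd); rewrite e01; apply/take1; exists (theta u1).
have [w' ew'] := ts w.
exists (dot_lin w') => z /=; apply/eqP; rewrite -subr_eq0; apply/eqP.
(* It remains to cancel x_0, which is regular on R, from x_0 (w' - f) = 0. *)
suff : (dot w' (subval _ z) - f z : R^o) \in ideal_gen (take 0 x) ** R^o.
  by rewrite take0 => /gmul_nil.
apply: (hreg (ltnW hd)); rewrite take0; apply/gmul_nil.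
have /tk/(_ (subval _ z)) : theta (u0 - x`_0 *: w') = 0.
  by rewrite linearB linearZ ew' hw subrr.
rewrite dotC dotBr dotZr ![dot (subval _ _) _]dotC hu0 => h.
rewrite -[LHS]/(x`_0 * (dot w' (subval _ z) - f z)) mulrBr -opprB h ?oppr0 //.
exact/in_mker/subvalP.
Qed.

End WithResolution.
End Syzygies.

(** * Vanishing of Ext and the Gorenstein property *)

Section GorensteinCriterion.
Variables (R : comNzRingType) (m : ideal R).
Hypothesis hnoeth : noetherian_ring R.
Hypothesis hlocal : local_ring m.
Variables (E : nat -> lmodType R) (e : {linear R^o -> E 0%N})
  (dE : forall n, {linear E n -> E n.+1}).
Hypothesis Einj : forall n, injective_module (E n).
Hypothesis einj : injective e.
Hypothesis Eexact0 : mim e =i mker (dE 0%N).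
Hypothesis EexactS : forall n, mim (dE n) =i mker (dE n.+1).
Implicit Types (J K : ideal R).

Lemma ext_zero_trivial n (M : lmodType R) : (forall v : M, v = 0) -> ext_zero dE n M.
Proof.
move=> h0; case: n => [|n] f _; first by move=> v; rewrite (h0 v) linear0.
by exists (lin_of (0 : Hom M (E n))) => v; rewrite hom0 (h0 v) !linear0.
Qed.

Lemma ext_zero_quot_eq n J K : J =i K -> ext_zero dE n (quotmod J) -> ext_zero dE n (quotmod K).
Proof.
move=> hJK; have [a /quotpi_eq0 ha|f hf] := factor_surj (f := quotpi K) (@quotpi_surj _ _ J).
  by apply/quotpi_eq0; rewrite -hJK.
apply: (iffLR (ext_zero_iso dE n (f := f) _ _)).
  apply: inj_lin => q; have [a <-] := quotpi_surj q; rewrite hf => /quotpi_eq0 ha.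
  by apply/quotpi_eq0; rewrite hJK.
by move=> q; have [a <-] := quotpi_surj q; exists (quotpi J a).
Qed.

Lemma adjoin_exact J (a : R) : exists K (p : {linear quotmod J -> quotmod K}),
  [/\ {subset J <= K}, a \in K, forall q, exists b, p b = q
    & forall q, p q = 0 <-> exists r : R, q = quotpi J (r * a)].
Proof.
have KP b : b \in msub (fun b : R^o => exists c : R, exists2 j, j \in J & b = c * a + j) <->
    exists c : R, exists2 j, j \in J & b = c * a + j.
  apply: (@msubP _ R^o (fun b => exists c : R, exists2 j, j \in J & b = c * a + j)).
    by exists 0, 0; rewrite ?subm0 // mul0r addr0.
  move=> r _ _ [c [j hj ->]] [c' [j' hj' ->]]; exists (r * c + c'), (r * j + j').
    exact: (submD (submZ r hj) hj').
  by rewrite scalerDr mulrDl -mulrA addrACA.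
set K := msub _ in KP.
have JK : {subset J <= K} by move=> b hb; apply/KP; exists 0, b; rewrite // mul0r add0r.
have [|p hp] := factor_surj (f := quotpi K) (@quotpi_surj _ _ J).
  by move=> b /quotpi_eq0 /JK hb; apply/quotpi_eq0.
exists K, p; split=> //.
- by apply/KP; exists 1, 0; rewrite ?subm0 // mul1r addr0.
- by move=> q; have [b <-] := quotpi_surj q; exists (quotpi J b).
move=> q; have [b <-] := quotpi_surj q; rewrite hp quotpi_eq0 KP; split.
  move=> [c [j hj ->]]; exists c; have /quotpi_eq0 ej := hj.
  by rewrite linearD ej addr0.
case=> r er; exists r, (b - r * a); last by rewrite addrC subrK.
by apply/quotpi_eq0; rewrite linearB er subrr.
Qed.

Lemma colon_exact J (a : R) : exists K (i : {linear quotmod K -> quotmod J}),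
  [/\ forall b : R, b \in K <-> b * a \in J, injective i
    & forall r : R, i (quotpi K r) = quotpi J (r * a)].
Proof.
have KP (b : R) : b \in msub (fun b : R^o => (b : R) * a \in J) <-> b * a \in J.
  apply: (@msubP _ R^o (fun b => (b : R) * a \in J)); first by rewrite mul0r; apply: (subm0 J).
  move=> r c c' hb hc; rewrite mulrDl -mulrA.
  exact: (submD (submZ r hb) hc).
set K := msub _ in KP.
have [||i hi] := factor_surj (p := quotpi K) (f := comp_lin (quotpi J) (mulv_lin (a : R^o))).
- exact: quotpi_surj.
- by move=> b /quotpi_eq0/KP hb; apply/quotpi_eq0.
exists K, i; split=> //.
apply: inj_lin => q; have [b <-] := quotpi_surj q; rewrite hi comp_linE => /quotpi_eq0 hb.
by apply/quotpi_eq0/KP.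
Qed.

(* Noetherian induction: an ideal maximal among those with nonvanishing [Ext]
   is prime, hence maximal by Nakayama. *)
Lemma ext_zero_all_quotients d : (forall n, (d <= n)%N -> ext_zero dE n.+1 (quotmod m)) ->
  forall J n, (d <= n)%N -> ext_zero dE n.+1 (quotmod J).
Proof.
move=> hm J0 n0 hn0; apply: contrapT => hno.
have [J [[n [hn hJ]] _ Jmax]] := noetherian_max hnoeth
  (Pr := fun J => exists n, (d <= n)%N /\ ~ ext_zero dE n.+1 (quotmod J))
  (ex_intro _ n0 (conj hn0 hno)).
have above K (a : R) : {subset J <= K} -> a \in K -> a \notin J ->
    forall k, (d <= k)%N -> ext_zero dE k.+1 (quotmod K).
  move=> JK aK /negP aJ k hk; apply: contrapT => hK; apply: aJ.
  by apply: (Jmax K) => //; exists k.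
have J1 : (1 : R) \notin J.
  apply/negP => h1; apply: hJ; apply: ext_zero_trivial => q; have [r <-] := quotpi_surj q.
  by apply/quotpi_eq0; rewrite -[r]mulr1; apply: mem_idealMl.
(* Otherwise both outer terms of 0 -> R/(J : a) -> R/J -> R/(J + Ra) -> 0 belong to strictly larger
   ideals. *)
have prime (a b : R) : b * a \in J -> a \notin J -> b \in J.
  move=> hab aJ; apply: contraT => bJ; exfalso; apply: hJ.
  have [K [i [KP ii iE]]] := colon_exact J a.
  have [K' [p [JK' aK' ps pk]]] := adjoin_exact J a.
  have hip : short_exact i p.
    split=> // q; rewrite pk; split=> [[r ->]|[q' <-]]; first by exists (quotpi K r).
    by have [r <-] := quotpi_surj q'; exists r; rewrite iE.
  apply: (ext_zero_mid Einj EexactS hip).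
    apply: (above K b) => //; last exact/KP.
    by move=> c hc; apply/KP; apply: mem_idealMr.
  exact: (above K' a).
have Jm := proper_ideal_sub hnoeth hlocal J1.
have [mJ|] := pselect {subset m <= J}.
  apply: hJ; apply: (@ext_zero_quot_eq _ m); last exact: hm.
  by move=> a; apply/idP/idP; [apply: mJ | apply: Jm].
move=> h; apply: h => a am; apply: contraT => aJ; exfalso; apply: hJ.
have [K' [p [JK' aK' ps pk]]] := adjoin_exact J a.
(* J being prime, [a] is regular on R/J; Ext^(n+2) vanishes for the larger ideal J + Ra, and
   Nakayama applies. *)
have hip : @short_exact R (quotmod J) (quotmod J) (quotmod K') (scale_lin a (id_lin _)) p.
  split=> // [|q].
    apply: inj_lin => q; have [r <-] := quotpi_surj q; rewrite scale_idE -linearZ.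
    move=> /quotpi_eq0 har; apply/quotpi_eq0; apply: prime aJ; rewrite mulrC; exact: har.
  rewrite pk; split=> [[r ->]|[q' <-]].
    by exists (quotpi J r); rewrite scale_idE -linearZ mulrC.
  by have [r <-] := quotpi_surj q'; exists r; rewrite scale_idE -linearZ mulrC.
apply: (ext_zero_nakayama Einj einj Eexact0 EexactS hnoeth hlocal _ am hip).
  apply: finite_quot; exists [:: 1 : R^o] => r.
  by apply/generated_cons; exists r, 0; rewrite subm0 addr0; split=> //; rewrite [RHS]mulr1.
by apply: (above K' a) => //; apply: leqW.
Qed.

End GorensteinCriterion.

(** * The implications between the assertions *)

Section Main.
Variables (R : comNzRingType) (m I : ideal R) (x : seq R).
Hypothesis hnoeth : noetherian_ring R.
Hypothesis hlocal : local_ring m.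
Hypothesis hdim : krull_dim R (size x).
Hypothesis hI : primary_to m I.
Hypothesis hx : primary_to m (ideal_gen x).
Hypothesis hreg : regular_on (R^o : lmodType R) x.
Hypothesis hQI : {subset ideal_gen x <= I}.
Hypothesis hI2 : ideal_mul I I =i ideal_mul (ideal_gen x) I.
Hypothesis hfree : free_over_quot I (quotmod (mtrace I (ideal_mul I I))).
Hypothesis hne : exists2 a : R, a \in I & a \notin ideal_gen x.

Lemma ulrich_module_iso (M N : lmodType R) : isomorphic M N ->
  Ulrich_module m I (ideal_gen x) M -> Ulrich_module m I (ideal_gen x) N.
Proof.
move=> /isomorphicP[f [fi fs]] /(cover_of_ulrich_module hnoeth hlocal hI hx hdim)[n [p hp]].
apply: (ulrich_module_of_cover hI hx hQI hdim (p := comp_lin f p)).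
have [n0 ps pI hM hIQ] := hp.
have back J v : f v \in J ** N -> v \in J ** M.
  by move=> /(mulM_surj fs)[w hw /fi <-].
split=> //.
- by move=> w; have [v <-] := fs w; have [u <-] := ps v; exists u.
- by move=> u; rewrite comp_linE => h; apply: pI; apply: fi; rewrite h linear0.
- move=> i hi w; have [v <-] := fs w; rewrite -linearZ => /back hv.
  exact/lin_mulM/(hM i hi).
by move=> w; have [v <-] := fs w; move=> /back/hIQ; apply: lin_mulM.
Qed.

Lemma gorenstein_lambda_ulrich (M : lmodType R) : Gorenstein R ->
  Ulrich_module m I (ideal_gen x) M -> Ulrich_module m I (ideal_gen x) (lambda m M).
Proof.
move=> [E [e [dE [Einj einj E0 ES [b hb]]]]].
move=> /(cover_of_ulrich_module hnoeth hlocal hI hx hdim)[n [p hp]].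
have hbig k (N : lmodType R) : (b <= k)%N -> ext_zero dE k.+1 N.
  move=> hk f _; exists (lin_of (0 : Hom N (E k))) => v.
  by rewrite hom0 linear0; apply: hb.
(* The length [b] of the resolution is not compared with d: vanishing starts at the larger of the
   two and is brought down to d. *)
have hIext k : (size x <= k)%N -> ext_zero dE k.+1 (quotmod I).
  move=> hk; apply: (ext_zero_quot_all hnoeth hlocal hI hreg hQI hI2 hfree hne Einj ES
    (n := maxn b (size x))) => //; first exact: leq_maxr.
  by apply: hbig; apply: leq_maxl.
have hM := ext_zero_ulrich hnoeth hlocal hx hQI Einj einj E0 ES hp hIext.
have [theta [ts tk]] := lambda_cover hnoeth hlocal (ulrich_cover_mincover hI hp).
apply: (ulrich_module_of_cover hI hx hQI hdim (p := theta)).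
exact: (lambda_ulrich_cover hnoeth hlocal hI hreg hQI hI2 hfree hne Einj einj E0 ES hp hM ts tk).
Qed.

Lemma gorenstein_lambda_preserves : Gorenstein R -> lambda_preserves_Ulrich m I (ideal_gen x).
Proof.
move=> hG M [hM iso]; split; first exact: gorenstein_lambda_ulrich.
by move=> /(gorenstein_lambda_ulrich hG); apply: ulrich_module_iso; apply: isomorphic_sym.
Qed.

Lemma lambda_CM_ext_zero : (2 <= size x)%N -> lambda_Ulrich_maximal_CM m I (ideal_gen x) ->
  Ext_vanishes (size x).+2 (quotmod I) (R^o : lmodType R).
Proof.
move=> hd hiii.
have Einj := @inj_res_injective R; have einj := @inj_aug_inj R.
have E0 := @inj_res_exact0 R; have ES := @inj_res_exactS R.
(* After d + 1 syzygies, Ext^1(X, R) is Ext^(d+2)(R/I, R). *)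
have [X [hX hext hkill /(_ isT)[k [i ii]]]] := syzygy_exists hnoeth hlocal hI hreg
  hQI hI2 hfree hne Einj ES (size x).+1.
have [[n [p [n0 ps pI]]] _ _ _ _] := hX.
have hp : ulrich_cover I x p.
  exact: (ulrich_cover_of_class hnoeth hlocal hx (leqnSn _) hX n0 ps pI).
have hmin := ulrich_cover_mincover hI hp.
have hlink : horizontally_linked m X.
  apply: (torsionless_linked hnoeth hlocal hmin _ ii) => u.
  exact: (ulrich_cover_stable hnoeth hlocal hne hp).
have hCM := hiii X hlink (ulrich_module_of_cover hI hx hQI hdim hp).
have h1 : ext_zero (@inj_diff R) 1 X.
  apply: (lambda_regular_ext_one hnoeth hlocal hreg hQI Einj einj E0 ES hd hmin).
    exact: maximal_CM_regular hCM.
  by move=> c f; apply: hkill.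
have [|F _] := @free_resolution_exists R hnoeth (quotmod I).
  apply: finite_quot; exists [:: 1 : R^o] => r.
  by apply/generated_cons; exists r, 0; rewrite subm0 addr0; split=> //; rewrite [RHS]mulr1.
by exists F; apply/(ext_zeroP Einj einj E0 ES F); apply/(hext 0%N).
Qed.

Lemma ext_zero_gorenstein : I =i m ->
  Ext_vanishes (size x).+2 (quotmod I) (R^o : lmodType R) -> Gorenstein R.
Proof.
move=> hIm [F hF].
have Einj := @inj_res_injective R; have einj := @inj_aug_inj R.
have E0 := @inj_res_exact0 R; have ES := @inj_res_exactS R.
apply: (@gorenstein_of_ext_zero R (size x)) => J.
apply: (ext_zero_all_quotients hnoeth hlocal Einj einj E0 ES (d := size x)) => // n hn.
apply: (ext_zero_quot_eq (J := I)) => //.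
(* Degrees are offset by one: (iv) is the case n = d + 1 of the vanishing of Ext^(n+1). *)
apply: (ext_zero_quot_all hnoeth hlocal hI hreg hQI hI2 hfree hne Einj ES (n := (size x).+1)) => //.
exact/(ext_zeroP Einj einj E0 ES F).
Qed.

End Main.

Theorem theorem4p1 (R : comNzRingType) (m : ideal R) (d : nat)
    (I : ideal R) (x : d.-tuple R)
    (hnoeth : noetherian_ring R)
    (hlocal : local_ring m)
    (hdim : krull_dim R d)
    (hCM : maximal_CM m (R^o : lmodType R))
    (hI : primary_to m I)
    (hx : primary_to m (ideal_gen x))
    (hred : reduction (ideal_gen x) I)
    (hUlrich : Ulrich_ideal I (ideal_gen x))
    (hnpar : ~ parameter_ideal m I) :
  let Q := ideal_gen x in
  let i := Gorenstein R in
  let ii := lambda_preserves_Ulrich m I Q in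
  let iii := lambda_Ulrich_maximal_CM m I Q in
  let iv := Ext_vanishes d.+2 (quotmod I) (R^o : lmodType R) in
  [/\ (i -> ii) /\ (ii -> iii),
      (2 <= d)%N -> iii -> iv
    & (2 <= d)%N -> I =i m ->
      [/\ i <-> ii, ii <-> iii & iii <-> iv]].
Proof.
have [hI2 hfree] := hUlrich; have [hQI _] := hred.
have hne : exists2 a : R, a \in I & a \notin ideal_gen x.
  apply: contrapT => hno; apply: hnpar; exists d, x; split=> // a.
  apply/idP/idP; last exact: hQI.
  by move=> aI; apply: contraT => aQ; case: hno; exists a.
move=> Q i ii iii iv.
have hdx : krull_dim R (size x) by rewrite size_tuple.
have hreg := maximal_CM_regular hnoeth hlocal hx hdx hCM.
have i_ii : i -> ii.
  exact: (gorenstein_lambda_preserves hnoeth hlocal hdx hI hx hreg hQI hI2 hfree hne).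
have ii_iii : ii -> iii.
  by move=> h M hM hU; have [] := (h M hM).1 hU.
have iii_iv : (2 <= d)%N -> iii -> iv.
  have := lambda_CM_ext_zero hnoeth hlocal hdx hI hx hreg hQI hI2 hfree hne.
  by rewrite size_tuple.
have iv_i : I =i m -> iv -> i.
  have := ext_zero_gorenstein hnoeth hlocal hI hreg hQI hI2 hfree hne.
  by rewrite size_tuple.
split=> // hd hIm; have h1 := iii_iv hd; have h2 := iv_i hIm.
by split; split=> // h; [apply/h2/h1/ii_iii | apply/i_ii/h2/h1 | apply/ii_iii/i_ii/h2].
Qed.
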